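(* Let $p$ be a prime, $K$ a $p$-adic field and $k\ge1$. Let $\mathcal{F}/K$ be a finite Galois extension, and suppose that $\mathcal{F}$ has the correspondence property $(C_k)$ defined in the context. Let $\tilde{\mathcal{F}}$ be a field, Galois over $K$. Then $\tilde{\mathcal{F}}$ also has property $(C_k)$ in each of the following cases: (i) $\tilde{\mathcal{F}}$ is an extension of $\mathcal{F}$ and $[\tilde{\mathcal{F}}:\mathcal{F}]$ is finite and coprime to $p$; (ii) $\tilde{\mathcal{F}}$ is the subfield of $\mathcal{F}$ fixed by the $p$-core of $\mathrm{Gal}(\mathcal{F}/K)$.
   Context: All extensions are inside a fixed algebraic closure of $K$. The $p$-core of a finite group is the intersection of all its $p$-Sylow subgroups. An extension $L/K$ has no intermediate extension if the only fields between $K$ and $L$ are $K$ and $L$. For a field $E$ and a subgroup $\Xi\subset E^\times/(E^\times)^p$, $E(\Xi^{1/p})$ is the field generated over $E$ by all $p$-th roots of elements of $E^\times$ with class in $\Xi$. Property $(C_k)$ for a finite Galois extension $E/K$: there is a natural one-to-one correspondence between the isomorphism classes $[L/K]$ of extensions $L/K$ of degree $p^k$ having no intermediate extension and the irreducible $\mathrm{Gal}(E/K)$-submodules $\Xi\subset E^\times/(E^\times)^p$ of dimension $k$ over $\mathbb{F}_p$, where $[L/K]$ corresponds to the $\Xi$ with $LE=E(\Xi^{1/p})$; and $\mathrm{Gal}(LE/K)$ is always a split extension of $\mathrm{Gal}(E/K)$. *)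

(* Defs.v *)
From HB Require Import structures.
From mathcomp Require Import all_boot all_order all_algebra.
From mathcomp Require Import all_fingroup all_solvable all_field.
From mathcomp Require Import mathcomp_extra boolp classical_sets.

Set Implicit Arguments.
Unset Strict Implicit.
Unset Printing Implicit Defensive.

Import Order.TTheory GRing.Theory Num.Theory.

Local Open Scope ring_scope.

(* |r|_p = p ^ (v_p(denominator) - v_p(numerator)), and |0|_p = 0. *)
Definition padic_norm (p : nat) (r : rat) : rat :=
  if r == 0 then 0
  else (p%:R : rat) ^ ((logn p `|denq r|%N)%:Z - (logn p `|numq r|%N)%:Z).

(* (Q, a) is the completion of the field of rational numbers for |.|_p; this
   determines (Q, a) up to a unique isomorphism.  The absolute value of Q_p
   takes the same values as |.|_p, so that it can be given values in rat. *)
Record is_Qp (p : nat) (Q : fieldType) (a : Q -> rat) : Prop := IsQp {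
  Qp_abs_ge0 : forall x, 0 <= a x;
  Qp_abs_eq0 : forall x, a x = 0 -> x = 0;
  Qp_absM : forall x y, a (x * y) = a x * a y;
  Qp_absD : forall x y, a (x + y) <= a x + a y;
  Qp_abs_ratr : forall r : rat, a (ratr r) = padic_norm p r;
  Qp_dense : forall x (eps : rat), 0 < eps -> exists r : rat, a (x - ratr r) < eps;
  Qp_complete : forall u : nat -> Q,
    (forall eps : rat, 0 < eps ->
       exists N, forall m n, (N <= m)%N -> (N <= n)%N -> a (u m - u n) < eps) ->
    exists l, forall eps : rat, 0 < eps ->
       exists N, forall n, (N <= n)%N -> a (u n - l) < eps
}.

Section PowerClasses.

Variables (p : nat) (p_pr : prime p) (E : fieldType).

Definition nonzero := {x : E | x != 0}.

Fact nz1_subproof : (1 : E) != 0. Proof. exact: oner_neq0. Qed.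
Fact nzM_subproof (x y : nonzero) : val x * val y != 0.
Proof. by rewrite mulf_neq0 ?(valP x) ?(valP y). Qed.
Fact nzV_subproof (x : nonzero) : (val x)^-1 != 0.
Proof. by rewrite invr_eq0 (valP x). Qed.

Definition nz1 : nonzero := Sub 1 nz1_subproof.
Definition nzM (x y : nonzero) : nonzero := Sub (val x * val y) (nzM_subproof x y).
Definition nzV (x : nonzero) : nonzero := Sub (val x)^-1 (nzV_subproof x).

Definition eqmodX (x y : nonzero) : bool :=
  `[< exists z : nonzero, val x = val y * val z ^+ p >].

Fact eqmodX_refl : reflexive eqmodX.
Proof. by move=> x; apply/asboolP; exists nz1; rewrite /= expr1n mulr1. Qed.

Fact eqmodX_imp x y : eqmodX x y -> eqmodX y x.
Proof.
move=> /asboolP[z xE]; apply/asboolP; exists (nzV z).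
by rewrite xE /= exprVn mulfK // expf_neq0 // (valP z).
Qed.

Fact eqmodX_sym : symmetric eqmodX.
Proof. by move=> x y; apply/idP/idP; exact: eqmodX_imp. Qed.

Fact eqmodX_trans : transitive eqmodX.
Proof.
move=> y x z /asboolP[u xE] /asboolP[v yE]; apply/asboolP; exists (nzM v u).
by rewrite xE yE /= exprMn mulrA.
Qed.

Canonical eqmodX_equiv := EquivRel eqmodX eqmodX_refl eqmodX_sym eqmodX_trans.

Local Open Scope quotient_scope.
Local Notation repr := generic_quotient.repr.

(* The group E^* / (E^* )^p, written additively, as a vector space over 'F_p.
   The argument p_pr only serves to provide the latter structure. *)
Definition pclasses of prime p := {eq_quot eqmodX_equiv}.

Local Notation V := (pclasses p_pr).

HB.instance Definition _ := Choice.on V.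
HB.instance Definition _ : EqQuotient _ eqmodX_equiv V := EqQuotient.on V.

Lemma eqmodXP (x y : nonzero) :
  reflect (exists z : nonzero, val x = val y * val z ^+ p)
          (\pi_V x == \pi_V y).
Proof. by rewrite piE; apply: asboolP. Qed.

Fact pi_ext (x y : nonzero) : val x = val y -> \pi_V x = \pi_V y.
Proof. by move=> /val_inj ->. Qed.

Definition pcl_add (x y : V) : V := \pi_V (nzM (repr x) (repr y)).
Definition pcl_opp (x : V) : V := \pi_V (nzV (repr x)).
Definition pcl_zero : V := \pi_V nz1.

Fact pcl_repr (x : nonzero) :
  exists z : nonzero, val (repr (\pi_V x)) = val x * val z ^+ p.
Proof. by apply/eqmodXP; rewrite reprK. Qed.

Fact pcl_addE x y : pcl_add (\pi_V x) (\pi_V y) = \pi_V (nzM x y).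
Proof.
have [u uE] := pcl_repr x; have [v vE] := pcl_repr y.
apply/eqP/eqmodXP; exists (nzM u v).
by rewrite /= uE vE exprMn mulrACA.
Qed.

Fact pcl_oppE x : pcl_opp (\pi_V x) = \pi_V (nzV x).
Proof.
have [u uE] := pcl_repr x.
by apply/eqP/eqmodXP; exists (nzV u); rewrite /= uE invfM exprVn.
Qed.

Fact pcl_addA : associative pcl_add.
Proof.
elim/quotW=> x; elim/quotW=> y; elim/quotW=> z.
rewrite (pcl_addE y z) (pcl_addE x y) !pcl_addE.
by apply: pi_ext; rewrite /= mulrA.
Qed.

Fact pcl_addC : commutative pcl_add.
Proof.
elim/quotW=> x; elim/quotW=> y; rewrite !pcl_addE.
by apply: pi_ext; rewrite /= mulrC.
Qed.

Fact pcl_add0 : left_id pcl_zero pcl_add.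
Proof.
elim/quotW=> x; rewrite pcl_addE.
by apply: pi_ext; rewrite /= mul1r.
Qed.

Fact pcl_addN : left_inverse pcl_zero pcl_opp pcl_add.
Proof.
elim/quotW=> x; rewrite (pcl_oppE x) pcl_addE.
by apply: pi_ext; rewrite /= mulVf // (valP x).
Qed.

HB.instance Definition _ :=
  GRing.isZmodule.Build V pcl_addA pcl_addC pcl_add0 pcl_addN.

(* The class of x <> 0; the value at x = 0 is irrelevant. *)
Definition pcl (x : E) : V := \pi_V (insubd nz1 x).

Lemma pclM x y : x != 0 -> y != 0 -> pcl (x * y) = pcl x + pcl y.
Proof.
move=> x0 y0; rewrite /pcl [RHS]pcl_addE; apply: pi_ext.
by rewrite /= !insubdK // -topredE /= mulf_neq0.
Qed.

Lemma pcl1 : pcl 1 = 0.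
Proof.
rewrite /pcl (_ : insubd nz1 1 = nz1) //.
by apply: val_inj; rewrite insubdK // -topredE /= oner_neq0.
Qed.

Lemma pclX x n : x != 0 -> pcl (x ^+ n) = pcl x *+ n.
Proof.
move=> x0; elim: n => [|n IHn]; first by rewrite pcl1.
by rewrite exprS mulrS pclM ?IHn ?expf_neq0.
Qed.

Lemma pcl_eq x y : x != 0 -> y != 0 ->
  pcl x = pcl y <-> exists2 z, z != 0 & x = y * z ^+ p.
Proof.
move=> x0 y0; split=> [/eqP/eqmodXP[z]|[z z0 xE]].
  by rewrite !insubdK // => xE; exists (val z) => //; exact: (valP z).
apply/eqP/eqmodXP; exists (Sub z z0).
by rewrite !insubdK.
Qed.

Lemma pcl_surj (v : V) : exists2 x, x != 0 & v = pcl x.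
Proof.
elim/quotW: v => x; exists (val x); first exact: (valP x).
by rewrite /pcl valKd.
Qed.

Fact pcl_torsion (v : V) : v *+ p = 0.
Proof.
have [x x0 ->] := pcl_surj v; rewrite -pclX // -pcl1.
by apply/pcl_eq; rewrite ?expf_neq0 ?oner_neq0 //; exists x; rewrite ?mul1r.
Qed.

Fact pcl_mod (v : V) n : v *+ (n %% p) = v *+ n.
Proof. by rewrite [in RHS](divn_eq n p) mulrnDr mulnC mulrnA pcl_torsion mul0rn add0r. Qed.

Definition pcl_scale (a : 'F_p) (v : V) : V := v *+ (a : nat).

Fact pcl_scaleA a b v : pcl_scale a (pcl_scale b v) = pcl_scale (a * b) v.
Proof.
rewrite /pcl_scale -mulrnA mulnC -[in LHS]pcl_mod.
congr (v *+ _); rewrite /=; congr (_ %% _)%N.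
by rewrite (Fp_cast p_pr).
Qed.

Fact pcl_scale1 : left_id 1 pcl_scale.
Proof. by move=> v; rewrite /pcl_scale /= modn_small ?mulr1n. Qed.

Fact pcl_scaleDr : right_distributive pcl_scale +%R.
Proof. by move=> a u v; rewrite /pcl_scale mulrnDl. Qed.

Fact pcl_scaleDl v : {morph pcl_scale^~ v : a b / a + b}.
Proof.
move=> a b; rewrite /pcl_scale -mulrnDr -[in RHS]pcl_mod.
congr (v *+ _); rewrite /=; congr (_ %% _)%N.
by rewrite (Fp_cast p_pr).
Qed.

HB.instance Definition _ := GRing.Zmodule_isLmodule.Build 'F_p V
  pcl_scaleA pcl_scale1 pcl_scaleDr pcl_scaleDl.

End PowerClasses.

Arguments pcl {p} p_pr {E} x.

(* X has dimension k over F: it has a basis with k elements. *)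
Definition has_dim (F : fieldType) (V : lmodType F) (k : nat) (X : set V) : Prop :=
  exists b : 'I_k -> V,
    (forall v, X v <-> exists c : 'I_k -> F, v = \sum_i c i *: b i) /\
    (forall c : 'I_k -> F, \sum_i c i *: b i = 0 -> forall i, c i = 0).

Section Extensions.

Variables (K : fieldType) (Omega : closedFieldType) (iota : {rmorphism K -> Omega}).

(* An extension L/K inside Omega is a fieldExtType together with an embedding
   over K; as a subfield of Omega it is the range of the embedding. *)
Record embedding (L : fieldExtType K) := Embedding {
  emb :> {rmorphism L -> Omega};
  embK : forall a : K, emb a%:A = iota a
}.

Definition no_intermediate (L : fieldExtType K) : Prop :=
  forall S : {subfield L}, S = 1%AS \/ S = {:L}%AS.

Definition Kisomorphic (L L' : fieldExtType K) : Prop :=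
  exists f : {lrmorphism L -> L'}, bijective f.

Definition generated_subfield (A : set Omega) : set Omega :=
  smallest (fun S : set Omega => GRing.divring_closed [in S]) A.

Definition compositum (L E : fieldExtType K) (l : embedding L) (e : embedding E) :=
  generated_subfield (range l `|` range e)%classic.

Section Galois.

Variables (p : nat) (p_pr : prime p) (E : splittingFieldType K) (e : embedding E).

(* E(Xi^(1/p)) *)
Definition radical_extension (Xi : set (pclasses E p_pr)) : set Omega :=
  generated_subfield
    (range e `|` [set y | exists x : E, [/\ x != 0, Xi (pcl p_pr x) & y ^+ p = e x]])%classic.

Definition is_submodule (Xi : set (pclasses E p_pr)) : Prop :=
  GRing.submod_closed [in Xi] /\
  forall (s : gal_of {:E}) (x : E), s \in 'Gal({:E} / 1)%g -> x != 0 ->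
    Xi (pcl p_pr x) -> Xi (pcl p_pr (s x)).

Definition irreducible_submodule (Xi : set (pclasses E p_pr)) : Prop :=
  [/\ is_submodule Xi, Xi <> [set 0]%classic
    & forall Y, is_submodule Y -> (Y `<=` Xi)%classic -> Y = [set 0]%classic \/ Y = Xi].

(* Gal(LE/K) -> Gal(E/K) is a split surjection: LE is the range of a Galois
   extension M of K, in which the kernel Gal(M/E) has a complement. *)
Definition split_compositum (L : fieldExtType K) (l : embedding L) : Prop :=
  exists (M : splittingFieldType K) (m : embedding M) (S : {subfield M}),
    [/\ galois 1 {:M}, range m = compositum l e,
        (m @` [set` S])%classic = range e
      & [splits 'Gal({:M} / 1), over 'Gal({:M} / S)]%g].

Definition property_C (k : nat) : Prop :=
  let ext (L : fieldExtType K) := \dim {:L} = (p ^ k)%N /\ no_intermediate L in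
  let irr (Xi : set (pclasses E p_pr)) := irreducible_submodule Xi /\ has_dim k Xi in
  let corr (L : fieldExtType K) (l : embedding L) Xi :=
    compositum l e = radical_extension Xi in
  [/\ forall (L : fieldExtType K) (l : embedding L), ext L ->
        exists! Xi, irr Xi /\ corr L l Xi,
      forall Xi, irr Xi ->
        exists (L : fieldExtType K) (l : embedding L),
          [/\ ext L, corr L l Xi
            & forall (L' : fieldExtType K) (l' : embedding L'), ext L' ->
                (corr L' l' Xi <-> Kisomorphic L L')]
    & forall (L : fieldExtType K) (l : embedding L), ext L ->
        split_compositum l].

End Galois.

End Extensions.

(* Main.v *)
(** Inside a finite Galois extension [M/K] with group [G], let [B] be the subgroup
    fixing [E].  An extension [L/K] of degree [p^k] without intermediate field is a
    maximal subgroup [A] of index [p^k], and [LE] is the subgroup [A :&: B].  When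
    [E] contains the [p]-th roots of unity, Kummer theory identifies the irreducible
    submodules of dimension [k] with the chief factors [B / D] of [G] of order [p^k],
    [D] fixing the radical extension.  So [(C_k)] for [E] says: the roots of unity
    are in [E]; [A |-> A :&: B] maps the maximal subgroups of index [p^k] onto such
    subgroups [D]; and its fibres are the conjugacy classes.  The roots of unity
    follow from [(C_k)] because some [L] always exists, generated by a root of the
    Eisenstein polynomial [X^q + pi X + pi], [q = p^k]: all the differences of its
    roots have the same absolute value, which leaves no room for an intermediate field.

    Passing from [F] to [F'] is then a question about [B' <= B] of index prime to [p]
    in case (i), and [B <= B'] with [B' / B] the [p]-core of [G / B] in case (ii).
    Only surjectivity is not formal.  In case (i), a Schur-Zassenhaus and Frattini
    argument gives either a complement of [B' / D] in [G / D], hence a maximal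
    subgroup, or a chief factor below [B] to which [(C_k)] for [F] applies.  In
    case (ii), [G / B'] has trivial [p]-core, so the wild inertia group of [G] lies
    in [B'] and [G / B'] is [p]-nilpotent; the same argument produces a complement
    unless [k = 1] and some normal subgroup of index [p] contains [B'], which [(C_k)]
    for [F] forbids. *)

Require Import Defs.
From HB Require Import structures.
From mathcomp Require Import mathcomp_extra boolp classical_sets filter.
From mathcomp Require Import all_boot all_order all_algebra.
From mathcomp Require Import all_fingroup all_solvable all_field.
From mathcomp Require Import ring lra zify.

Set Implicit Arguments.
Unset Strict Implicit.
Unset Printing Implicit Defensive.

Import Order.TTheory GRing.Theory Num.Theory.

(** * Chief factors of finite groups *)

(** The group theory is finite, while [(C_k)] quantifies over all extensions in [Omega]. Each
    instance involves finitely many fields and is tested in an [M] containing them. A single [M] for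
    all would require that [K] has finitely many extensions of degree [p ^ k]; instead, [chief_corr]
    is transferred for arbitrarily large [M].

    Beyond characteristic 0, the arithmetic of [K] enters twice: to find one [L], and to filter [G]
    by wild inertia (a [p]-group), inertia (of order prime to [p] over it) and an abelian quotient.
    Rings of integers and residue fields do not appear: everything is an inequality [w _ < 1]. The
    absolute value of a finite extension may involve roots of rationals, so [w] is a fixed power of
    it, which affects no such inequality. Completeness is used only through limits of bounded
    sequences along an ultrafilter; these bound inverses, which leads to the ultrametric inequality,
    and show that every unit has a power close to 1. This replaces the finiteness of the residue
    field: modulo the maximal ideal, an automorphism maps a unit to one of its powers, so that
    automorphisms commute there. *)

Section ChiefFactors.

Local Open Scope group_scope.

Variable gT : finGroupType.
Implicit Types (A B C D G H J N V : {group gT}) (p : nat).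

Lemma chief_factorP G D B : reflect
  [/\ D <| G, B <| G, D \proper B & forall N, N <| G -> D \subset N -> N \subset B ->
     N :=: D \/ N :=: B] (chief_factor G D B).
Proof.
apply: (iffP andP) => [[/maxgroupP[/andP[prDB nDG] max] nBG]|[nDG nBG prDB max]].
  have nsDG : D <| G.
    by rewrite /normal nDG (subset_trans (proper_sub prDB)) ?normal_sub.
  split=> // N /andP[_ nNG] DN NB; have [->|/eqP NnB] := eqVneq (N : {set _}) B; first by right.
  by left; apply: max; rewrite ?properEneq ?NB ?nNG ?andbT //; apply/eqP.
split=> //; apply/maxgroupP; split=> [|N /andP[prNB nNG] DN]; first by rewrite prDB normal_norm.
have NG : N <| G by rewrite /normal nNG (subset_trans (proper_sub prNB)) ?normal_sub.
by have [//|NB] := max N NG DN (proper_sub prNB); move: prNB; rewrite NB properxx.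
Qed.

Lemma maximal_group_eq G A H : maximal A G -> A \subset H -> H \subset G ->
  H :=: A \/ H :=: G.
Proof.
case/maxgroupP => prA max AH HG; have [->|HnG] := eqVneq (H : {set _}) G; first by right.
by left; apply: max => //; rewrite properEneq HnG.
Qed.

Lemma maximal_normal_mul G A N : maximal A G -> N <| G -> ~~ (N \subset A) -> A * N = G.
Proof.
move=> maxA nNG NA; have AG := maxgroupp maxA; have sAG := proper_sub AG.
have nNA : A \subset 'N(N) := subset_trans sAG (normal_norm nNG).
rewrite -norm_joinEl //; have [|E|//] := maximal_group_eq (H := A <*> N) maxA (joing_subl _ _).
  by rewrite join_subG sAG normal_sub.
by case/negP: NA; rewrite -E joing_subr.
Qed.

Lemma maximal_index_mul G A N : maximal A G -> N <| G -> ~~ (N \subset A) ->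
  #|N : A :&: N| = #|G : A|.
Proof.
move=> maxA nNG NA; have AG := proper_sub (maxgroupp maxA).
have := mul_cardG A N; rewrite (maximal_normal_mul maxA nNG NA).
rewrite -(Lagrange AG) -(Lagrange (subsetIr A N)).
move=> /= E; apply/eqP; rewrite -(eqn_pmul2l (cardG_gt0 (A :&: N))).
by rewrite -(eqn_pmul2l (cardG_gt0 A)) E -mulnA [(_ * #|_ : _|)%N]mulnC.
Qed.

(* A normal subgroup between [A :&: B] and [B] either lies in [A], or has the same
   index over its intersection with [A] as [B] has. *)
Lemma maximal_chief_factor G A B : maximal A G -> B <| G -> A :&: B <| G ->
  ~~ (B \subset A) -> chief_factor G (A :&: B) B.
Proof.
move=> maxA nBG nDG BA; apply/chief_factorP; split=> //.
  rewrite properEneq subsetIr andbT; apply: contraNneq BA => <-.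
  exact: subsetIl.
move=> N nNG DN NB; have [NA|NA] := boolP (N \subset A).
  by left; apply/eqP; rewrite eqEsubset DN subsetI NA NB.
right; apply/eqP; rewrite eqEcard NB /=.
have ANE : A :&: N = A :&: B.
  apply/eqP; rewrite eqEsubset setIS //= subsetI subsetIl; exact: DN.
rewrite -(Lagrange (subsetIr A N)) -(Lagrange (subsetIr A B)).
by rewrite /= (maximal_index_mul maxA nNG NA) (maximal_index_mul maxA nBG BA) ANE.
Qed.

(** [minnormal_solvable] makes [B / D] elementary abelian for some prime; a prime divisor of
    [#|B / D|] identifies it with [p]. *)
Lemma chief_pgroup_abelem G D B p : chief_factor G D B -> p.-group (B / D) ->
  p.-abelem (B / D).
Proof.
move=> chief pBD.
have [_ ntBD /is_abelemP[q q_pr abel]] := minnormal_solvable (chief_factor_minnormal chief)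
  (subxx _) (nilpotent_sol (pgroup_nil pBD)).
have qBD := abelem_pgroup abel.
suff -> : p = q by [].
have [r r_pr rd] : exists2 r, prime r & r %| #|B / D|.
  by exists (pdiv #|B / D|); rewrite ?pdiv_prime ?pdiv_dvd // cardG_gt1.
by rewrite -(eqP (pgroupP pBD _ r_pr rd)) -(eqP (pgroupP qBD _ r_pr rd)).
Qed.

(** [A] is the preimage of a complement. It is maximal because a subgroup [H] containing it is
    [A (B :&: H)], and [H :&: B] is normal in [G], hence equal to [D] or [B]. *)
Lemma chief_splits_maximal G D B p : chief_factor G D B -> p.-group (B / D) ->
  [splits G / D, over B / D] ->
  exists A, [/\ maximal A G, #|G : A| = #|B : D| & A :&: B = D].
Proof.
move=> chief pBD /splitsP[Hbar /complP[tiBH BHG]].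
have abBD := abelem_abelian (chief_pgroup_abelem chief pBD).
have [nDG nBG prDB max] := chief_factorP _ _ _ chief.
have sHG : Hbar \subset G / D by rewrite -BHG mulG_subr.
have [A AE DA sAG] := inv_quotientS nDG sHG.
have nDB : D <| B := normalS (proper_sub prDB) (normal_sub nBG) nDG.
have nDA : D <| A := normalS DA sAG nDG.
have ABD : A :&: B = D.
  apply/eqP; rewrite eqEsubset subsetI DA (proper_sub prDB) !andbT.
  rewrite -quotient_sub1 ?(subset_trans (subsetIr _ _)) ?normal_norm //.
  by rewrite quotientGI // -AE setIC tiBH.
have ABG : A * B = G.
  have nBA := subset_trans sAG (normal_norm nBG).
  apply/eqP; rewrite -norm_joinEl // eqEsubset join_subG sAG normal_sub //=.
  rewrite -(quotientSGK (normal_norm nDG)) ?(subset_trans DA (joing_subl _ _)) //.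
  by rewrite quotientY ?normal_norm // -AE joingC -BHG mulG_subG joing_subl joing_subr.
have indexE : #|G : A| = #|B : D|.
  have := mul_cardG A B; rewrite ABG ABD -(Lagrange sAG) -(Lagrange (proper_sub prDB)).
  move=> E; apply/eqP; rewrite -(eqn_pmul2l (cardG_gt0 D)).
  by rewrite -(eqn_pmul2l (cardG_gt0 A)) E -mulnA [(_ * #|_ : _|)%N]mulnC.
exists A; split=> //; apply/maxgroupP; split.
  rewrite properEneq sAG andbT; apply: contraTneq prDB => AG.
  by rewrite -ABD AG (setIidPr (normal_sub nBG)) properxx.
move=> H prHG AH; have sHG' := proper_sub prHG.
(* [A] normalises [H :&: B] since it lies in [H]; [B] does since [B / D] is abelian and [D] lies in
   [H :&: B]. *)
have nHBG : H :&: B <| G.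
  have sDHB : D \subset H :&: B by rewrite subsetI (subset_trans DA AH) proper_sub.
  rewrite /normal (subset_trans (subsetIl _ _)) //= -ABG mul_subG //.
    by rewrite (subset_trans AH) // normsI ?normG ?(subset_trans sHG' (normal_norm nBG)).
  apply: normal_norm; apply: sub_der1_normal (subsetIr _ _).
  by rewrite (subset_trans _ sDHB) // der1_min // normal_norm.
have HE : A * (B :&: H) = H by rewrite group_modl // ABG (setIidPr sHG').
have [||E|E] := max _ nHBG; rewrite /= ?subsetI ?(subset_trans DA AH) ?(proper_sub prDB) ?subsetIr //.
  by rewrite -[LHS]HE setIC [H :&: B]E mulGSid.
by move: prHG; rewrite -HE setIC [H :&: B]E ABG properxx.
Qed.

(* Frattini's argument for a complement [C] of [V] in [J]: [G = V 'N_G(C)], and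
   [V] meets ['N_G(C)] in a normal subgroup of [G]. *)
Lemma minnormal_splits_or_normal_complement G V J p :
  minnormal V G -> p.-abelem V -> V <| G -> V \subset J -> J <| G ->
  coprime p #|J : V| ->
  [splits G, over V] \/ exists C, [/\ C <| G, V :&: C = 1 & V * C = J].
Proof.
move=> minV abV nVG VJ nJG cop.
have nVJ : V <| J := normalS VJ (normal_sub nJG) nVG.
have pV := abelem_pgroup abV.
have copV n : coprime p n -> coprime #|V| n.
  by move=> pn; have [m ->] := p_natP pV; rewrite coprimeXl.
have hallV : Hall J V by rewrite /Hall VJ copV.
have [C /complP[tiVC VCJ]] := splitsP (SchurZassenhaus_split hallV nVJ).
have CJ : C \subset J by rewrite -VCJ mulG_subr.
have nVC := subset_trans CJ (normal_norm nVJ).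
have copVC : coprime #|V| #|C|.
  suff -> : #|C| = #|J : V| by apply: copV.
  by apply/eqP; rewrite -(eqn_pmul2l (cardG_gt0 V)) -(TI_cardMg tiVC) VCJ Lagrange.
have GE : V * 'N_G(C) = G.
  apply/eqP; rewrite eqEsubset; apply/andP; split.
    by rewrite mul_subG ?(normal_sub nVG) ?subsetIl.
  apply/subsetP => g gG.
  have CgJ : C :^ g \subset V * C by rewrite VCJ -(normsP (normal_norm nJG) g gG) conjSg.
  have [x xV CgE] :=
    SchurZassenhaus_trans_sol (abelian_sol (abelem_abelian abV)) nVC CgJ copVC (cardJg _ _).
  apply/imset2P; have xG := subsetP (normal_sub nVG) x xV.
  exists (g * x^-1 * g^-1)^-1 (g * x^-1).
  - rewrite groupV; rewrite -[g in X in X * g^-1](invgK g) -mulgA -conjgE.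
    by rewrite memJ_norm ?groupV // (subsetP (normal_norm nVG)) ?groupV.
  - rewrite inE groupM ?groupV //=; apply/normP.
    by rewrite conjsgM CgE -conjsgM mulgV conjsg1.
  - by rewrite invMg invgK mulgKV.
(* [V] normalises this intersection because it is abelian, ['N_G(C)] because [V] is normal in
   [G]. *)
have nVNC : V :&: 'N_G(C) <| G.
  rewrite /normal (subset_trans (subsetIl _ _) (normal_sub nVG)) /=.
  rewrite -{1}GE mul_subG //.
    by rewrite sub_abelian_norm ?subsetIl // (abelem_abelian abV).
  by rewrite normsI ?normG // (subset_trans (subsetIl _ _)) // normal_norm.
have [/eqP triv|ntriv] := eqVneq (V :&: 'N_G(C)) 1.
  left; apply/splitsP; exists 'N_G(C)%G; apply/complP; split=> //.
  exact/eqP.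
(* Minimality puts [V] inside ['N_G(C)], so that [G = V 'N_G(C)] normalises [C]. *)
right; exists C; split=> //.
have VN : V \subset 'N_G(C).
  have /mingroupP[_ /(_ (V :&: 'N_G(C))%G)] := minV.
  rewrite ntriv normal_norm //= subsetIl => /(_ isT isT) <-; exact: subsetIr.
by rewrite /normal (subset_trans CJ (normal_sub nJG)) -{1}GE mul_subG ?subsetIr // (subset_trans VN) ?subsetIr.
Qed.


End ChiefFactors.

(** * Passing to a smaller or larger normal subgroup *)

Section ChiefTransfer.

Local Open Scope group_scope.

Variable gT : finGroupType.
Implicit Types (A B C D G H J N V : {group gT}) (p : nat).

Lemma pnat_dvd_coprime_eq1 p n m : p.-nat n -> n %| m -> coprime p m -> n = 1%N.
Proof.
move=> pn nm cop; have [e nE] := p_natP pn; have := coprime_dvdr nm cop.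
by rewrite nE; case: e {nE} => [|e] //; rewrite coprime_pexpr // /coprime gcdnn => /eqP->; rewrite exp1n.
Qed.

(** If [A] contained [B1], the index [#|B : A :&: B| = #|G : A|], a power of [p], would divide
    [#|B : B1|], which is prime to [p]. *)
Lemma coprime_normal_transfer G A B B1 p : maximal A G -> B <| G -> B1 <| G ->
  B1 \subset B -> coprime p #|B : B1| -> p.-nat #|G : A| ->
  A :&: B <| G -> ~~ (B \subset A) ->
  A :&: B1 <| G /\ ~~ (B1 \subset A).
Proof.
move=> maxA nBG nB1G B1B cop pA nDG BA; split.
  by rewrite -(setIidPr B1B) setIA normalI.
apply/negP => B1A; have iD := maximal_index_mul maxA nBG BA.
have dv : #|G : A| %| #|B : B1| by rewrite -iD indexgS // subsetI B1A.
have /eqP := pnat_dvd_coprime_eq1 pA dv cop; rewrite indexg_eq1 => GA.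
by have /andP[_ /negP] := maxgroupp maxA.
Qed.

(** The dichotomy for [V = B1 / D1] in [J = B / D1], of index prime to [p]. A normal complement
    lifts to [D] with [D B1 = B] and [D :&: B1 = D1]; then [B / D] is a chief factor because, by the
    modular law, a normal [N] between [D] and [B] is [D (B1 :&: N)]. *)
Lemma coprime_chief_transfer G D1 B1 B p : chief_factor G D1 B1 -> p.-group (B1 / D1) ->
  B <| G -> B1 \subset B -> coprime p #|B : B1| ->
  [splits G / D1, over B1 / D1] \/
  exists D, [/\ chief_factor G D B, D :&: B1 = D1 & #|B : D| = #|B1 : D1|].
Proof.
move=> chief pV nBG B1B cop; have [nDG nB1G prDB max] := chief_factorP _ _ _ chief.
have sDB1 := proper_sub prDB; have sDB := subset_trans sDB1 B1B.
have nDB : D1 <| B := normalS sDB (normal_sub nBG) nDG.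
have nDB1 : D1 <| B1 := normalS sDB1 (normal_sub nB1G) nDG.
have cop' : coprime p #|B / D1 : B1 / D1|.
  by rewrite index_quotient_eq ?normal_norm // (subset_trans (subsetIr _ _) sDB1).
have [|[C [nCG tiC VC]]] := minnormal_splits_or_normal_complement
  (chief_factor_minnormal chief) (chief_pgroup_abelem chief pV) (quotient_normal _ nB1G)
  (quotientS _ B1B) (quotient_normal _ nBG) cop'; first by left.
right; have [D CE sD1D nDG'] := inv_quotientN nDG nCG.
have sDB' : D \subset B.
  rewrite -(quotientSGK (subset_trans (normal_sub nDG') (normal_norm nDG)) sDB).
  by rewrite -CE -VC mulG_subr.
have DB1 : D :&: B1 = D1.
  apply/eqP; rewrite eqEsubset subsetI sD1D sDB1 !andbT.
  rewrite -quotient_sub1 ?(subset_trans (subsetIr _ _) (normal_norm nDB1)) //.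
  by rewrite quotientGI // -CE setIC tiC.
have DmB1 : D * B1 = B.
  have nB1D := subset_trans (normal_sub nDG') (normal_norm nB1G).
  apply/eqP; rewrite -norm_joinEl // eqEsubset join_subG sDB' B1B /=.
  rewrite -(quotientSGK (normal_norm nDB)) ?(subset_trans sD1D (joing_subl _ _)) //.
  rewrite quotientY ?(subset_trans sDB' (normal_norm nDB)) ?normal_norm // -CE joingC -VC.
  by rewrite mulG_subG joing_subl joing_subr.
have indexE : #|B : D| = #|B1 : D1|.
  have := mul_cardG D B1; rewrite DmB1 DB1 -(Lagrange sDB') -(Lagrange sDB1).
  move=> E; apply/eqP; rewrite -(eqn_pmul2l (cardG_gt0 D1)).
  by rewrite -(eqn_pmul2l (cardG_gt0 D)) E -mulnA [(_ * #|_ : _|)%N]mulnC.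
exists D; split=> //; apply/chief_factorP; split=> //.
  rewrite properEneq sDB' andbT; apply: contraTneq prDB => DB.
  by rewrite -DB1 DB (setIidPr B1B) properxx.
move=> N nNG DN NB; have NE : D * (B1 :&: N) = N by rewrite group_modl // DmB1 (setIidPr NB).
have [|||E|E] := max (N :&: B1)%G; rewrite /= ?normalI ?subsetIr //.
- by rewrite subsetI sDB1 (subset_trans sD1D DN).
- by left; rewrite -NE setIC [N :&: B1]E mulGSid.
- by right; rewrite -NE setIC [N :&: B1]E DmB1.
Qed.

(** For [X], [Y] among [D1], [D2], the index [#|X : X :&: Y|] divides [#|B : Y|], a power of [p],
    and, since [X :&: B1 = Y :&: B1], also [#|B : B1|], prime to [p]. *)
Lemma coprime_meet_inj G D1 D2 B B1 p : D1 <| G -> D2 <| G -> B <| G -> B1 <| G ->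
  D1 \subset B -> D2 \subset B -> B1 \subset B -> coprime p #|B : B1| ->
  p.-nat #|B : D1| -> p.-nat #|B : D2| -> D1 :&: B1 = D2 :&: B1 -> D1 :=: D2.
Proof.
move=> nD1 nD2 nB nB1 sD1 sD2 sB1 cop p1 p2 E.
have half (X Y : {group gT}) : X <| G -> Y <| G -> X \subset B -> Y \subset B -> p.-nat #|B : Y| ->
    X :&: B1 = Y :&: B1 -> X \subset Y.
  move=> nX nY sX sY pY XY.
  have norm (H K : {group gT}) : H <| G -> K <| G -> K \subset 'N(H).
    by move=> nH nK; rewrite (subset_trans (normal_sub nK) (normal_norm nH)).
  rewrite -indexg_eq1; apply/eqP.
  apply: (pnat_dvd_coprime_eq1 (p := p) _ _ cop).
    apply: pnat_dvd pY; rewrite -!card_quotient ?norm //.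
    by rewrite cardSg // quotientS.
  apply: (@dvdn_trans #|X : B1|); last first.
    by rewrite -!card_quotient ?norm // cardSg // quotientS.
  by rewrite -(indexgI X Y) -(indexgI X B1) indexgS // subsetI subsetIl /= XY subsetIl.
by apply/eqP; rewrite eqEsubset; apply/andP; split; apply: half.
Qed.

(* A minimal normal subgroup [V = B / (A :&: B)] of a normal [p]-subgroup [B1 / (A :&: B)]
   is central in it, so that [B] normalises [A :&: B1]. *)
Lemma pcore_normal_transfer G A B B1 p : maximal A G -> B <| G -> B1 <| G ->
  B \subset B1 -> p.-group (B1 / B) -> p.-nat #|G : A| ->
  A :&: B <| G -> ~~ (B \subset A) ->
  A :&: B1 <| G /\ ~~ (B1 \subset A).
Proof.
move=> maxA nBG nB1G BB1 pB1 pA nDG BA; split; last first.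
  by apply: contra BA; exact: subset_trans.
have chief := maximal_chief_factor maxA nBG nDG BA.
set D := (A :&: B)%G in nDG chief *; have sDB : D \subset B by exact: subsetIr.
have norm (H K : {group gT}) : H <| G -> K <| G -> K \subset 'N(H).
  by move=> nH nK; rewrite (subset_trans (normal_sub nK) (normal_norm nH)).
have pW : p.-group (B1 / D).
  rewrite /pgroup card_quotient ?norm // -(Lagrange_index BB1 sDB) pnatM.
  by rewrite -card_quotient ?norm // -/(pgroup _ _) pB1 (maximal_index_mul maxA nBG BA).
have nVW : B / D <| B1 / D by rewrite quotient_normal // /normal BB1 norm.
have cVW : B / D \subset 'C(B1 / D).
  have /mingroupP[/andP[ntV _] min] := chief_factor_minnormal chief.
  have ZE : (B / D) :&: 'Z(B1 / D) = B / D.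
    apply: (min ((B / D) :&: 'Z(B1 / D))%G); last exact: subsetIl.
    rewrite (meet_center_nil (pgroup_nil pW)) //= normsI ?quotient_norms ?norm //.
    by rewrite normal_norm // (gFnormal_trans _ (quotient_normal _ nB1G)).
  by rewrite -ZE (subset_trans (subsetIr _ _)) // subsetIr.
have comm : [~: B, B1] \subset D by rewrite -quotient_cents2 ?norm.
have GE := maximal_normal_mul maxA nBG BA.
rewrite /normal subIset ?(proper_sub (maxgroupp maxA)) //= -{1}GE mul_subG //.
  by rewrite normsI ?normG // (subset_trans (proper_sub (maxgroupp maxA))) ?normal_norm.
rewrite -commg_subl commGC; apply: subset_trans (commgS _ (subsetIr _ _)) _.
by rewrite (subset_trans comm) // setIS.
Qed.

(** The image of [P] in [G / B] is a normal [p]-subgroup, hence trivial; so [I] maps to a normal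
    [p']-subgroup. The quotient of [G / B] by its [p']-core is then abelian with trivial [p']-core,
    hence a [p]-group. *)
Lemma ramified_pcore_quotient G B (P I : {group gT}) p : B <| G -> P <| G -> I <| G ->
  p.-group P -> p^'.-group (I / P) -> abelian (G / I) -> 'O_p(G / B) = 1 ->
  p.-group ((G / B) / 'O_p^'(G / B)).
Proof.
move=> nBG nPG nIG pP p'I abGI Op1.
have norm (H K : {group gT}) : H <| G -> K <| G -> K \subset 'N(H).
  by move=> nH nK; rewrite (subset_trans (normal_sub nK) (normal_norm nH)).
have sPB : P \subset B.
  rewrite -quotient_sub1 ?norm // -Op1 pcore_max ?quotient_pgroup //.
  exact: quotient_normal.
have sIO : I / B \subset 'O_p^'(G / B).
  rewrite pcore_max ?quotient_normal //.
  apply: pnat_dvd p'I; rewrite /= !card_quotient ?norm //.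
  by rewrite -(indexgI I B) -(indexgI I P) indexgS // setIS.
set O := 'O_p^'(G / B).
have abO : abelian ((G / B) / O).
  apply: sub_der1_abelian; apply: subset_trans sIO.
  rewrite -quotient_der ?(norm B G) ?normal_refl // quotientS // der1_min ?norm //.
have /dprodP[_ E _ _] := nilpotent_pcoreC p (abelian_nil abO).
move: E; rewrite [X in _ * X]trivg_pcore_quotient mulg1 => <-.
exact: pcore_pgroup.
Qed.

(** Let [J / B] be the [p']-core of [G / B]. If the dichotomy gives a normal complement [C] of
    [V = B / D] in [J / D], either [G / B] is a [p']-group and Schur-Zassenhaus applies, or [V] is
    central of order [p] while [G] has a maximal subgroup of index [p] containing [B]. *)
Lemma tame_chief_splits G D B p : prime p -> chief_factor G D B -> p.-group (B / D) ->
  p.-group ((G / B) / 'O_p^'(G / B)) ->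
  (forall A, maximal A G -> #|G : A| = #|B : D| -> ~~ (B \subset A)) ->
  [splits G / D, over B / D].
Proof.
move=> p_pr chief pV pG noA; have [nDG nBG prDB max] := chief_factorP _ _ _ chief.
have sDB := proper_sub prDB.
have norm (H K : {group gT}) : H <| G -> K <| G -> K \subset 'N(H).
  by move=> nH nK; rewrite (subset_trans (normal_sub nK) (normal_norm nH)).
have [J JE sBJ nJG] := inv_quotientN nBG (pcore_normal p^' (G / B)).
have sDJ := subset_trans sDB sBJ.
have pJ : p^'.-group (J / B) by rewrite -JE pcore_pgroup.
have cop : coprime p #|J / D : B / D|.
  rewrite index_quotient_eq ?norm ?(subset_trans (subsetIr _ _) sDB) //.
  by rewrite -card_quotient ?norm // prime_coprime // -p'natE.
have minV := chief_factor_minnormal chief.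
have abV := chief_pgroup_abelem chief pV.
have [//|[C [nCG tiC VC]]] := minnormal_splits_or_normal_complement minV abV
  (quotient_normal _ nBG) (quotientS _ sBJ) (quotient_normal _ nJG) cop.
have pGJ : p.-group (G / J).
  have := isog_pgroup p (third_isog sBJ nBG nJG); rewrite -JE => <- //.
have [p'G|pdG] := boolP (p^'.-group (G / B)).
  apply: SchurZassenhaus_split; last exact: quotient_normal.
  rewrite /Hall quotientS ?normal_sub //= (pnat_coprime pV) //.
  rewrite index_quotient_eq ?norm ?(normal_sub nBG) ?normal_refl //; last first.
    exact: subset_trans (subsetIr _ _) sDB.
  by rewrite -card_quotient ?norm ?normal_refl.
have [JG|[A0 maxA JA]] := maximal_exists (normal_sub nJG).
  by case/negP: pdG; rewrite -JG.
have {}noA : #|G : A0| != #|B : D|.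
  by apply: contraL (subset_trans sBJ JA) => /eqP; exact: noA.
case/eqP: noA.
have sAG := proper_sub (maxgroupp maxA).
have -> : #|G : A0| = p.
  have maxAJ : maximal (A0 / J) (G / J) by rewrite quotient_maximal // (normalS JA sAG).
  rewrite -(p_maximal_index pGJ maxAJ) index_quotient_eq ?norm ?normal_refl //.
  exact: subset_trans (subsetIr _ _) JA.
rewrite -card_quotient ?norm //.
have nVQ := quotient_normal D nBG; have nJQ := quotient_normal D nJG.
(* For a Sylow subgroup [S], [G / D = V C S]. As [V] commutes with itself and with [C], the
   nontrivial group [V :&: 'Z(S)] is central in [G / D]. *)
have [S sylS] := Sylow_exists p (G / D).
have sSQ := pHall_sub sylS; have pS := pHall_pgroup sylS.
have nVS : B / D <| S.
  rewrite /normal (subset_trans sSQ (normal_norm nVQ)) andbT.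
  by rewrite (subset_trans _ (pcore_sub_Hall sylS)) // pcore_max.
have ntZ : (B / D) :&: 'Z(S) != 1.
  by rewrite (meet_center_nil (pgroup_nil pS)) //; case/andP: (mingroupp minV).
have QE : J / D * S = G / D.
  apply/eqP; rewrite eqEsubset mul_subG ?(normal_sub nJQ) //=.
  rewrite -quotientSK ?normal_norm //.
  have nJS := subset_trans sSQ (normal_norm nJQ).
  rewrite (pHall_id (quotient_pHall nJS sylS)) //.
  by rewrite (isog_pgroup p (third_isog sDJ nDG nJG)).
have cVV := abelem_abelian abV.
have cVC : B / D \subset 'C(C).
  apply/commG1P/trivgP; rewrite -tiC commg_subI // subsetI subxx /=.
    by rewrite (subset_trans (normal_sub nVQ) (normal_norm nCG)).
  by rewrite (subset_trans (normal_sub nCG) (normal_norm nVQ)).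
have ZQ : (B / D) :&: 'Z(S) \subset 'Z(G / D).
  rewrite subsetI (subset_trans (subsetIl _ _) (normal_sub nVQ)) -QE centM subsetI /=.
  rewrite -[J / D]VC centM !subsetI.
  rewrite (subset_trans (subsetIl _ _) cVV) (subset_trans (subsetIl _ _) cVC).
  exact: subset_trans (subsetIr _ _) (subsetIr _ _).
have VZ : B / D \subset 'Z(G / D).
  have /mingroupP[_ min] := minV.
  rewrite -(min ((B / D) :&: 'Z(G / D))%G) ?subsetIl ?subsetIr //=.
  rewrite normsI ?normal_norm ?center_normal // andbT.
  apply: contra ntZ; rewrite -!subG1; apply: subset_trans.
  by rewrite subsetI subsetIl.
(* Every subgroup of the central group [V] is normal, so minimality makes [V] the cyclic group
   generated by an element of order [p]. *)
have [x xV ox] : exists2 x, x \in B / D & #[x] = p.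
  have [_ pd _] := pgroup_pdiv pV (proj1 (andP (mingroupp minV))).
  by have [x xV ox] := Cauchy p_pr pd; exists x.
have /mingroupP[_ min] := minV.
have <- : <[x]> = B / D; last exact: esym ox.
apply: (min <[x]>%G); last by rewrite cycle_subG.
rewrite cents_norm ?andbT; last first.
  by rewrite centsC cycle_subG (subsetP (subset_trans VZ (subsetIr _ _))).
by rewrite -cardG_gt1 -[#|_|]/#[x] ox prime_gt1.
Qed.

End ChiefTransfer.

(** * The property (C_k) in terms of groups *)

Section ChiefCorrespondence.

Local Open Scope group_scope.

Variable gT : finGroupType.
Implicit Types (A B D G P I : {group gT}) (p q k : nat).

(* For [G = Gal(M/K)], [B = Gal(M/E)] and [q = p^k]: property [(C_k)] of [E] seen in [M]. *)
Definition chief_corr G B q : Prop :=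
  [/\ forall A, maximal A G -> #|G : A| = q -> A :&: B <| G /\ ~~ (B \subset A),
      forall D, chief_factor G D B -> #|B : D| = q ->
        exists A, [/\ maximal A G, #|G : A| = q & A :&: B = D]
    & forall A1 A2, maximal A1 G -> maximal A2 G -> #|G : A1| = q -> #|G : A2| = q ->
        A1 :&: B = A2 :&: B -> exists s, A2 :=: A1 :^ s].

Lemma chief_pgroup_index G D B p k : prime p -> chief_factor G D B -> #|B : D| = (p ^ k)%N ->
  p.-group (B / D).
Proof.
move=> p_pr /chief_factorP[nD nB prDB _] iD; rewrite /pgroup card_quotient ?iD ?pnatX ?pnat_id //.
exact: subset_trans (normal_sub nB) (normal_norm nD).
Qed.

Lemma chief_corr_coprime G B B1 p k : prime p -> chief_corr G B (p ^ k) ->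
  B <| G -> B1 <| G -> B1 \subset B -> coprime p #|B : B1| -> chief_corr G B1 (p ^ k).
Proof.
move=> p_pr [nor ex inj] nB nB1 sB cop.
have pq : p.-nat (p ^ k)%N by rewrite pnatX pnat_id.
split=> [A maxA iA|D1 chief iD|A1 A2 max1 max2 i1 i2 E].
- have [nAB BA] := nor A maxA iA.
  by apply: (coprime_normal_transfer (p := p) maxA nB nB1 sB cop) => //; rewrite iA.
- have pV := chief_pgroup_index p_pr chief iD.
  have [spl|[D [chD D1E iDE]]] := coprime_chief_transfer chief pV nB sB cop.
    have [A [maxA iA AE]] := chief_splits_maximal chief pV spl.
    by exists A; split=> //; rewrite iA iD.
  have [|A [maxA iA AE]] := ex D chD; first by rewrite iDE iD.
  by exists A; split=> //; rewrite -D1E -AE -setIA (setIidPr sB).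
have [n1 b1] := nor A1 max1 i1; have [n2 b2] := nor A2 max2 i2.
apply: inj => //; apply: (coprime_meet_inj (p := p) n1 n2 nB nB1) => //; rewrite ?subsetIr //.
- by rewrite (maximal_index_mul max1) // i1.
- by rewrite (maximal_index_mul max2) // i2.
- by rewrite /= -!setIA (setIidPr sB).
Qed.

(** [A :&: B1] determines [A :&: B], which settles the fibres. For surjectivity, the clause
    [~~ (B1 \subset A)], already transferred to [B1], rules out the exceptional case of
    [tame_chief_splits]. *)
Lemma chief_corr_pcore G B B1 P I p k : prime p -> chief_corr G B (p ^ k) ->
  B <| G -> B1 <| G -> B \subset B1 -> p.-group (B1 / B) -> 'O_p(G / B1) = 1 ->
  P <| G -> I <| G -> p.-group P -> p^'.-group (I / P) -> abelian (G / I) ->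
  chief_corr G B1 (p ^ k).
Proof.
move=> p_pr [nor ex inj] nB nB1 sB pB1 Op1 nP nI pP p'I abGI.
have pq : p.-nat (p ^ k)%N by rewrite pnatX pnat_id.
have nor1 A : maximal A G -> #|G : A| = (p ^ k)%N -> A :&: B1 <| G /\ ~~ (B1 \subset A).
  move=> maxA iA; have [nAB BA] := nor A maxA iA.
  by apply: (pcore_normal_transfer (p := p) maxA nB nB1 sB pB1) => //; rewrite iA.
split=> // [D chief iD|A1 A2 max1 max2 i1 i2 E].
- have pV := chief_pgroup_index p_pr chief iD.
  have pG := ramified_pcore_quotient nB1 nP nI pP p'I abGI Op1.
  have [A [maxA iA AE]] := chief_splits_maximal chief pV
    (tame_chief_splits p_pr chief pV pG (fun A maxA iA => (nor1 A maxA (etrans iA iD)).2)).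
  by exists A; split=> //; rewrite iA iD.
by apply: inj => //; rewrite -(setIidPr sB) !setIA E.
Qed.

(* The preimage of the [p]-core under an epimorphism with kernel [B]. *)
Lemma preimage_pcore (rT : finGroupType) G B B1 p (H : {group rT}) (f : gT -> rT) :
  {in G &, {morph f : x y / x * y}} -> f @: G = H ->
  (forall s, s \in B = (s \in G) && (f s == 1)) ->
  (forall s, s \in B1 = (s \in G) && (f s \in 'O_p(H))) ->
  [/\ B \subset B1, B1 <| G, p.-group (B1 / B) & 'O_p(G / B1) = 1].
Proof.
move=> fM fG BE B1E; pose g := Morphism fM.
have gG : g @* G = H by rewrite -[RHS]fG /= morphimEdom.
have kg : 'ker g = B by apply/setP => s; rewrite BE !inE.
have B1g : g @*^-1 'O_p(H) = B1 by apply/setP => s; rewrite B1E !inE.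
have sB : B \subset B1.
  by apply/subsetP => s; rewrite BE B1E => /andP[-> /eqP ->]; rewrite group1.
have GE : g @*^-1 H = G.
  by apply/setP => s; rewrite !inE /= -fG andb_idr // => sG; exact: imset_f.
have nB1 : B1 <| G.
  by rewrite -GE -B1g morphpre_normal ?gG ?pcore_sub ?subxx ?pcore_normal.
have nBG : B <| G by rewrite -kg ker_normal.
have cardg (N : {group gT}) : N \subset G -> #|g @* N| = #|N : B|.
  by move=> NG; rewrite card_morphim kg (setIidPr NG).
have pB : p.-nat #|B1 : B|.
  rewrite -cardg ?(normal_sub nB1) //.
  apply: (pgroupS _ (pcore_pgroup p H)).
  by rewrite sub_morphim_pre ?B1g ?normal_sub.
split=> //.
  by rewrite /pgroup card_quotient // (subset_trans (normal_sub nB1)) ?normal_norm.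
have [N NE sB1N nN] := inv_quotientN nB1 (pcore_normal p (G / B1)).
have pN : p.-nat #|N : B1|.
  rewrite -card_quotient; last by rewrite (subset_trans (normal_sub nN)) ?normal_norm.
  by rewrite -NE; exact: pcore_pgroup.
have nNB1 : N \subset 'N(B1) by rewrite (subset_trans (normal_sub nN)) ?normal_norm.
apply/trivgP; rewrite NE /= quotient_sub1 //.
rewrite -B1g -sub_morphim_pre; last exact: normal_sub.
rewrite pcore_max //.
  by rewrite /pgroup cardg ?normal_sub // -(Lagrange_index sB1N sB) pnatM pN.
by rewrite -gG morphim_normal.
Qed.

End ChiefCorrespondence.

Local Open Scope ring_scope.

(** * Absolute values of [p]-adic fields *)

(** Bernoulli's bound for [t ^ m], squared, makes [t ^ (m + m)] grow quadratically in [m] when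
    [t > 1]. This turns a triangle inequality into an ultrametric one, as [(1 + x) ^ m] has [m + 1]
    terms. *)
Lemma le1_of_expr_le_linear (t C : rat) :
  0 <= t -> (forall m, t ^+ m <= C *+ m.+1) -> t <= 1.
Proof.
move=> t0 tC; rewrite leNgt; apply/negP => t1.
have [h h0 tE] : exists2 h, 0 < h & t = 1 + h by exists (t - 1); lra.
have bern m : 1 + m%:R * h <= t ^+ m.
  elim: m => [|m IHm]; first by rewrite expr0 mul0r addr0.
  rewrite exprS; have : t * (1 + m%:R * h) <= t * t ^+ m by rewrite ler_wpM2l.
  apply: le_trans; have : 0 <= m%:R :> rat by rewrite ler0n.
  by rewrite tE -[m.+1%:R]natr1 => m0; nra.
have C0 : 0 <= C by have := tC 0; rewrite expr0 mulr1n; lra.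
(* For [m >= 1], [C (2 m + 1) <= 3 C m], which is less than [(m h) ^ 2] once [m > 3 C / h ^ 2]. *)
have [m] : exists m : nat, 3 * C / h ^+ 2 < m%:R.
  exists (Num.truncn (3 * C / h ^+ 2)).+1.
  by rewrite truncnS_gt.
rewrite ltr_pdivrMr ?exprn_gt0 // => mC.
have m0 : (0 < m)%N.
  by rewrite lt0n; apply/eqP => m0; rewrite m0 mul0r in mC; lra.
have m1 : 1 <= m%:R :> rat by rewrite ler1n.
have := tC (m + m)%N; rewrite exprD -mulr_natr -natr1 natrD.
have := bern m; have : 0 <= t ^+ m by rewrite exprn_ge0.
set T := t ^+ m; set M := m%:R in m1 mC *; rewrite expr2 in mC.
move=> T0 TM.
have : (M * h) * (M * h) <= T * T by apply: ler_pM; nra.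
by nra.
Qed.

Section PadicField.

Variables (p : nat) (Q : fieldType) (a : Q -> rat).
Hypotheses (p_pr : prime p) (hQ : is_Qp p a).

Let a_ge0 := Qp_abs_ge0 hQ.
Let aM := Qp_absM hQ.

Lemma pabs0 : a 0 = 0.
Proof. by have := Qp_abs_ratr hQ 0; rewrite (ratr_nat _ 0) /padic_norm eqxx. Qed.

Lemma pabs_eq0 x : (a x == 0) = (x == 0).
Proof. by apply/eqP/eqP => [/(Qp_abs_eq0 hQ)|->] //; exact: pabs0. Qed.

Lemma pabs_gt0 x : (0 < a x) = (x != 0).
Proof. by rewrite lt_def pabs_eq0 a_ge0 andbT. Qed.

Lemma pabs1 : a 1 = 1.
Proof.
have n0 : a 1 != 0 by rewrite pabs_eq0 oner_eq0.
by apply: (mulfI n0); rewrite -aM !mulr1.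
Qed.

Lemma pabsX x n : a (x ^+ n) = a x ^+ n.
Proof. by elim: n => [|n IHn]; rewrite ?pabs1 // !exprS aM IHn. Qed.

Lemma pabsN x : a (- x) = a x.
Proof.
suff aN1 : a (- 1) = 1 by rewrite -mulN1r aM aN1 mul1r.
have : a (- 1) * a (- 1) = 1 by rewrite -aM mulrNN mulr1 pabs1.
by have := a_ge0 (- 1); set t := a _ => t0 /eqP; rewrite -expr2 sqrf_eq1
   => /orP[] /eqP // tE; rewrite tE in t0; lra.
Qed.

Lemma pabsV x : a x^-1 = (a x)^-1.
Proof.
have [->|x0] := eqVneq x 0; first by rewrite invr0 pabs0 invr0.
have n0 : a x != 0 by rewrite pabs_eq0.
by apply: (mulfI n0); rewrite -aM !divff // pabs1.
Qed.

Lemma p_gt0R : 0 < p%:R :> rat. Proof. by rewrite ltr0n prime_gt0. Qed.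
Lemma p_gt1R : 1 < p%:R :> rat. Proof. by rewrite ltr1n prime_gt1. Qed.

Lemma pabs_nat n : (0 < n)%N -> a n%:R = p%:R ^- logn p n.
Proof.
move=> n0; have := Qp_abs_ratr hQ n%:R; rewrite ratr_nat => ->.
rewrite /padic_norm pnatr_eq0 -[n%:R]/(n%:Z%:~R) numq_int denq_int.
by rewrite eqn0Ngt n0 /= logn1 sub0r -exprnN.
Qed.

Lemma pabs_natr_le1 n : a n%:R <= 1.
Proof.
case: n => [|n]; first by rewrite pabs0.
rewrite pabs_nat // invf_le1 ?exprn_gt0 ?p_gt0R // exprn_ege1 //.
exact/ltW/p_gt1R.
Qed.

Lemma pabs_p : a p%:R = p%:R^-1.
Proof. by rewrite pabs_nat ?prime_gt0 // -[X in logn _ X]expn1 pfactorK. Qed.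

Lemma pabs_sum_le (I : finType) (x : I -> Q) : a (\sum_i x i) <= \sum_i a (x i).
Proof.
elim/big_ind2: _ => [|u s v t us vt|//]; first by rewrite pabs0.
exact: le_trans (Qp_absD hQ _ _) (lerD us vt).
Qed.

(** [is_Qp] provides the triangle inequality only. Binomial coefficients have absolute value at most
    1, so [a (1 + x) ^ m <= m + 1] for all [m]. *)
Lemma pabs_add1_le1 x : a x <= 1 -> a (1 + x) <= 1.
Proof.
move=> x1; apply: (@le1_of_expr_le_linear _ 1); first exact: a_ge0.
move=> m; rewrite -pabsX exprDn; apply: le_trans (pabs_sum_le _) _.
rewrite -[m.+1 in leRHS]card_ord -sumr_const; apply: ler_sum => i _.
rewrite expr1n mul1r -mulr_natr aM pabsX mulr_ile1 ?exprn_ge0 ?a_ge0 //.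
  by rewrite exprn_ile1 ?a_ge0.
exact: pabs_natr_le1.
Qed.

Lemma pabsD x y : a (x + y) <= Num.max (a x) (a y).
Proof.
wlog xy : x y / a x <= a y.
  move=> H; have /orP[/H //|yx] := le_total (a x) (a y).
  by rewrite addrC maxC; exact: H.
rewrite (max_idPr xy).
have [y0|y0] := eqVneq y 0.
  by move: xy; rewrite y0 pabs0 addr0.
rewrite -[x + y](@mulfVK _ y) // aM -{2}[a y]mul1r ler_wpM2r ?a_ge0 //.
rewrite mulrDl divff // addrC pabs_add1_le1 // aM pabsV ler_pdivrMr ?mul1r //.
by rewrite pabs_gt0.
Qed.

Lemma pabsD_le x y (t : rat) : a x <= t -> a y <= t -> a (x + y) <= t.
Proof. by move=> xt yt; apply: le_trans (pabsD x y) _; rewrite ge_max xt. Qed.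

Lemma pabsB_le x y (t : rat) : a x <= t -> a y <= t -> a (x - y) <= t.
Proof. by move=> xt yt; apply: pabsD_le => //; rewrite pabsN. Qed.

Lemma pabsD_lt x y (t : rat) : a x < t -> a y < t -> a (x + y) < t.
Proof. by move=> xt yt; apply: le_lt_trans (pabsD x y) _; rewrite gt_max xt. Qed.

Lemma pabs_sum_max (I : finType) (x : I -> Q) (t : rat) :
  0 <= t -> (forall i, a (x i) <= t) -> a (\sum_i x i) <= t.
Proof.
move=> t0 xt; elim/big_ind: _ => //; first by rewrite pabs0.
by move=> u v; exact: pabsD_le.
Qed.

Lemma pabs_close x y : a (x - y) < a x -> a y = a x.
Proof.
move=> xy; apply/eqP; rewrite eq_le; apply/andP; split.
  by rewrite -[y](subKr x) pabsB_le // ltW.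
rewrite leNgt; apply/negP => yx.
by have := pabsD_lt xy yx; rewrite subrK ltxx.
Qed.

Lemma pabs_value x : x != 0 -> exists z : int, a x = p%:R ^ z.
Proof.
rewrite -pabs_gt0 => x0; have [r xr] := Qp_dense hQ x x0.
rewrite -(pabs_close xr) (Qp_abs_ratr hQ) /padic_norm.
case: eqP => [r0|_]; last by eexists.
by move: xr; rewrite r0 (ratr_nat _ 0) subr0 ltxx.
Qed.

Lemma pabs_lt1 x : a x < 1 -> a x <= p%:R^-1.
Proof.
have [->|x0] := eqVneq x 0; first by rewrite pabs0 invr_ge0 ler0n.
have [z ->] := pabs_value x0.
rewrite -[X in _ < X](expr0z (p%:R : rat)) ltr_eXz2l ?p_gt1R //.
by rewrite -exprN1 ler_eXz2l ?p_gt1R //; lia.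
Qed.

(** The residue field is the prime field: [x] is close to a rational [r] with denominator prime to
    [p], and such an [r] is congruent to an integer. *)
Lemma pabs_digit x : a x <= 1 -> exists j : 'I_p, a (x - (j : nat)%:R) < 1.
Proof.
move=> x1; have [r xr] := Qp_dense hQ x (ltr01 : 0 < 1 :> rat).
have r1 : a (ratr r) <= 1.
  by rewrite -[ratr r](subKr x) pabsB_le // ltW.
suff [j jr] : exists j : 'I_p, a (ratr r - (j : nat)%:R) < 1.
  by exists j; rewrite -[x](subrK (ratr r)) -addrA pabsD_lt.
have dvd1F m : coprime m m -> (p %| m)%N = false.
  rewrite /coprime gcdnn => /eqP->; apply/negP.
  by rewrite dvdn1 => /eqP p1; move: p_pr; rewrite p1.
have pd : ~~ (p %| `|denq r|)%N.
  apply/negP => pd; move: r1; rewrite (Qp_abs_ratr hQ) /padic_norm.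
  case: eqP => [r0|/eqP r0]; first by move: pd; rewrite r0 (_ : `|denq 0|%N = 1%N) // dvd1F.
  have -> : logn p `|numq r| = 0%N.
    apply/eqP; rewrite lognE p_pr absz_gt0 numq_eq0 r0 /=; case: ifP => // pn.
    have := dvdn_gcd p `|numq r| `|denq r|; rewrite pn pd.
    by rewrite (eqP (coprime_num_den r)) dvd1F.
  rewrite subr0; have : (0 < logn p `|denq r|)%N.
    by rewrite logn_gt0 mem_primes p_pr absz_gt0 denq_neq0.
  case: (logn _ _) => // n _; rewrite leNgt => /negP; apply.
  by rewrite exprn_egt1 ?p_gt1R.
have cz : coprimez p (denq r) by rewrite coprimezE prime_coprime.
have [[u v] /= uv] := elimT (coprimezP _ _) cz.
have p0 : (p%:Z != 0) by rewrite -lt0n prime_gt0.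
(* By the Bezout relation [uv], [v] inverts the denominator of [r] modulo [p]. *)
pose j := `|modz (numq r * v) p|%N.
have jE : (j : int) = modz (numq r * v) p by rewrite /j gez0_abs // modz_ge0.
have jp : (j < p)%N by rewrite -ltz_nat jE ltz_pmod // ltz_nat prime_gt0.
exists (Ordinal jp) => /=.
have ad : a (denq r)%:~R = 1.
  rewrite -(gtz0_abs (denq_gt0 r)) pabs_nat ?absz_gt0 ?denq_neq0 //.
  by rewrite lognE p_pr absz_gt0 denq_neq0 /= (negPf pd) expr0 invr1.
have d0 : (denq r)%:~R != 0 :> Q by rewrite -pabs_eq0 ad.
have [c cE] : exists c : int, numq r - j%:Z * denq r = p%:Z * c.
  rewrite jE; have := divz_eq (numq r * v) p; set q := divz _ _; set s := modz _ _.
  move=> E; exists (numq r * u + q * denq r).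
  have -> : s = numq r * v - q * p by rewrite E addrC addKr.
  have {1}-> : numq r = numq r * (u * p + v * denq r) by rewrite uv mulr1.
  by ring.
rewrite -[a _]mul1r -ad -aM mulrBr /ratr mulrC mulfVK // mulrC.
rewrite -[j%:R]/(j%:~R) -intrM -intrB cE intrM aM pabs_p ad.
apply: le_lt_trans (_ : p%:R^-1 * 1 < 1); last first.
  by rewrite mulr1 invf_lt1 ?p_gt1R // p_gt0R.
rewrite ler_wpM2l ?invr_ge0 ?ler0n //.
case: (c) => m; rewrite ?NegzE ?mulrNz ?pabsN; exact: pabs_natr_le1.
Qed.

End PadicField.

Lemma exists_pow_small (p : nat) (C eps : rat) : (1 < p)%N -> 0 < eps ->
  exists N, forall n, (N <= n)%N -> C / p%:R ^+ n < eps.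
Proof.
move=> p1 e0; exists (Num.truncn (C / eps)).+1 => n Nn.
have pn0 : 0 < p%:R ^+ n :> rat by rewrite exprn_gt0 // ltr0n ltnW.
rewrite ltr_pdivrMr // mulrC -ltr_pdivrMr //.
apply: lt_le_trans (truncnS_gt _) _; rewrite -natrX ler_nat.
by apply: leq_trans Nn _; rewrite ltnW // ltn_expl.
Qed.

(** * Compactness along an ultrafilter *)

Section UltraLimit.

Variables (p : nat) (Q : fieldType) (a : Q -> rat).
Hypotheses (p_pr : prime p) (hQ : is_Qp p a).
Variables (U : set_system nat) (UU : UltraFilter U).

Let B (c : Q) (u : nat -> Q) m y := U [set i | a (u i - y) <= a c / p%:R ^+ m]%classic.

(** The [p] digits cut a ball into smaller balls; by the ultrafilter property, [u] stays in one of
    them for [U]-almost all indices. *)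
Lemma ultra_digit c u m y : B c u m y -> exists y', B c u m.+1 y'.
Proof.
have [c0 uy|c0 uy] := eqVneq c 0.
  by exists y; move: uy; rewrite /B c0 (pabs0 hQ) !mul0r.
pose d := c * p%:R ^+ m.
have p0 : p%:R != 0 :> Q.
  by rewrite -(pabs_eq0 hQ) (pabs_p p_pr hQ) invr_eq0 gt_eqF // p_gt0R.
have d0 : d != 0 by rewrite mulf_neq0 // expf_neq0.
have ad : a d = a c / p%:R ^+ m by rewrite (Qp_absM hQ) (pabsX hQ) (pabs_p p_pr hQ) exprVn.
pose D (j : 'I_p) := [set i | a (u i - (y + d * (j : nat)%:R)) <= a c / p%:R ^+ m.+1]%classic.
have [[j Dj]|noj] := pselect (exists j : 'I_p, U (D j)); first by exists (y + d * (j : nat)%:R).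
have FU : Filter U := @filter_filter _ _ (@ultra_proper _ _ UU).
have allC : U [set i | forall j : 'I_p, ~ D j i]%classic.
  apply: filter_forall => j.
  by have [Dj|] := in_ultra_setVsetC (D j) UU; [case: noj; exists j|].
have [i [/= ui /= iD]] := filter_ex (filterI uy allC).
have /(pabs_digit p_pr hQ)[j ij] : a ((u i - y) / d) <= 1.
  rewrite (Qp_absM hQ) (pabsV hQ) ad ler_pdivrMr ?mul1r //.
  by rewrite -ad (pabs_gt0 hQ).
case: (iD j); rewrite /D /=.
have -> : u i - (y + d * (j : nat)%:R) = d * ((u i - y) / d - (j : nat)%:R).
  by rewrite mulrBr mulrCA divff // mulr1 opprD addrA.
have -> : a c / p%:R ^+ m.+1 = a d / p%:R by rewrite ad exprSr invfM mulrA.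
rewrite (Qp_absM hQ) ler_wpM2l ?(Qp_abs_ge0 hQ) //.
exact: (pabs_lt1 p_pr hQ).
Qed.

(** A limit along [U] rather than a convergent subsequence: the same [U] serves for all the
    coordinates of a vector. *)
Lemma pabs_ulim (u : nat -> Q) (R : rat) : (forall i, a (u i) <= R) ->
  exists l, forall eps, 0 < eps -> U [set i | a (u i - l) < eps]%classic.
Proof.
move=> uR; have FU : Filter U := @filter_filter _ _ (@ultra_proper _ _ UU).
have [c Rc] : exists c, R <= a c.
  have [N /(_ N (leqnn N))] := exists_pow_small R (prime_gt1 p_pr) ltr01.
  rewrite ltr_pdivrMr ?mul1r ?exprn_gt0 ?p_gt0R // => RN; exists (p%:R ^- N).
  by rewrite (pabsV hQ) (pabsX hQ) (pabs_p p_pr hQ) exprVn invrK ltW.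
have exY m : exists y, B c u m y.
  elim: m => [|m [y /ultra_digit//]]; exists 0.
  by apply: filterS filterT => i _ /=; rewrite subr0 expr0 divr1 (le_trans (uR i)).
have [Y YB] := choice exY.
have YC (m n : nat) : (m <= n)%N -> a (Y m - Y n) <= a c / p%:R ^+ m.
  move=> mn; have [i [/= im /= iN]] := filter_ex (filterI (YB m) (YB n)).
  have -> : Y m - Y n = (u i - Y n) - (u i - Y m) by ring.
  apply: (pabsB_le p_pr hQ) => //; apply: le_trans iN _.
  rewrite ler_wpM2l ?(Qp_abs_ge0 hQ) // lef_pV2 ?posrE ?exprn_gt0 ?p_gt0R //.
  by rewrite ler_weXn2l // ltW ?p_gt1R.
have [l lY] : exists l, forall eps : rat, 0 < eps ->
    exists N, forall n, (N <= n)%N -> a (Y n - l) < eps.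
  apply: (Qp_complete hQ) => eps e0.
  have [N small] := exists_pow_small (a c) (prime_gt1 p_pr) e0.
  exists N => m n Nm Nn; wlog mn : m n Nm Nn / (m <= n)%N.
    move=> H; have /orP[/H|/H] := leq_total m n; first exact.
    by rewrite -(pabsN hQ) opprB; apply.
  exact: le_lt_trans (YC _ _ mn) (small _ Nm).
exists l => eps e0.
have [N1 small] := exists_pow_small (a c) (prime_gt1 p_pr) e0.
have [N2 close] := lY _ e0.
apply: filterS (YB (maxn N1 N2)) => i /= ui.
rewrite -(subrK (Y (maxn N1 N2)) (u i)) -addrA (pabsD_lt p_pr hQ) ?close ?leq_maxr //.
by apply: le_lt_trans ui _; rewrite small ?leq_maxl.
Qed.

End UltraLimit.

(** * The sup norm on a finite extension of Q_p *)

Section Norm.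

Variables (p : nat) (Q : fieldType) (a : Q -> rat).
Hypotheses (p_pr : prime p) (hQ : is_Qp p a).
Variable (E : fieldExtType Q).

Notation n := (\dim {:E}).
Let b := vbasis {:E}.
Let a_ge0 := Qp_abs_ge0 hQ.

Definition sup_norm (x : E) : rat := \big[Num.max/0]_(i < n) a (coord b i x).
Notation N := sup_norm.

Lemma sup_norm_ge0 x : 0 <= N x.
Proof. by rewrite /N bigmax_ge_id. Qed.

Lemma sup_norm_le x t : 0 <= t -> (forall i, a (coord b i x) <= t) -> N x <= t.
Proof. by move=> t0 xt; rewrite /N; apply: bigmax_le. Qed.

Lemma coord_le_sup_norm x i : a (coord b i x) <= N x.
Proof. by rewrite /N le_bigmax. Qed.

Lemma sup_norm0 : N 0 = 0.
Proof.
apply/le_anti; rewrite sup_norm_ge0 andbT; apply: sup_norm_le => // i.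
by rewrite linear0 (pabs0 hQ).
Qed.

Lemma sup_norm_coord x : x != 0 -> exists2 i, coord b i x != 0 & N x = a (coord b i x).
Proof.
move=> x0; have [i xi] : exists i, coord b i x != 0.
  apply/existsP; apply: contraNT x0; rewrite negb_exists => /forallP xE.
  rewrite (coord_vbasis (memvf x)) big1 // => i _.
  by have := xE i; rewrite negbK => /eqP->; rewrite scale0r.
have [NE|[j jE]] : N x = 0 \/ exists j, N x = a (coord b j x).
- rewrite /N; elim/big_ind: _ => [|u v|k _]; [by left| |by right; exists k].
  by case: (leP u v).
- by have := coord_le_sup_norm x i; rewrite NE leNgt (pabs_gt0 hQ) xi.
exists j => //.
rewrite -(pabs_gt0 hQ) -jE; apply: lt_le_trans (coord_le_sup_norm x i).
by rewrite (pabs_gt0 hQ).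
Qed.

Lemma sup_norm_gt0 x : x != 0 -> 0 < N x.
Proof. by move=> /sup_norm_coord[i xi ->]; rewrite (pabs_gt0 hQ). Qed.

Lemma sup_normZ c x : N (c *: x) = a c * N x.
Proof.
rewrite /N; elim/big_ind2: _ => [|u s v t uE vE|i _]; first by rewrite mulr0.
  by rewrite uE vE maxr_pMr.
by rewrite linearZ (Qp_absM hQ).
Qed.

Lemma sup_normN x : N (- x) = N x.
Proof. by rewrite -scaleN1r sup_normZ (pabsN hQ) (pabs1 hQ) mul1r. Qed.

Lemma sup_normD_le x y t : N x <= t -> N y <= t -> N (x + y) <= t.
Proof.
move=> xt yt; apply: sup_norm_le => [|i]; first exact: le_trans (sup_norm_ge0 x) xt.
rewrite linearD; apply: (pabsD_le p_pr hQ); exact: le_trans (coord_le_sup_norm _ i) _.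
Qed.

Lemma sup_norm_sum_le (I : finType) (x : I -> E) t :
  0 <= t -> (forall i, N (x i) <= t) -> N (\sum_i x i) <= t.
Proof.
move=> t0 xt; elim/big_ind: _ => //; first by rewrite sup_norm0.
by move=> u v; exact: sup_normD_le.
Qed.

Lemma sup_normM : exists2 C, 0 < C & forall x y, N (x * y) <= C * N x * N y.
Proof.
pose C := \big[Num.max/1]_(ij : 'I_n * 'I_n) N (b`_ij.1 * b`_ij.2).
have C1 : 1 <= C by rewrite /C bigmax_ge_id.
exists C => [|x y]; first exact: lt_le_trans C1.
have xy0 : 0 <= C * N x * N y by rewrite !mulr_ge0 ?sup_norm_ge0 // (le_trans _ C1).
rewrite {1}(coord_vbasis (memvf x)) {1}(coord_vbasis (memvf y)) mulr_suml.
apply: sup_norm_sum_le => // i; rewrite mulr_sumr; apply: sup_norm_sum_le => // j.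
rewrite -scalerAl -scalerAr !sup_normZ.
have -> : C * N x * N y = N x * (N y * C) by ring.
have ge0 := (a_ge0, sup_norm_ge0).
apply: ler_pM; rewrite ?mulr_ge0 ?ge0 ?coord_le_sup_norm //.
apply: ler_pM; rewrite ?ge0 ?coord_le_sup_norm //.
exact: (le_bigmax 1 (fun ij : 'I_n * 'I_n => N (b`_ij.1 * b`_ij.2)) (i, j)).
Qed.

Lemma sup_norm_ulim (U : set_system nat) (UU : UltraFilter U) (x : nat -> E) (R : rat) :
  (forall i, N (x i) <= R) ->
  exists l, forall eps, 0 < eps -> U [set i | N (x i - l) < eps]%classic.
Proof.
move=> xR; have FU : Filter U := @filter_filter _ _ (@ultra_proper _ _ UU).
have exl (j : 'I_n) : exists l, forall eps, 0 < eps ->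
    U [set i | a (coord b j (x i) - l) < eps]%classic.
  by apply: (pabs_ulim p_pr hQ UU) => i; exact: le_trans (coord_le_sup_norm _ _) (xR i).
have [l lP] := choice exl.
exists (\sum_j l j *: b`_j) => eps e0; have e20 : 0 < eps / 2 by lra.
have := filter_forall FU (fun j : 'I_n => lP j _ e20); apply: filterS => i /= close.
apply: le_lt_trans (_ : eps / 2 < _); last by lra.
apply: sup_norm_le => [|j]; first exact: ltW.
rewrite linearB /= coord_sum_free ?(basis_free (vbasisP _)) //.
by apply: ltW; exact: close.
Qed.

Lemma exists_ultra_oo : exists2 U : set_system nat, UltraFilter U & (eventually `<=` U)%classic.
Proof. by have [U [UU sU]] := @ultraFilterLemma _ eventually _; exists U. Qed.

(* On the sphere [N x = 1], compactness provides a limit [x0 != 0]; and when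
   [x = x0 + h] with [h] small, [x^-1 = x0^-1 (1 - h x^-1)] bounds [N x^-1]. *)
Lemma sup_normV : exists2 C, 0 < C & forall x, N x * N x^-1 <= C.
Proof.
have [C C0 NM] := sup_normM.
apply: contrapT => noC.
have bad (m : nat) : exists x : E, N x = 1 /\ m%:R < N x^-1.
  have [x xm] : exists x, ~ (N x * N x^-1 <= m.+1%:R).
    by apply: contrapT => nox; apply: noC; exists m.+1%:R => // x;
      apply: contrapT => xm; apply: nox; exists x.
  have x0 : x != 0 by apply/eqP => x0; apply: xm; rewrite x0 sup_norm0 mul0r ler0n.
  have [i xi NxE] := sup_norm_coord x0.
  (* Scaling by a coordinate of largest absolute value puts [x] on the unit sphere and leaves
     [N x * N x^-1] unchanged. *)
  exists ((coord b i x)^-1 *: x); rewrite sup_normZ (pabsV hQ) -NxE.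
  have Nx0 : N x != 0 by rewrite gt_eqF // sup_norm_gt0.
  split; first by rewrite mulVf.
  rewrite -[_ *: x]mulr_algl invfM -(fmorphV (in_alg E)) invrK mulr_algl sup_normZ -NxE.
  move/negP: xm; rewrite -ltNge.
  by apply: lt_trans; rewrite ltr_nat.
have [x xP] := choice bad.
have [U UU ooU] := exists_ultra_oo.
have FU : Filter U := @filter_filter _ _ (@ultra_proper _ _ UU).
have [|x0 x0P] := @sup_norm_ulim U UU x 1; first by move=> i; rewrite (xP i).1.
have x0n0 : x0 != 0.
  apply/eqP => x00; have [i /=] := filter_ex (x0P _ ltr01).
  by rewrite x00 subr0 (xP i).1 ltxx.
(* With this [e], the term [D C N(x i - x0) N z] is smaller than [N z], so the ultrametric
   inequality leaves [N z <= D N 1], against [D N 1 < m <= i < N z]. *)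
pose D := C * N x0^-1; pose e := (D * C)^-1.
have D0 : 0 < D by rewrite mulr_gt0 // sup_norm_gt0 // invr_neq0.
have e0 : 0 < e by rewrite invr_gt0 mulr_gt0.
have [m mD] : exists m : nat, D * N 1 < m%:R by exists (Num.truncn (D * N 1)).+1; rewrite truncnS_gt.
have ge_m : U [set i | (m <= i)%N]%classic by apply: ooU; exists m.
have [i [/= ix0 /= mi]] := filter_ex (filterI (x0P _ e0) ge_m).
have [Nxi xVi] := xP i; pose z := (x i)^-1; rewrite -/z in xVi.
have xi0 : x i != 0 by apply/eqP => xi0; move: Nxi; rewrite xi0 sup_norm0 => /eqP; rewrite eq_sym oner_eq0.
have zE : z = x0^-1 * (1 - (x i - x0) * z).
  by rewrite mulrBl divff // subKr mulKf.
have z0 : 0 < N z by rewrite sup_norm_gt0 // invr_neq0.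
have : N z <= Num.max (D * N 1) (D * (C * N (x i - x0) * N z)).
  have : N z <= D * N (1 - (x i - x0) * z) by rewrite {1}zE NM.
  move=> /le_trans; apply; rewrite -maxr_pMr; last exact: ltW.
  rewrite ler_wpM2l ?(ltW D0) //; apply: sup_normD_le; rewrite le_max ?lexx //.
  by rewrite sup_normN NM orbT.
rewrite le_max => /orP[zD|].
  have := lt_le_trans (le_lt_trans zD mD) (_ : m%:R <= i%:R); rewrite ler_nat.
  by move=> /(_ mi) /lt_trans /(_ xVi); rewrite ltxx.
apply/negP; rewrite -ltNge !mulrA -[ltRHS]mul1r ltr_pM2r //.
have DC : 0 < D * C by rewrite mulr_gt0.
by rewrite -(mulfV (lt0r_neq0 DC)) ltr_pM2l.
Qed.

End Norm.

(* [av_residue] says that the residue field is algebraic over its prime field. *)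
Record padic_absval (p : nat) (E : fieldType) (w : E -> rat) : Prop := PadicAbsval {
  av_ge0 : forall x, 0 <= w x;
  av_eq0 : forall x, w x = 0 -> x = 0;
  avM : forall x y, w (x * y) = w x * w y;
  avD : forall x y, w (x + y) <= Num.max (w x) (w y);
  av_value : forall x, x != 0 -> exists z : int, w x = p%:R ^ z;
  av_p : w p%:R < 1;
  av_p_neq0 : p%:R != 0 :> E;
  av_prime : forall q, prime q -> q != p -> w q%:R = 1;
  av_residue : forall x, w x = 1 -> exists2 m, (0 < m)%N & w (x ^+ m - 1) < 1
}.

(** * Extending the absolute value to a finite extension *)

Section ExtendAbs.

Variables (p : nat) (Q : fieldType) (a : Q -> rat).
Hypotheses (p_pr : prime p) (hQ : is_Qp p a).
Variable (E : fieldExtType Q).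

Notation n := (\dim {:E}).
Let b := vbasis {:E}.
Let N := sup_norm a (E := E).

Definition regular_mx (x : E) : 'M[Q]_n := \matrix_(i, j) coord b j (b`_i * x).

(* The [n]-th power of the extension of [a] to [E]; no root is extracted, so that the
   values stay rational. *)
Definition ext_abs (x : E) : rat := a (\det (regular_mx x)).
Notation w := ext_abs.

Lemma regular_mxM x y : regular_mx (x * y) = regular_mx x *m regular_mx y.
Proof.
apply/matrixP => i j; rewrite !mxE mulrA.
rewrite {1}(coord_vbasis (memvf (b`_i * x))) mulr_suml linear_sum.
by apply: eq_bigr => k _; rewrite !mxE -scalerAl linearZ.
Qed.

Lemma regular_mx_alg c : regular_mx c%:A = c%:M.
Proof.
apply/matrixP => i j; rewrite !mxE -scalerAr mulr1 linearZ /=.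
by rewrite coord_free ?(basis_free (vbasisP _)) // mulr_natr eq_sym.
Qed.

Lemma ext_abs_alg c : w c%:A = a c ^+ n.
Proof. by rewrite /w regular_mx_alg det_scalar (pabsX hQ). Qed.

Lemma ext_abs1 : w 1 = 1.
Proof. by rewrite -[1]scale1r ext_abs_alg (pabs1 hQ) expr1n. Qed.

Lemma ext_absM x y : w (x * y) = w x * w y.
Proof. by rewrite /w regular_mxM det_mulmx (Qp_absM hQ). Qed.

Lemma ext_absX x m : w (x ^+ m) = w x ^+ m.
Proof. by elim: m => [|m IHm]; rewrite ?ext_abs1 // !exprS ext_absM IHm. Qed.

Lemma ext_abs_neq0 x : x != 0 -> w x != 0.
Proof.
move=> x0; apply/eqP => wx; have := ext_absM x x^-1.
by rewrite divff // wx mul0r ext_abs1 => /eqP; rewrite oner_eq0.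
Qed.

Lemma ext_absV x : x != 0 -> w x^-1 = (w x)^-1.
Proof.
move=> x0; apply: (mulfI (ext_abs_neq0 x0)).
by rewrite -ext_absM !divff ?ext_abs1 ?ext_abs_neq0.
Qed.

Let dim_gt0 : (0 < n)%N.
Proof. exact: adim_gt0. Qed.

Lemma ext_abs0 : w 0 = 0.
Proof. by rewrite -(scale0r 1) ext_abs_alg (pabs0 hQ) expr0n eqn0Ngt dim_gt0. Qed.

Lemma ext_abs_ge0 x : 0 <= w x. Proof. exact: Qp_abs_ge0 hQ _. Qed.

Lemma ext_abs_upper : exists2 C, 0 < C & forall x, w x <= C * N x ^+ n.
Proof.
have [C C0 NM] := sup_normM p_pr hQ E.
pose D := \big[Num.max/1]_(i < n) N b`_i.
have D0 : 0 < D by rewrite (lt_le_trans ltr01) // /D bigmax_ge_id.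
exists ((C * D) ^+ n) => [|x]; first by rewrite exprn_gt0 ?mulr_gt0.
have CD0 : 0 <= C * D * N x by rewrite !mulr_ge0 ?(ltW C0) ?(ltW D0) ?sup_norm_ge0.
rewrite -exprMn; apply: (pabs_sum_max p_pr hQ); first exact: exprn_ge0.
move=> s; rewrite (Qp_absM hQ) (pabsX hQ) (pabsN hQ) (pabs1 hQ) expr1n mul1r.
have aprod (I : finType) (u : I -> Q) : a (\prod_i u i) = \prod_i a (u i).
  by rewrite (big_morph a (Qp_absM hQ) (pabs1 hQ)).
rewrite aprod -[n in leRHS]card_ord -prodr_const; apply: ler_prod => i _.
rewrite (Qp_abs_ge0 hQ) //= mxE; apply: le_trans (coord_le_sup_norm _ _ _) _.
apply: le_trans (NM _ _) _; rewrite ler_wpM2r ?sup_norm_ge0 // ler_wpM2l ?(ltW C0) //.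
exact: (le_bigmax 1 (fun i : 'I_n => N b`_i) i).
Qed.

(** The upper bound applied to [x^-1], combined with the bound on [N x * N x^-1]. *)
Lemma ext_abs_lower : exists2 C, 0 < C & forall x, N x ^+ n <= C * w x.
Proof.
have [C C0 wC] := ext_abs_upper; have [D D0 ND] := sup_normV p_pr hQ E.
exists (C * D ^+ n) => [|x]; first by rewrite mulr_gt0 ?exprn_gt0.
have [->|x0] := eqVneq x 0.
  by rewrite /N (sup_norm0 hQ) ext_abs0 mulr0 expr0n eqn0Ngt dim_gt0.
have wx0 : 0 < w x by rewrite lt_def ext_abs_neq0 ?ext_abs_ge0.
have := wC x^-1; rewrite ext_absV // => wV.
have : 1 <= w x * (C * N x^-1 ^+ n) by rewrite -(divff (lt0r_neq0 wx0)) ler_pM2l.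
have Nn0 : 0 <= N x ^+ n by rewrite exprn_ge0 ?sup_norm_ge0.
move=> /(ler_wpM2l Nn0); rewrite mulr1 => /le_trans; apply.
have -> : N x ^+ n * (w x * (C * N x^-1 ^+ n)) = (C * w x) * (N x * N x^-1) ^+ n.
  by rewrite exprMn; ring.
rewrite -[leRHS]mulrAC ler_wpM2l ?mulr_ge0 ?(ltW C0) ?(ltW wx0) //.
by rewrite lerXn2r ?nnegrE ?mulr_ge0 ?sup_norm_ge0 // ltW.
Qed.

(** With its converse below, this expresses [w x <= 1] by bounded powers of [x], a criterion without
    determinants: it yields the ultrametric inequality and the compatibility with field
    morphisms. *)
Lemma ext_abs_pow_bounded x : w x <= 1 ->
  exists2 R, 0 < R & forall m, N (x ^+ m) <= R.
Proof.
move=> x1; have [C C0 NC] := ext_abs_lower.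
exists (1 + C) => [|m]; first by rewrite addr_gt0.
have NmC : N (x ^+ m) ^+ n <= C.
  apply: le_trans (NC _) _; rewrite ext_absX -[leRHS]mulr1 ler_wpM2l ?(ltW C0) //.
  by rewrite exprn_ile1 ?ext_abs_ge0.
(* Either the norm is at most 1, or it is at most its own [n]-th power, hence at most [C]; whence
   the constant [1 + C]. *)
have [Nm1|/ltW Nm1] := leP (N (x ^+ m)) 1; first by rewrite (le_trans Nm1) // lerDl ltW.
apply: le_trans (_ : C <= _); last by rewrite lerDr.
by apply: le_trans NmC; rewrite -[leLHS]expr1 ler_weXn2l // dim_gt0.
Qed.

Lemma ext_abs_le1_of_pow_bounded x R : (forall m, N (x ^+ m) <= R) -> w x <= 1.
Proof.
move=> xR; have [C C0 wC] := ext_abs_upper.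
have R0 : 0 <= R by apply: le_trans (xR 0%N); exact: sup_norm_ge0.
have ub m : w x ^+ m <= C * R ^+ n.
  rewrite -ext_absX; apply: le_trans (wC _) _; rewrite ler_wpM2l ?(ltW C0) //.
  by rewrite lerXn2r ?nnegrE ?sup_norm_ge0.
apply: (@le1_of_expr_le_linear _ (C * R ^+ n)) => [|m]; first exact: ext_abs_ge0.
by apply: le_trans (ub m) _; rewrite mulrS lerDl mulrn_wge0 // mulr_ge0 ?exprn_ge0 ?(ltW C0).
Qed.

Lemma ext_abs_add1 x : w x <= 1 -> w (1 + x) <= 1.
Proof.
move=> /ext_abs_pow_bounded[R R0 xR]; apply: (@ext_abs_le1_of_pow_bounded _ R) => m.
rewrite exprDn; apply: (sup_norm_sum_le p_pr hQ) => // [|i]; first exact: ltW.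
rewrite expr1n mul1r -scaler_nat (sup_normZ hQ) -[R]mul1r.
by apply: ler_pM; rewrite ?(Qp_abs_ge0 hQ) ?sup_norm_ge0 ?(pabs_natr_le1 p_pr hQ) //; exact: xR.
Qed.

Lemma ext_absD x y : w (x + y) <= Num.max (w x) (w y).
Proof.
wlog xy : x y / w x <= w y.
  move=> H; have /orP[/H //|yx] := le_total (w x) (w y).
  by rewrite addrC maxC; exact: H.
rewrite (max_idPr xy); have [y0|y0] := eqVneq y 0.
  move: xy; rewrite y0 ext_abs0 addr0; have [-> _|x0] := eqVneq x 0; first by rewrite ext_abs0.
  by rewrite leNgt lt_def ext_abs_neq0 ?ext_abs_ge0.
have wy0 : 0 < w y by rewrite lt_def ext_abs_neq0 ?ext_abs_ge0.
rewrite -[x + y](@mulfVK _ y) // ext_absM -{2}[w y]mul1r ler_wpM2r ?(ltW wy0) //.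
rewrite mulrDl divff // addrC ext_abs_add1 // ext_absM ext_absV //.
by rewrite ler_pdivrMr ?mul1r.
Qed.

(** The powers of [x] are bounded, so two of them, [x ^ i] and [x ^ j], are close to a common limit;
    dividing by [x ^ i] gives the exponent [j - i]. *)
Lemma ext_abs_residue x : w x = 1 -> exists2 m, (0 < m)%N & w (x ^+ m - 1) < 1.
Proof.
move=> x1; have [U UU ooU] := exists_ultra_oo.
have FU : Filter U := @filter_filter _ _ (@ultra_proper _ _ UU).
have [|R R0 xR] := @ext_abs_pow_bounded x; first by rewrite x1.
have [l lP] := sup_norm_ulim p_pr hQ UU xR.
have [C C0 wC] := ext_abs_upper.
(* This [e] makes [C e ^ n <= C e < 1]. *)
pose e := (1 + C)^-1; have e0 : 0 < e by rewrite invr_gt0 addr_gt0.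
have e1 : e <= 1 by rewrite invf_le1 ?lerDl ?(ltW C0) // addr_gt0.
have [i /= il] := filter_ex (lP _ e0).
have gt_i : U [set j | (i < j)%N]%classic by apply: ooU; exists i.+1.
have [j [/= jl /= ij]] := filter_ex (filterI (lP _ e0) gt_i).
exists (j - i)%N; first by rewrite subn_gt0.
have -> : w (x ^+ (j - i) - 1) = w (x ^+ j - x ^+ i).
  rewrite -(subnK (ltnW ij)) exprD addnK -[X in _ * x ^+ i - X]mul1r -mulrBl ext_absM.
  by rewrite ext_absX x1 expr1n mulr1.
have Nij : N (x ^+ j - x ^+ i) <= e.
  have -> : x ^+ j - x ^+ i = (x ^+ j - l) - (x ^+ i - l) by ring.
  by apply: (sup_normD_le p_pr hQ); rewrite ?(sup_normN hQ) ltW.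
apply: le_lt_trans (wC _) _; apply: le_lt_trans (_ : C * e < 1); last first.
  by rewrite ltr_pdivrMr ?addr_gt0 // mul1r ltrDr.
rewrite ler_wpM2l ?(ltW C0) //; apply: le_trans (_ : e ^+ n <= e).
  by rewrite lerXn2r ?nnegrE ?sup_norm_ge0 // ltW.
by rewrite -[leRHS]expr1 ler_wiXn2l ?(ltW e0) // dim_gt0.
Qed.

Lemma ext_abs_is_absval : padic_absval p w.
Proof.
split; [exact: ext_abs_ge0| |exact: ext_absM|exact: ext_absD| | | | |exact: ext_abs_residue].
- by move=> x wx; apply/eqP; apply: contraT => /ext_abs_neq0; rewrite wx eqxx.
- move=> x x0; apply: (pabs_value p_pr hQ); rewrite -(pabs_eq0 hQ).
  exact: ext_abs_neq0.
- rewrite -scaler_nat ext_abs_alg (pabs_p p_pr hQ).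
  by rewrite exprn_ilt1 ?invr_ge0 ?ler0n ?invf_lt1 ?p_gt0R ?p_gt1R // -lt0n dim_gt0.
- rewrite -scaler_nat scaler_eq0 oner_eq0 orbF -(pabs_eq0 hQ) (pabs_p p_pr hQ).
  by rewrite invr_eq0 gt_eqF // p_gt0R.
move=> q q_pr qp; rewrite -scaler_nat ext_abs_alg (pabs_nat hQ) ?prime_gt0 //.
by rewrite lognE p_pr prime_gt0 //= dvdn_prime2 // eq_sym (negPf qp) expr0 invr1 expr1n.
Qed.

(** The matrices of multiplication by [x] and by [s x] are conjugate under the matrix of [s], so
    they have the same determinant. *)
Lemma ext_abs_aut (s t : {linear E -> E}) :
  {morph s : x y / x * y} -> cancel s t -> forall x, w (s x) = w x.
Proof.
move=> s_mul st x.
pose mx (f : E -> E) : 'M[Q]_n := \matrix_(i, j) coord b j (f b`_i).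
have mxE' (f : {linear E -> E}) y : f y = \sum_k coord b k y *: f b`_k.
  rewrite {1}(coord_vbasis (memvf y)) linear_sum.
  by apply: eq_bigr => k _; rewrite linearZ.
have mxM : mx s *m mx t = 1%:M.
  apply/matrixP => i j; rewrite !mxE -(coord_free _ _ (basis_free (vbasisP {:E}))) -/b.
  rewrite -[b`_i in RHS]st (mxE' t (s _)) linear_sum.
  by apply: eq_bigr => k _; rewrite !mxE linearZ.
have sx : mx s *m regular_mx (s x) = regular_mx x *m mx s.
  apply/matrixP => i j; rewrite !mxE.
  transitivity (coord b j (s b`_i * s x)).
    rewrite [in RHS](coord_vbasis (memvf (s b`_i))) mulr_suml linear_sum.
    by apply: eq_bigr => k _; rewrite !mxE -scalerAl linearZ.
  rewrite -s_mul (mxE' s (_ * _)) linear_sum.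
  by apply: eq_bigr => k _; rewrite !mxE linearZ.
have ds : \det (mx s) != 0.
  have /(congr1 determinant) := mxM; rewrite det_mulmx det1 => /eqP.
  by apply: contraTneq => ->; rewrite mul0r eq_sym oner_eq0.
apply: (congr1 a); apply: (mulfI ds).
by rewrite -det_mulmx sx det_mulmx mulrC.
Qed.

End ExtendAbs.

Lemma exprD_middle (R : comNzRingType) (x y : R) n : (0 < n)%N ->
  (x + y) ^+ n = x ^+ n + y ^+ n + \sum_(i < n.-1) x ^+ (n.-1 - i) * y ^+ i.+1 *+ 'C(n, i.+1).
Proof.
case: n => // n _; rewrite exprDn big_ord_recl big_ord_recr /=.
rewrite bin0 subn0 expr0 mulr1 mulr1n /bump /= add1n binn subnn mul1r mulr1n.
by rewrite -!addrA; congr (_ + _); rewrite addrC; congr (_ + _).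
Qed.

(** * Arithmetic modulo the maximal ideal *)

Section AbsvalTheory.

Variables (p : nat) (E : fieldType) (w : E -> rat).
Hypotheses (p_pr : prime p) (hw : padic_absval p w).

Let w_ge0 := av_ge0 hw.
Let wM := avM hw.

Lemma av0 : w 0 = 0.
Proof.
have w0 := wM 0 p%:R; rewrite mul0r in w0; apply/eqP; apply: contraTT isT => n0.
have /(mulfI n0) := etrans (mulr1 _) w0.
by move=> p1; have := av_p hw; rewrite -p1 ltxx.
Qed.

Lemma av_eq0E x : (w x == 0) = (x == 0).
Proof. by apply/eqP/eqP => [/(av_eq0 hw)|->] //; exact: av0. Qed.

Lemma av_gt0 x : (0 < w x) = (x != 0).
Proof. by rewrite lt_def av_eq0E w_ge0 andbT. Qed.

Lemma av1 : w 1 = 1.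
Proof.
have n0 : w 1 != 0 by rewrite av_eq0E oner_eq0.
by apply: (mulfI n0); rewrite -wM !mulr1.
Qed.

Lemma avX x n : w (x ^+ n) = w x ^+ n.
Proof. by elim: n => [|n IHn]; rewrite ?av1 // !exprS wM IHn. Qed.

Lemma avN1 : w (- 1) = 1.
Proof.
have : w (- 1) ^+ 2 = 1 by rewrite -avX sqrrN expr1n av1.
have := w_ge0 (- 1); set t := w _ => t0 /eqP; rewrite sqrf_eq1.
by case/orP => /eqP // tE; rewrite tE in t0; lra.
Qed.

Lemma avN x : w (- x) = w x.
Proof. by rewrite -mulN1r wM avN1 mul1r. Qed.

Lemma avV x : w x^-1 = (w x)^-1.
Proof.
have [->|x0] := eqVneq x 0; first by rewrite invr0 av0 invr0.
have n0 : w x != 0 by rewrite av_eq0E.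
by apply: (mulfI n0); rewrite -wM !divff // av1.
Qed.

Lemma avD_lt x y t : w x < t -> w y < t -> w (x + y) < t.
Proof. by move=> xt yt; apply: le_lt_trans (avD hw x y) _; rewrite gt_max xt. Qed.

Lemma avD_le x y t : w x <= t -> w y <= t -> w (x + y) <= t.
Proof. by move=> xt yt; apply: le_trans (avD hw x y) _; rewrite ge_max xt. Qed.

Lemma avB_lt x y t : w x < t -> w y < t -> w (x - y) < t.
Proof. by move=> xt yt; apply: avD_lt => //; rewrite avN. Qed.

Lemma avB_le x y t : w x <= t -> w y <= t -> w (x - y) <= t.
Proof. by move=> xt yt; apply: avD_le => //; rewrite avN. Qed.

Lemma av_sum_lt (I : Type) (r : seq I) (P : pred I) (F : I -> E) t :
  0 < t -> (forall i, P i -> w (F i) < t) -> w (\sum_(i <- r | P i) F i) < t.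
Proof.
move=> t0 Ft; elim/big_ind: _ => //; first by rewrite av0.
by move=> u v; exact: avD_lt.
Qed.

Lemma avD_dom x y : w y < w x -> w (x + y) = w x.
Proof.
move=> yx; apply: le_anti; rewrite avD_le //=; last exact: ltW.
rewrite leNgt; apply/negP => xyx.
by have := avB_lt xyx yx; rewrite addrK ltxx.
Qed.

Lemma av_near1 u : w (u - 1) < 1 -> w u = 1.
Proof. by move=> u1; rewrite -(subrK 1 u) addrC avD_dom av1. Qed.

Lemma av_near1M u v : w (u - 1) < 1 -> w (v - 1) < 1 -> w (u * v - 1) < 1.
Proof.
move=> u1 v1; have -> : u * v - 1 = (u - 1) * v + (v - 1) by ring.
by rewrite avD_lt // wM (av_near1 v1) mulr1.
Qed.

Lemma av_nat n : w n%:R <= 1.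
Proof. by elim: n => [|n IHn]; rewrite ?av0 // -natr1 avD_le ?av1. Qed.

Lemma av_natMp n : (p %| n)%N -> w n%:R < 1.
Proof.
case/dvdnP=> m ->; rewrite natrM wM; apply: le_lt_trans (av_p hw).
by rewrite ler_piMl ?av_nat.
Qed.

Lemma av_nat_coprime n : ~~ (p %| n)%N -> w n%:R = 1.
Proof.
rewrite -prime_coprime // coprime_sym; case: n => [|n].
  by rewrite /coprime gcd0n => /eqP p1; move: p_pr; rewrite p1.
move=> /coprimeP -/(_ isT)[[u v] /= uv].
have uv' : (u * n.+1 = v * p + 1)%N by lia.
have : w (u * n.+1)%:R = 1.
  by rewrite uv' natrD av_near1 // addrK av_natMp // dvdn_mull.
rewrite natrM wM => un; apply: le_anti; rewrite av_nat /= leNgt; apply/negP => n1.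
have : w u%:R * w n.+1%:R < 1 by apply: le_lt_trans n1; rewrite ler_piMl ?av_nat.
by rewrite un ltxx.
Qed.

(** The Frobenius congruence: the middle binomial coefficients are divisible by [p]. *)
Lemma av_frobenius x : w x <= 1 -> w ((1 + x) ^+ p - 1 - x ^+ p) < 1.
Proof.
move=> x1; rewrite exprD_middle ?prime_gt0 // expr1n; set S := \sum_(_ < _) _.
have -> : 1 + x ^+ p + S - 1 - x ^+ p = S by ring.
apply: av_sum_lt => // i _; rewrite expr1n mul1r -mulr_natl wM avX.
apply: le_lt_trans (av_natMp (_ : p %| 'C(p, i.+1))%N).
  by rewrite ler_piMr ?exprn_ile1.
by rewrite prime_dvd_bin //=; have := ltn_ord i; have := prime_gt0 p_pr; lia.
Qed.

(* In the residue field, of characteristic [p], [p]-power torsion is trivial. *)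
Lemma av_root_near1 u : w (u ^+ p - 1) < 1 -> w (u - 1) < 1.
Proof.
move=> up; have u1 : w u <= 1.
  rewrite leNgt; apply/negP => u1; have := av_near1 up; rewrite avX => /eqP.
  by rewrite gt_eqF // exprn_egt1 // -lt0n prime_gt0.
have v1 : w (u - 1) <= 1 by rewrite avB_le ?av1.
have := av_frobenius v1; rewrite [1 + _]addrC subrK => fr.
have : w ((u - 1) ^+ p) < 1.
  by rewrite -(subKr (u ^+ p - 1) ((u - 1) ^+ p)) avB_lt.
rewrite avX; apply: contraTT; rewrite -!leNgt => /exprn_ege1; exact.
Qed.

(* The sums [e c] of [(x^-c y)^i] satisfy [e c * (x^-c y - 1) = 0] in the residue
   field and add up to [d != 0]. *)
Lemma av_unity_root x y d : (0 < d)%N ->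
  w (x ^+ d - 1) < 1 -> (forall i, (0 < i < d)%N -> 1 <= w (x ^+ i - 1)) ->
  w (y ^+ d - 1) < 1 -> exists c, w (y - x ^+ c) < 1.
Proof.
move=> d0 xd xmin yd; apply: contrapT => noc.
have far c : 1 <= w (y - x ^+ c).
  by rewrite leNgt; apply/negP => yc; apply: noc; exists c.
have unit1 u : w (u ^+ d - 1) < 1 -> w u = 1.
  by move=> /av_near1; rewrite avX => /eqP; rewrite pexpr_eq1 // => /eqP.
have wx := unit1 _ xd; have wy := unit1 _ yd.
have x0 : x != 0 by rewrite -av_gt0 wx.
have near1X u n : w (u - 1) < 1 -> w (u ^+ n - 1) < 1.
  move=> u1; elim: n => [|n IHn]; first by rewrite subrr av0.
  by rewrite exprS av_near1M.
have geom t : w (t ^+ d - 1) < 1 -> 1 <= w (t - 1) -> w (\sum_(i < d) t ^+ i) < 1.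
  rewrite subrX1 wM => td t1; rewrite ltNge; apply/negP => /(ler_pM ler01 ler01 t1).
  by rewrite mulr1 leNgt td.
have shift z i : w (x^-1 ^+ i * z - 1) = w (z - x ^+ i).
  have -> : x^-1 ^+ i * z - 1 = x^-1 ^+ i * (z - x ^+ i).
    by rewrite mulrBr exprVn mulVf ?expf_neq0.
  by rewrite wM avX avV wx invr1 expr1n mul1r.
have shift1 i : w (x^-1 ^+ i - 1) = w (x ^+ i - 1).
  by rewrite -[x^-1 ^+ i]mulr1 shift -avN opprB.
have vd : w (x^-1 ^+ d - 1) < 1 by rewrite shift1.
have vmin i : (0 < i < d)%N -> 1 <= w (x^-1 ^+ i - 1) by rewrite shift1; exact: xmin.
pose e c := \sum_(i < d) (x^-1 ^+ c * y) ^+ i.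
have e1 (c : 'I_d) : w (e c) < 1.
  apply: geom.
    by rewrite exprMn exprAC av_near1M // near1X.
  by rewrite shift.
(* In the sum over [c], the exponent [i = 0] contributes [d]; each other [i] contributes a geometric
   sum of powers of [x^-1 ^+ i], which vanishes in the residue field. *)
have eE : \sum_(c < d) e c = d%:R + \sum_(i < d | (0 < i)%N) y ^+ i * \sum_(c < d) (x^-1 ^+ i) ^+ c.
  rewrite /e exchange_big /= (bigID (fun i : 'I_d => (0 < i)%N)) /= addrC; congr (_ + _).
    rewrite (bigD1 (Ordinal d0)) //= [X in _ + X]big1 => [|i]; last first.
      by rewrite -leqNgt leqn0 => /andP[/eqP i0 /eqP []]; apply: val_inj.
    by rewrite addr0 sumr_const card_ord.
  apply: eq_bigr => i _; rewrite mulr_sumr; apply: eq_bigr => c _.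
  by rewrite exprMn exprAC mulrC.
have wd : w d%:R < 1.
  rewrite -(addrK (\sum_(i < d | (0 < i)%N) y ^+ i * \sum_(c < d) (x^-1 ^+ i) ^+ c) d%:R) -eE.
  apply: avB_lt; apply: av_sum_lt => // i i0.
  rewrite wM avX wy expr1n mul1r; apply: geom; last by apply: vmin; rewrite i0 ltn_ord.
  by rewrite exprAC; apply: near1X.
(* Hence [p] divides [d], and [x ^ (d / p)], a [p]-torsion element of the residue field, is 1 there,
   against the minimality of [d]. *)
have [/dvdnP[m dE]|/av_nat_coprime wd1] := boolP (p %| d)%N; last by rewrite wd1 ltxx in wd.
have m0 : (0 < m)%N by move: d0; rewrite dE muln_gt0 => /andP[].
have md : (0 < m < d)%N by rewrite m0 dE ltn_Pmulr // prime_gt1.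
have := xmin m md; rewrite leNgt av_root_near1 // -exprM -dE.
exact: xd.
Qed.

End AbsvalTheory.

(** * Ramification groups *)

Section Ramification.

Variables (p : nat) (F0 : fieldType) (M : splittingFieldType F0) (w : M -> rat).
Hypotheses (p_pr : prime p) (hw : padic_absval p w).
Hypothesis w_gal : forall (s : gal_of {:M}) x, w (s x) = w x.

Local Notation G := ('Gal({:M} / 1))%g.

Lemma mem_galf (s : gal_of {:M}) : s \in G.
Proof. by rewrite gal_kHom ?sub1v ?k1AHom. Qed.

Lemma galfM (s t : gal_of {:M}) x : (s * t)%g x = t (s x).
Proof. by rewrite galM ?memvf. Qed.

Definition inertia : {set gal_of {:M}} :=
  [set s : gal_of {:M} | `[< forall x, w x <= 1 -> w (s x - x) < 1 >]].

(** The first ramification group, usually called [G_1]. Testing all [x != 0] avoids the choice of a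
    uniformizer of [M]. *)
Definition wild_inertia : {set gal_of {:M}} :=
  [set s : gal_of {:M} | `[< forall x, x != 0 -> w (s x / x - 1) < 1 >]].

Lemma inertiaP (s : gal_of {:M}) : reflect (forall x, w x <= 1 -> w (s x - x) < 1) (s \in inertia).
Proof. by rewrite inE; exact: asboolP. Qed.

Lemma wild_inertiaP (s : gal_of {:M}) :
  reflect (forall x, x != 0 -> w (s x / x - 1) < 1) (s \in wild_inertia).
Proof. by rewrite inE; exact: asboolP. Qed.

Fact inertia_group_set : group_set inertia.
Proof.
apply/group_setP; split=> [|s t /inertiaP sI /inertiaP tI]; apply/inertiaP => x x1.
  by rewrite gal_id subrr (av0 hw).
rewrite galfM -(subrK (t x) (t (s x))) -rmorphB -addrA (avD_lt hw) ?tI //.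
by rewrite w_gal sI.
Qed.
Canonical inertia_group := Group inertia_group_set.

Fact wild_inertia_group_set : group_set wild_inertia.
Proof.
apply/group_setP; split=> [|s t /wild_inertiaP sP /wild_inertiaP tP]; apply/wild_inertiaP => x x0.
  by rewrite gal_id divff // subrr (av0 hw).
have sx0 : s x != 0 by rewrite fmorph_eq0.
have -> : (s * t)%g x / x = (t (s x) / s x) * (s x / x) by rewrite galfM mulrA mulfVK.
by rewrite (av_near1M hw) ?tP ?sP.
Qed.
Canonical wild_inertia_group := Group wild_inertia_group_set.

Lemma inertia_normal : (inertia <| G)%g.
Proof.
apply/andP; split; first by apply/subsetP => s _; exact: mem_galf.
apply/subsetP => t _; rewrite inE; apply/subsetP => _ /imsetP[s /inertiaP sI ->].
apply/inertiaP => x x1; rewrite conjgE !galfM -{2}[x](gal_id {:M}) -(mulVg t) galfM.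
by rewrite -rmorphB w_gal sI // w_gal.
Qed.

Lemma wild_inertia_normal : (wild_inertia <| G)%g.
Proof.
apply/andP; split; first by apply/subsetP => s _; exact: mem_galf.
apply/subsetP => t _; rewrite inE; apply/subsetP => _ /imsetP[s /wild_inertiaP sP ->].
apply/wild_inertiaP => x x0; rewrite conjgE !galfM -{2}[x](gal_id {:M}) -(mulVg t) galfM.
by rewrite -fmorph_div -(rmorph1 t) -rmorphB w_gal sP // fmorph_eq0.
Qed.

(* An element of prime order [q != p] has an injective trace [q + m], hence is trivial. *)
Lemma wild_inertia_pgroup : (p.-group wild_inertia)%g.
Proof.
apply/pgroupP => q q_pr /(Cauchy q_pr)[s sP os]; rewrite inE; apply: contraT => qp.
have s1 : s = 1%g; last by move: q_pr; rewrite -os s1 order1.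
apply/eqP/gal_eqP => x _; rewrite gal_id; apply/eqP; rewrite -subr_eq0.
set y := s x - x; apply: contraT => y0.
pose T z := \sum_(i < q) (s ^+ i)%g z.
have Ty : T y = 0.
  have Ti i : (s ^+ i)%g y = (s ^+ i.+1)%g x - (s ^+ i)%g x.
    by rewrite rmorphB expgS galfM.
  apply/eqP; rewrite /T; under eq_bigr do rewrite Ti.
  rewrite sumrB subr_eq0; case: (q) q_pr os => // n _ os.
  by rewrite big_ord_recr big_ord_recl /= -os expg_order expg0 addrC.
have : w (T y / y) = 1.
  have -> : T y / y = q%:R + \sum_(i < q) ((s ^+ i)%g y / y - 1).
    by rewrite sumrB sumr_const card_ord addrC subrK mulr_suml.
  have wq := av_prime hw q_pr qp.
  rewrite (avD_dom hw) // wq (av_sum_lt hw) // => i _.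
  by have /wild_inertiaP := groupX i sP; apply.
by rewrite Ty mul0r (av0 hw) => /eqP; rewrite eq_sym oner_eq0.
Qed.

Lemma gal_ratio_unit (s : gal_of {:M}) x : x != 0 -> w (s x / x) = 1.
Proof. by move=> x0; rewrite (avM hw) w_gal (avV hw) divff // (av_eq0E hw). Qed.

(** Put [u = s x / x], a unit. As [s] acts trivially on the residue field, [(s ^ n) x / x] is
    congruent to [u ^ n]; so [u ^ p] is congruent to 1, hence so is [u]. No element of order [p] is
    left in [inertia / wild_inertia]. *)
Lemma wild_of_pow (s : gal_of {:M}) :
  s \in inertia -> (s ^+ p)%g \in wild_inertia -> s \in wild_inertia.
Proof.
move=> /inertiaP sI /wild_inertiaP spP; apply/wild_inertiaP => x x0.
apply: (av_root_near1 p_pr hw); set u := s x / x.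
have u1 : w u = 1 by rewrite gal_ratio_unit.
have powE n : w ((s ^+ n)%g x / x - u ^+ n) < 1.
  elim: n => [|n IHn]; first by rewrite expg0 gal_id divff // subrr (av0 hw).
  pose v := (s ^+ n)%g x / x; have v1 : w v <= 1 by rewrite gal_ratio_unit.
  have -> : (s ^+ n.+1)%g x / x - u ^+ n.+1 = (s v - v) * u + (v - u ^+ n) * u.
    have -> : (s ^+ n.+1)%g x / x = s v * u.
      by rewrite expgSr galfM /v fmorph_div mulrA mulfVK // fmorph_eq0.
    by rewrite exprSr; ring.
  by rewrite (avD_lt hw) // (avM hw) u1 mulr1 ?sI.
rewrite -(subrK ((s ^+ p)%g x / x) (u ^+ p)) -addrA (avD_lt hw) ?spP //.
by rewrite -(avN hw) opprB.
Qed.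

Lemma tame_quotient : (p^'.-group (inertia / wild_inertia))%g.
Proof.
apply/pgroupP => q q_pr /(Cauchy q_pr)[X]; rewrite inE /=.
case/morphimP => s sN sI -> oX; apply/negP => /eqP qp.
have sP : s \in wild_inertia.
  apply: wild_of_pow => //; rewrite -qp coset_idr ?groupX //.
  by rewrite morphX // -oX expg_order.
by move: q_pr; rewrite -oX [coset_morphism _ s](coset_id sP) order1.
Qed.

(** If [x] has order [d] in the residue field, [s x] is also a [d]-th root of unity there, and these
    roots are the powers of [x]. *)
Lemma gal_residue_pow (s : gal_of {:M}) x : w x = 1 -> exists c, w (s x - x ^+ c) < 1.
Proof.
move=> x1; have exm : exists m, (0 < m)%N && (w (x ^+ m - 1) < 1).
  by have [m m0 xm] := av_residue hw x1; exists m; rewrite m0.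
case: (ex_minnP exm) => d /andP[d0 xd] dmin.
apply: (av_unity_root p_pr hw d0 xd) => [i /andP[i0 id]|].
  by rewrite leNgt; apply: contraTN id => xi; rewrite -leqNgt dmin // i0.
by rewrite -rmorphXn -(rmorph1 s) -rmorphB w_gal.
Qed.

(** Modulo the maximal ideal both automorphisms raise [x] to powers, with exponents depending on
    [x]; this is enough to commute at [x], without a generator of the residue field. *)
Lemma gal_residue_comm (s t : gal_of {:M}) x : w x <= 1 -> w (s (t x) - t (s x)) < 1.
Proof.
rewrite le_eqVlt => /predU1P[x1|x1]; last by rewrite (avB_lt hw) // !w_gal.
have [c sx] := gal_residue_pow s x1; have [d tx] := gal_residue_pow t x1.
have powc u v n : w u = 1 -> w v = 1 -> w (u - v) < 1 -> w (u ^+ n - v ^+ n) < 1.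
  move=> u1 v1 uv; elim: n => [|n IHn]; first by rewrite subrr (av0 hw).
  have -> : u ^+ n.+1 - v ^+ n.+1 = (u - v) * u ^+ n + v * (u ^+ n - v ^+ n) by rewrite !exprS; ring.
  by rewrite (avD_lt hw) // !(avM hw) ?(avX hw) ?u1 ?v1 ?expr1n ?mulr1 ?mul1r.
have half (a b : gal_of {:M}) i j : w (a x - x ^+ i) < 1 -> w (b x - x ^+ j) < 1 ->
    w (a (b x) - x ^+ (i * j)) < 1.
  move=> ax bx; have -> : a (b x) - x ^+ (i * j) = a (b x - x ^+ j) + ((a x) ^+ j - (x ^+ i) ^+ j).
    by rewrite rmorphB rmorphXn exprM; ring.
  by rewrite (avD_lt hw) ?w_gal // powc ?w_gal // (avX hw) x1 expr1n.
have -> : s (t x) - t (s x) = (s (t x) - x ^+ (c * d)) - (t (s x) - x ^+ (d * c)).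
  by rewrite mulnC; ring.
by rewrite (avB_lt hw) // half.
Qed.

Lemma abelian_mod_inertia : abelian (G / inertia)%g.
Proof.
apply: sub_der1_abelian; rewrite gen_subG; apply/subsetP => _ /imset2P[s t _ _ ->].
apply/inertiaP => x x1; rewrite commgEl conjgE mulgA -invMg.
rewrite galfM; set z := ((t * s)^-1)%g x; have -> : x = (t * s)%g z.
  by rewrite -galfM mulVg gal_id.
by rewrite !galfM gal_residue_comm // w_gal.
Qed.

Lemma ramification_filtration : exists P I : {group gal_of {:M}},
  [/\ P <| G, I <| G, p.-group P, p^'.-group (I / P) & abelian (G / I)]%g.
Proof.
exists wild_inertia_group, inertia_group; split.
- exact: wild_inertia_normal.
- exact: inertia_normal.
- exact: wild_inertia_pgroup.
- exact: tame_quotient.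
- exact: abelian_mod_inertia.
Qed.

End Ramification.

(** * An Eisenstein extension without intermediate field *)

Lemma dvdn_bin_pow (p k i : nat) : prime p -> (0 < i < p ^ k)%N -> (p %| 'C(p ^ k, i))%N.
Proof.
move=> p_pr /andP[i0 ik]; apply: contraTT ik => pC.
have : (p ^ k %| i * 'C(p ^ k, i))%N.
  rewrite -(prednK i0) -[X in 'C(X, _)](@prednK (p ^ k)) ?expn_gt0 ?prime_gt0 //.
  by rewrite -mul_bin_diag dvdn_mulr // prednK // expn_gt0 prime_gt0.
rewrite Gauss_dvdl ?coprimeXl ?prime_coprime // => /dvdn_leq; rewrite -leqNgt; exact.
Qed.

Section Eisenstein.

Variables (p : nat) (K : fieldType) (M : splittingFieldType K) (w : M -> rat).
Hypotheses (p_pr : prime p) (hw : padic_absval p w).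

Let wM := avM hw.

(** A uniformizer of [K], not of [M]: its value is measured in [M], which may be ramified over
    [K]. *)
Definition uniformizer (pi : K) :=
  0 < w pi%:A < 1 /\ forall c : K, c != 0 -> exists z : int, w c%:A = w pi%:A ^ z.

(** The values of [w] on nonzero scalars are powers of [p], not all equal to 1 since [w p%:R < 1];
    [pi] realises the least [m > 0] such that [p ^ (- m)] is a value, and [m] divides all
    exponents. *)
Lemma exists_uniformizer : exists pi : K, uniformizer pi.
Proof.
have p1 : 1 < p%:R :> rat by rewrite ltr1n prime_gt1.
have p0 : p%:R != 0 :> rat by rewrite pnatr_eq0 -lt0n prime_gt0.
have algV (c : K) : (c^-1)%:A = (c%:A)^-1 :> M by rewrite -[LHS]/(in_alg M _) fmorphV.
have algM (c d : K) : (c * d)%:A = c%:A * d%:A :> M by rewrite -[LHS]/(in_alg M _) rmorphM.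
have alg0 (c : K) : (c%:A == 0 :> M) = (c == 0) by rewrite scaler_eq0 oner_eq0 orbF.
have algX (c : K) n : (c ^+ n)%:A = c%:A ^+ n :> M by rewrite -[LHS]/(in_alg M _) rmorphXn.
have val c : c != 0 -> exists z : int, w c%:A = p%:R ^ z.
  by move=> c0; apply: (av_value hw); rewrite alg0.
have exm : exists m, (0 < m)%N && `[< exists2 c, c != 0 & w c%:A = p%:R ^ (- m%:Z) >].
  have pK0 : p%:R != 0 :> K by rewrite -alg0 scaler_nat (av_p_neq0 hw).
  have [z wz] := val _ pK0; have := av_p hw; rewrite -scaler_nat wz => z1.
  have {}z1 : z < 0 by rewrite -(ltr_eXz2l p1) expr0z.
  exists `|z|%N; rewrite absz_gt0 lt_eqF //=; apply/asboolP; exists p%:R => //.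
  by rewrite wz; congr (_ ^ _); lia.
case: (ex_minnP exm) => m /andP[m0 /asboolP[pi pi0 wpi]] min.
exists pi; split=> [|c c0].
  rewrite (av_gt0 hw) alg0 pi0 wpi -[X in _ < X](expr0z (p%:R : rat)) ltr_eXz2l //.
  lia.
have [z wc] := val _ c0; exists (- (z %/ m)%Z); rewrite wpi wc exprz_exp.
congr (_ ^ _); suff : (z %% m)%Z = 0 by have := divz_eq z m; lia.
apply/eqP; apply: contraT => r0.
have m0Z : m%:Z != 0 by lia.
have r_ge0 : 0 <= (z %% m)%Z by rewrite modz_ge0.
have r_lt : (z %% m)%Z < m by rewrite ltz_pmod.
suff /min : (0 < `|(z %% m)%Z|)%N && `[< exists2 c, c != 0 & w c%:A = p%:R ^ (- `|(z %% m)%Z|%:Z) >] by lia.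
rewrite absz_gt0 r0 /=; apply/asboolP.
(* According to the sign of the quotient, [c] is multiplied or divided by a natural power of [pi];
   the value left over has the remainder as exponent, against the minimality of [m]. *)
have [n [nE|nE]] : exists n : nat, (z %/ m)%Z = n \/ (z %/ m)%Z = - n%:Z.
  by exists `|(z %/ m)%Z|%N; lia.
- exists (c * pi ^+ n)^-1; first by rewrite invr_neq0 // mulf_neq0 ?expf_neq0.
  rewrite algV algM algX (avV hw) wM (avX hw) wc wpi exprnP exprz_exp -expfzDr // invr_expz.
  by congr (_ ^ _); have := divz_eq z m; lia.
- exists (c / pi ^+ n)^-1; first by rewrite invr_neq0 // mulf_neq0 ?invr_neq0 ?expf_neq0.
  rewrite algV algM algV algX (avV hw) wM (avV hw) (avX hw) wc wpi exprnP exprz_exp invr_expz -expfzDr // invr_expz.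
  by congr (_ ^ _); have := divz_eq z m; lia.
Qed.

Lemma ler_exprz_lt1 (t : rat) (m n : int) : 0 < t < 1 -> (t ^ m <= t ^ n) = (n <= m).
Proof.
move=> /andP[t0 t1]; rewrite -[t]invrK !(exprz_inv t^-1) ler_eXz2l ?invf_gt1 //.
by rewrite lerN2.
Qed.

Lemma exprz_lt1_inj (t : rat) : 0 < t < 1 -> injective (exprz t).
Proof.
move=> t01 m n E; apply: le_anti.
by rewrite -!(ler_exprz_lt1 _ _ t01) E lexx.
Qed.

Section Root.

Variables (k : nat) (pi : K) (al : M).
Hypotheses (k_gt0 : (0 < k)%N) (pi_unif : uniformizer pi).
Local Notation q := (p ^ k)%N.
Local Notation piM := (pi%:A : M).

(** ['X^q - pi] would not do: for [k > 1] its roots generate intermediate fields. The linear term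
    gives the derivative the absolute value of [pi] at every root. *)
Definition eisenstein_poly : {poly M} := 'X^q + piM *: 'X + piM%:P.

Lemma eisensteinE x : eisenstein_poly.[x] = x ^+ q + piM * x + piM.
Proof. by rewrite /eisenstein_poly !hornerE. Qed.

Lemma q_gt1 : (1 < q)%N.
Proof. apply: leq_trans (prime_gt1 p_pr) _; rewrite -{1}(expn1 p).
by rewrite leq_pexp2l // prime_gt0. Qed.

Lemma size_eisenstein : size eisenstein_poly = q.+1.
Proof.
have q1 := q_gt1.
rewrite /eisenstein_poly -addrA size_polyDl size_polyXn // ltnS.
apply: leq_trans (size_polyD _ _) _; rewrite geq_max; apply/andP; split.
  by apply: leq_trans (size_scale_leq _ _) _; rewrite size_polyX.
by rewrite (leq_trans (size_polyC_leq1 _)) // ltnW.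
Qed.

Let u01 : 0 < w piM < 1 := pi_unif.1.

(** A root with [w x >= 1] would satisfy [w x ^ q < w x]; so [1 + x] is a unit, and
    [x ^ q = - pi (1 + x)] has the value of [pi]. *)
Lemma root_abs x : root eisenstein_poly x -> w x ^+ q = w piM /\ w x < 1.
Proof.
move=> /rootP; rewrite eisensteinE => /eqP; rewrite -addrA addr_eq0 => /eqP xq.
have /andP[u0 u1] := u01; have q1 := q_gt1.
have {}xq : w x ^+ q = w piM * w (1 + x).
  by rewrite -(avX hw) xq (avN hw) -wM mulrDr mulr1 addrC.
have x1 : w x < 1.
  rewrite ltNge; apply/negP => x1.
  have : w x ^+ q < w x.
    rewrite xq; apply: lt_le_trans (_ : 1 * w x <= _); last by rewrite mul1r.
    apply: le_lt_trans (_ : w piM * w x < _); last by rewrite ltr_pM2r // (lt_le_trans ltr01).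
    by rewrite ler_wpM2l ?(ltW u0) // (avD_le hw) ?(av1 hw).
  by apply/negP; rewrite -leNgt -[leLHS]expr1 ler_weXn2l // ltnW.
by rewrite xq (avD_dom hw) ?(av1 hw) ?mulr1.
Qed.

Lemma w_p_le_pi : w p%:R <= w piM.
Proof.
have /andP[u0 u1] := u01.
have pK0 : p%:R != 0 :> K.
  by have := av_p_neq0 hw; rewrite -scaler_nat scaler_eq0 oner_eq0 orbF.
have [z wz] := pi_unif.2 _ pK0; rewrite -scaler_nat wz.
have := av_p hw; rewrite -scaler_nat wz -(expr0z (w piM)) ltNge ler_exprz_lt1 // -ltNge => z0.
by rewrite -[leRHS]expr1z ler_exprz_lt1 //; lia.
Qed.

(* Expanding [f (x + d) - f x = 0] around the root [x], every middle term is
   smaller than the constant term [pi], so that [|d|^(q-1) = |pi|]. *)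
Lemma root_diff_abs x y : root eisenstein_poly x -> root eisenstein_poly y -> x != y ->
  w (x - y) ^+ q.-1 = w piM.
Proof.
move=> rx ry xy; have /andP[u0 u1] := u01; have q1 := q_gt1.
have [xq x1] := root_abs rx; have [_ y1] := root_abs ry.
pose d := y - x; have d0 : d != 0 by rewrite subr_eq0 eq_sym.
have -> : w (x - y) = w d by rewrite -(avN hw) opprB.
have d1 : w d < 1 by rewrite (avB_lt hw).
move: rx ry => /rootP + /rootP; rewrite !eisensteinE -[y](subrK x) -/d.
rewrite [d + x]addrC exprD_middle ?(ltnW q1) // => fx fy.
pose S := \sum_(i < q.-1) x ^+ (q.-1 - i) * d ^+ i *+ 'C(q, i.+1).
have dS : \sum_(i < q.-1) x ^+ (q.-1 - i) * d ^+ i.+1 *+ 'C(q, i.+1) = d * S.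
  by rewrite mulr_sumr; apply: eq_bigr => i _; rewrite mulrnAr mulrCA -exprS.
have E : d * (d ^+ q.-1 + (piM + S)) = 0.
  transitivity ((x ^+ q + d ^+ q + d * S + piM * (x + d) + piM) - (x ^+ q + piM * x + piM)).
    by rewrite mulrDr -exprS prednK ?(ltnW q1) //; ring.
  by rewrite -dS fx fy subr0.
move/eqP: E; rewrite mulf_eq0 (negPf d0) addr_eq0 => /eqP E.
rewrite -(avX hw) E (avN hw) (avD_dom hw) //; rewrite /S; apply: (av_sum_lt hw) => // i _.
rewrite -mulr_natr !wM !(avX hw).
have wC : w 'C(q, i.+1)%:R <= w piM.
  have /dvdnP[c ->] : (p %| 'C(q, i.+1))%N by apply: dvdn_bin_pow => //=; have := ltn_ord i; lia.
  by rewrite natrM wM (le_trans _ w_p_le_pi) // ler_piMl ?(av_ge0 hw) ?(av_nat hw).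
apply: le_lt_trans (_ : w x ^+ (q.-1 - i) * w d ^+ i * w piM < _).
  by rewrite ler_wpM2l // mulr_ge0 ?exprn_ge0 ?(av_ge0 hw).
rewrite gtr_pMl //; apply: le_lt_trans (_ : w x ^+ (q.-1 - i) * 1 < 1).
  by rewrite ler_wpM2l ?exprn_ge0 ?(av_ge0 hw) // exprn_ile1 ?(av_ge0 hw) // ltW.
rewrite mulr1 exprn_ilt1 ?(av_ge0 hw) // -lt0n subn_gt0.
exact: ltn_ord.
Qed.

Hypothesis root_al : root eisenstein_poly al.

Lemma w_al_lt1 : 0 < w al < 1.
Proof.
have [alq al1] := root_abs root_al; rewrite al1 andbT lt_def (av_ge0 hw) andbT.
apply: contraTneq (andP u01).1 => al0.
by rewrite -alq al0 expr0n gtn_eqF ?ltxx // ltnW // q_gt1.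
Qed.

(* The values of the terms are pairwise distinct, being distinct modulo [q] as
   powers of [w al]. *)
Lemma sum_value n (c : nat -> K) : (n <= q)%N ->
  (forall i, (i < n)%N -> c i = 0) \/
  exists i z, (i < n)%N /\ w (\sum_(j < n) (c j)%:A * al ^+ j) = w al ^ (z * q%:Z + i%:Z).
Proof.
have [alq _] := root_abs root_al; have al01 := w_al_lt1.
have al0 : w al != 0 by rewrite gt_eqF //; case/andP: al01.
elim: n => [_|n IHn nq]; first by left.
rewrite big_ord_recr /=; set S := \sum_(j < n) _ in IHn *.
have [c0|c0] := eqVneq (c n) 0.
  rewrite c0 scale0r mul0r addr0; have [cE|[i [z [ltin wE]]]] := IHn (ltnW nq).
    by left=> i; rewrite ltnS leq_eqVlt => /predU1P[->//|/cE].
  by right; exists i, z; split=> //; exact: ltnW.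
right; have [z' wc] := pi_unif.2 _ c0.
have wcn : w ((c n)%:A * al ^+ n) = w al ^ (z' * q%:Z + n%:Z).
  by rewrite wM (avX hw) wc -alq exprnP exprz_exp exprnP -expfzDr // mulrC.
have [cE|[i [z [ltin wE]]]] := IHn (ltnW nq).
  exists n, z'; split=> //; rewrite (_ : S = 0) ?add0r // /S big1 // => j _.
  by rewrite cE ?ltn_ord // scale0r mul0r.
have [lt|gt|E] := ltgtP (w S) (w ((c n)%:A * al ^+ n)).
- by exists n, z'; rewrite addrC (avD_dom hw) // wcn.
- by exists i, z; rewrite (avD_dom hw) // ltnW.
exfalso; move: E; rewrite wE wcn => /(exprz_lt1_inj al01) E.
have : (n%:Z - i%:Z) = (z - z') * q%:Z by lia.
have : 0 < n%:Z - i%:Z < q%:Z by lia.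
by case: (z - z') => [[|m]|m]; nia.
Qed.

Let S := <<1; al>>%AS.

Lemma eisenstein_polyOver (N : {subfield M}) : eisenstein_poly \is a polyOver N.
Proof.
have piN : piM \in N by rewrite rpredZ ?mem1v.
by rewrite /eisenstein_poly !rpredD ?rpredX ?polyOverX ?polyOverC ?polyOverZ ?polyOverX.
Qed.

(** A minimal polynomial of degree below [q] would be a vanishing combination of at most [q] powers
    of [al], which [sum_value] excludes because the leading coefficient is 1. *)
Lemma adjoin_degree_eisenstein : adjoin_degree 1 al = q.
Proof.
apply/eqP; rewrite eqn_leq; apply/andP; split.
  rewrite -ltnS -size_minPoly -size_eisenstein dvdp_leq //.
    by rewrite -size_poly_eq0 size_eisenstein.
  exact: minPoly_dvdp (eisenstein_polyOver 1%AS) root_al.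
rewrite leqNgt; apply/negP => nq.
have /polyOverP m1 := minPolyOver 1 al.
have [c cE] : exists c : nat -> K, forall i, (minPoly 1 al)`_i = (c i)%:A.
  have := choice (fun i => vlineP _ _ (m1 i)); case=> c cE.
  by exists c => i; rewrite cE.
have [c0|[i [z [_]]]] := sum_value c nq.
  have := monic_minPoly 1 al; rewrite monicE lead_coefE size_minPoly /= cE c0 //.
  by rewrite scale0r eq_sym oner_eq0.
have -> : \sum_(j < (adjoin_degree 1 al).+1) (c j)%:A * al ^+ j = 0.
  rewrite -[RHS](minPolyxx 1 al) horner_coef size_minPoly.
  by apply: eq_bigr => j _; rewrite cE.
have /andP[al0 _] := w_al_lt1.
by rewrite (av0 hw) => /eqP; rewrite eq_sym expfz_eq0 (gt_eqF al0) andbF.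
Qed.

(** Total ramification, read off from the expansion of [y] in powers of [al]. *)
Lemma value_in_adjoin y : y \in S -> y != 0 -> exists s : int, w y = w al ^ s.
Proof.
move=> yS y0; have /polyOverP m1 := Fadjoin_polyOver 1 al y.
have [c cE] : exists c : nat -> K, forall i, (Fadjoin_poly 1 al y)`_i = (c i)%:A.
  have := choice (fun i => vlineP _ _ (m1 i)); case=> c cE.
  by exists c => i; rewrite cE.
have yE : y = \sum_(j < q) (c j)%:A * al ^+ j.
  rewrite -[LHS](Fadjoin_poly_eq yS) (horner_coef_wide _ (n := q)).
    by apply: eq_bigr => j _; rewrite cE.
  by rewrite -adjoin_degree_eisenstein size_Fadjoin_poly.
have [c0|[i [z [_ wE]]]] := sum_value c (leqnn q).
  move: y0; rewrite yE big1 ?eqxx // => j _.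
  by rewrite c0 ?ltn_ord // scale0r mul0r.
by exists (z * q%:Z + i%:Z); rewrite yE.
Qed.

(* With [d] the degree of [al] over [N], the different [y] of [al] over [N] has
   [|y|^(q-1) = |al|^(q(d-1))], whence [q - 1] divides [d - 1]. *)
Lemma eisenstein_no_intermediate (N : {subfield M}) : galois 1 {:M} ->
  (N <= S)%VS -> (N : {vspace M}) = 1%VS \/ (N : {vspace M}) = S.
Proof.
move=> galM NS; have q1 := q_gt1.
have galN : galois N {:M} by apply: galoisS galM; rewrite sub1v subvf.
have [r [_ Ur minE]] := galois_factors (subvf N) galN al (memvf al).
set ra := map _ _ in Ur minE; pose d := adjoin_degree N al.
have NalS : <<N; al>>%VS = S.
  apply/eqP; rewrite eqEsubv; apply/andP; split.
    by apply/FadjoinP; rewrite NS memv_adjoin.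
  by apply: adjoinSl; exact: sub1v.
have dimS : \dim S = q by rewrite dim_Fadjoin dimv1 muln1 adjoin_degree_eisenstein.
have dimN : (d * \dim N)%N = q by rewrite -dimS -NalS dim_Fadjoin.
have al_ra : al \in ra by rewrite -root_prod_XsubC -minE root_minPoly.
have root_ra b : b \in ra -> root eisenstein_poly b.
  rewrite -root_prod_XsubC -minE => /root_dvdp; apply.
  exact: minPoly_dvdp (eisenstein_polyOver N) root_al.
pose rb := rem al ra; pose y := \prod_(b <- rb) (al - b).
have size_rb : size rb = d.-1.
  rewrite size_rem //; congr _.-1; apply/eqP.
  by rewrite -eqSS -(size_prod_XsubC ra id) -minE size_minPoly.
have yE : y = (minPoly N al)^`().[al].
  rewrite minE (perm_big _ (perm_to_rem al_ra)) big_cons -/rb derivM derivXsubC.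
  by rewrite hornerD !hornerM !hornerXsubC subrr mul0r addr0 hornerC mul1r horner_prod;
    apply: eq_bigr => b _; rewrite hornerXsubC.
have yS : y \in S.
  by rewrite -NalS yE mempx_Fadjoin // polyOver_deriv ?minPolyOver.
have rb_ra b : b \in rb -> (b != al) && (b \in ra) by rewrite mem_rem_uniq // inE.
have y0 : y != 0.
  rewrite prodf_seq_neq0; apply/allP => b /rb_ra /andP[bal _] /=.
  by rewrite subr_eq0 eq_sym.
have wy : w y ^+ q.-1 = w al ^+ (q * d.-1).
  have [alq _] := root_abs root_al.
  rewrite exprM alq -size_rb -(avX hw) /y -prodrXl.
  elim: rb rb_ra {y yE yS y0 size_rb} => [|b s IHs] sra; first by rewrite big_nil (av1 hw).
  have /andP[bal bra] := sra b (mem_head _ _).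
  rewrite big_cons wM exprS (avX hw) (root_diff_abs root_al (root_ra b bra)) 1?eq_sym //.
  by rewrite IHs // => u us; apply: sra; rewrite in_cons us orbT.
have [s ws] := value_in_adjoin yS y0.
have sE : s * q.-1%:Z = (q * d.-1)%N.
  by apply: (exprz_lt1_inj w_al_lt1); rewrite -exprz_exp -ws -!exprnP.
have dN0 : (0 < \dim N)%N := adim_gt0 N.
have d0 : (0 < d)%N by move: dimN; case: (d) => // q0; rewrite mul0n in q0; lia.
have dq : (d <= q)%N by rewrite -dimN leq_pmulr.
have : (q.-1 %| d.-1)%N.
  have : (q.-1 %| q * d.-1)%N.
    apply/dvdnP; exists `|s|%N; have := congr1 absz sE.
    by rewrite abszM /= => ->.
  by rewrite Gauss_dvdr // -{2}(prednK (ltnW q1)) coprimenS.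
(* [q - 1] divides [d - 1] and [1 <= d <= q], so the quotient is 0 or 1: [N] is all of [S] or
   trivial. *)
case/dvdnP=> c dE; have {}dE : d = q \/ d = 1%N.
  by case: c dE => [|c] dE; [right|left]; move: dE; nia.
case: dE => dE; [left; apply/esym|right]; apply/eqP; rewrite eqEdim ?sub1v ?NS /=.
  move: dimN; rewrite dE => /eqP; rewrite -{2}[q]muln1 eqn_pmul2l ?(ltnW q1) //.
  by move=> /eqP ->; rewrite dimv1.
by rewrite dimS -dimN dE mul1n.
Qed.

End Root.

End Eisenstein.

(** A linear map is bounded for the sup norms, so bounded powers stay bounded. This compares the
    absolute values of two fields without computing a norm in a tower. *)
Lemma ext_abs_le1_morph (p : nat) (Q : fieldType) (a : Q -> rat) (E1 E2 : fieldExtType Q)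
    (f : {linear E1 -> E2}) x : prime p -> is_Qp p a -> f 1 = 1 -> {morph f : u v / u * v} ->
  ext_abs a x <= 1 -> ext_abs a (f x) <= 1.
Proof.
move=> p_pr hQ f1 fM /(ext_abs_pow_bounded p_pr hQ)[R R0 xR].
pose C := \big[Num.max/0]_(i < \dim {:E1}) sup_norm a (f (vbasis {:E1})`_i).
apply: (ext_abs_le1_of_pow_bounded p_pr hQ (R := R * C)) => m.
have -> : f x ^+ m = f (x ^+ m).
  by elim: m => [|m IHm]; rewrite ?f1 // !exprS fM IHm.
rewrite (coord_vbasis (memvf (x ^+ m))) linear_sum.
have C0 : 0 <= C by rewrite bigmax_ge_id.
apply: (sup_norm_sum_le p_pr hQ) => [|i]; first by rewrite mulr_ge0 ?(ltW R0).
rewrite linearZ /= (sup_normZ hQ) ler_pM ?(Qp_abs_ge0 hQ) ?sup_norm_ge0 //.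
  exact: le_trans (coord_le_sup_norm _ _ _) (xR m).
by rewrite /C (le_bigmax _ (fun i : 'I_(\dim {:E1}) => sup_norm a (f (vbasis {:E1})`_i))).
Qed.

Lemma absval_comp (p : nat) (E1 E2 : fieldType) (f : {rmorphism E1 -> E2}) (w : E2 -> rat) :
  padic_absval p w -> padic_absval p (fun x => w (f x)).
Proof.
case=> w1 w2 w3 w4 w5 w6 w7 w8 w9; split=> //.
- by move=> x /w2/eqP; rewrite fmorph_eq0 => /eqP.
- by move=> x y; rewrite rmorphM w3.
- by move=> x y; rewrite rmorphD w4.
- by move=> x x0; apply: w5; rewrite fmorph_eq0.
- by rewrite rmorph_nat.
- by rewrite -(fmorph_eq0 f) rmorph_nat.
- by move=> q q_pr qp; rewrite rmorph_nat w8.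
- by move=> x /w9[m m0]; exists m => //; rewrite rmorphB rmorphXn rmorph1.
Qed.

Section TwoAbsvals.

Variables (p : nat) (E : fieldType) (v1 v2 : E -> rat).
Hypotheses (p_pr : prime p) (h1 : padic_absval p v1) (h2 : padic_absval p v2).

Lemma av_exprz x z : v1 (x ^ z) = v1 x ^ z.
Proof. by case: z => n; rewrite ?NegzE -?exprnN -?exprnP ?(avV h1) (avX h1). Qed.

(** Some power of [x] has a [v1]-value at most that of [p]; so [x ^ n / p] is integral for [v1],
    hence for [v2], and [v2 x ^ n <= v2 p < 1]. *)
Lemma absval_lt1 x : (forall c, v1 c <= 1 -> v2 c <= 1) -> v1 x < 1 -> v2 x < 1.
Proof.
move=> le1 x1; have [->|x0] := eqVneq x 0; first by rewrite (av0 h2).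
have p1 : 1 < p%:R :> rat by rewrite ltr1n prime_gt1.
have [z xz] := av_value h1 x0; have [e pe] := av_value h1 (av_p_neq0 h1).
have z0 : (z < 0)%R.
  by move: x1; rewrite xz -(expr0z (p%:R : rat)) ltr_eXz2l.
have e0 : (e < 0)%R.
  by have := av_p h1; rewrite pe -[X in _ < X](expr0z (p%:R : rat)) ltr_eXz2l.
have [n [n0 ne]] : exists n : nat, (0 < n)%N /\ e = - n%:Z.
  by exists `|e|%N; split; lia.
have : v2 (x ^+ n / p%:R) <= 1.
  apply: le1; rewrite (avM h1) (avV h1) (avX h1) xz pe exprnP exprz_exp invr_expz.
  rewrite -expfzDr; last by rewrite pnatr_eq0 -lt0n prime_gt0.
  rewrite -[X in _ <= X](expr0z (p%:R : rat)) ler_eXz2l // ne; nia.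
have p20 : 0 < v2 p%:R by rewrite (av_gt0 h2) (av_p_neq0 h1).
rewrite (avM h2) (avV h2) ler_pdivrMr // mul1r (avX h2) => xn.
rewrite ltNge; apply/negP => x2.
have := le_lt_trans xn (av_p h2); rewrite ltNge exprn_ege1 //.
Qed.

End TwoAbsvals.

(** * The absolute value of a Galois extension of K *)

Section GalAbs.

Variables (p : nat) (Q : fieldType) (a : Q -> rat) (K : fieldExtType Q).
Hypotheses (p_pr : prime p) (hQ : is_Qp p a).
Implicit Type M : splittingFieldType K.

Definition gal_abs M : M -> rat := ext_abs a (E := baseFieldType M).

Lemma gal_abs_is_absval M : padic_absval p (@gal_abs M).
Proof. exact (ext_abs_is_absval p_pr hQ (baseFieldType M)). Qed.

Lemma gal_abs_gal M (s : gal_of {:M}) x : gal_abs (s x) = gal_abs x.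
Proof.
pose M0 : fieldExtType Q := baseFieldType M.
have lin (t : gal_of {:M}) : linear (t : M0 -> M0).
  by move=> c u v; rewrite !baseField_scaleE linearP.
pose f (t : gal_of {:M}) : {linear M0 -> M0} :=
  HB.pack (t : M0 -> M0) (GRing.isLinear.Build _ _ _ _ (t : M0 -> M0) (lin t)).
refine (@ext_abs_aut Q a M0 (f s) (f s^-1%g) _ _ x) => [u v|u].
  exact: (rmorphM s).
by rewrite /= -galfM mulgV gal_id.
Qed.

Lemma gal_abs_alg M (c : K) : gal_abs (c : K^o) <= 1 -> gal_abs (c%:A : M) <= 1.
Proof.
pose K0 : fieldExtType Q := baseFieldType K^o; pose M0 : fieldExtType Q := baseFieldType M.
pose f (c : K0) : M0 := (c : K)%:A.
have lin : linear f.
  move=> c' u v; rewrite /f !baseField_scaleE /=.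
  by rewrite scalerDl -scalerA.
pose g : {linear K0 -> M0} := HB.pack f (GRing.isLinear.Build _ _ _ _ f lin).
apply: (@ext_abs_le1_morph p Q a K0 M0 g c p_pr hQ) => [|u v]; rewrite /= /f.
  exact: scale1r.
by rewrite -[LHS]/(in_alg M _) rmorphM.
Qed.

(* [pi] has to be chosen before [M], which must contain a root of the Eisenstein
   polynomial of [pi]. *)
Lemma uniformizer_alg (M : splittingFieldType K) (pi : K) :
  uniformizer (@gal_abs K^o) pi -> uniformizer (@gal_abs M) pi.
Proof.
pose v1 (c : K) := @gal_abs K^o c; pose v2 (c : K) := @gal_abs M c%:A.
have algE (c : K) : c%:A = c :> K^o by rewrite -[LHS]/(c * 1) mulr1.
have h1 : padic_absval p v1 := gal_abs_is_absval K^o.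
have h2 : padic_absval p v2 := absval_comp (in_alg M) (gal_abs_is_absval M).
have le1 (c : K) : v1 c <= 1 -> v2 c <= 1 := @gal_abs_alg M c.
case; rewrite algE -/(v1 pi) => /andP[pi0 pi1] val.
have pi_neq0 : pi != 0 by rewrite (av_gt0 h1) in pi0.
split.
  by rewrite -/(v2 pi) (av_gt0 h2) pi_neq0 (absval_lt1 p_pr h1 h2 le1).
move=> c c0; have [z] := val c c0; rewrite algE -/(v1 c) -/(v2 c) => cz; exists z.
(* [c / pi ^ z] is a unit for [v1]; the implication [le1], applied to it and to its inverse, makes
   it a unit for [v2]. *)
have c1 : v1 (c / pi ^ z) = 1.
  by rewrite (avM h1) (avV h1) (av_exprz h1) cz divff // expfz_neq0 // (av_eq0E h1).
have : v2 (c / pi ^ z) = 1.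
  apply: le_anti; rewrite le1 ?c1 //=.
  have : v2 (c / pi ^ z)^-1 <= 1 by apply: le1; rewrite (avV h1) c1 invr1.
  by rewrite (avV h2) invf_le1 // (av_gt0 h2) mulf_neq0 ?invr_eq0 ?expfz_neq0.
rewrite (avM h2) (avV h2) (av_exprz h2) => /(congr1 (fun t => t * v2 pi ^ z)).
by rewrite mulfVK ?mul1r // expfz_neq0 // (av_eq0E h2).
Qed.

End GalAbs.

(** * Kummer theory in a Galois extension *)

Section Kummer.

Variables (p : nat) (K : fieldType) (M : splittingFieldType K).
Hypotheses (p_pr : prime p) (M_gal : galois 1 {:M}).
Implicit Types (S T : {subfield M}) (s t : gal_of {:M}).

Lemma galois_over S : galois S {:M}.
Proof. by apply: galoisS M_gal; rewrite sub1v subvf. Qed.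

Lemma mem_galfP S s : reflect {in S, forall x, s x = x} (s \in 'Gal({:M} / S))%g.
Proof. by rewrite gal_kHom ?subvf //; exact: kAHomP. Qed.

Lemma gal_mulr s x y : s (x * y) = s x * s y. Proof. exact: rmorphM. Qed.

Lemma gal_expr s x n : s (x ^+ n) = s x ^+ n. Proof. exact: rmorphXn. Qed.

Lemma gal_prodr (I : Type) (r : seq I) (P : pred I) (f : I -> M) s :
  s (\prod_(i <- r | P i) f i) = \prod_(i <- r | P i) s (f i).
Proof. exact: rmorph_prod. Qed.

Lemma mem_of_gal_fixed S x : {in 'Gal({:M} / S)%g, forall s, s x = x} -> x \in S.
Proof.
move=> fx; have /galois_fixedField <- := galois_over S.
by apply/fixedFieldP; rewrite ?memvf.
Qed.

Variables (S : {subfield M}) (zeta : M).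
Hypothesis zeta_prim : p.-primitive_root zeta.

Let Sz := <<S; zeta>>%AS.

Lemma subv_zeta : (S <= Sz)%VS. Proof. exact: subv_adjoin. Qed.

(** [zeta] is a root of [1 + X + ... + X ^ (p - 1)]. The bound serves to make the degree prime to
    [p]. *)
Lemma adjoin_degree_zeta : (adjoin_degree S zeta < p)%N.
Proof.
pose f : {poly M} := \poly_(i < p) 1.
have pS : f \is a polyOver S by apply/polyOver_poly => i _; exact: mem1v.
have rf : root f zeta.
  apply/rootP; rewrite horner_poly; under eq_bigr do rewrite mul1r.
  have : (zeta - 1) * (\sum_(i < p) zeta ^+ i) = 0.
    by rewrite -subrX1 (prim_expr_order zeta_prim) subrr.
  move/eqP; rewrite mulf_eq0 subr_eq0 => /orP[/eqP z1|/eqP //].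
  have := eq_prim_root_expr zeta_prim 1 0; rewrite z1 !expr1n eqxx.
  by rewrite mod0n modn_small ?prime_gt1.
have szf : size f = p.
  by rewrite size_poly_eq ?oner_neq0.
rewrite -size_minPoly -[X in (_ <= X)%N]szf dvdp_leq ?minPoly_dvdp //.
by rewrite -size_poly_gt0 szf prime_gt0.
Qed.

Lemma galois_zeta : galois S Sz.
Proof.
apply/splitting_galoisField; exists ('X^p - 1); split.
- by rewrite rpredB ?rpredX ?polyOverX ?rpred1.
- rewrite -(factor_Xn_sub_1 zeta_prim) big_mkord.
  rewrite -(big_map (fun i : 'I_p => zeta ^+ i) xpredT (fun b => 'X - b%:P)).
  rewrite separable_prod_XsubC map_inj_uniq ?index_enum_uniq // => i j /eqP.
  by rewrite (eq_prim_root_expr zeta_prim) !modn_small // => /eqP /val_inj.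
exists [seq zeta ^+ i | i <- iota 0 p].
  by rewrite big_map -(factor_Xn_sub_1 zeta_prim) /index_iota subn0 eqpxx.
apply/eqP; rewrite eqEsubv; apply/andP; split.
  apply/Fadjoin_seqP; split=> [|x /mapP[i _ ->]]; first exact: subv_zeta.
  by rewrite rpredX // memv_adjoin.
apply/FadjoinP; split; first exact: subv_adjoin_seq.
rewrite -[X in X \in _]expr1; apply: seqv_sub_adjoin; apply: map_f.
by rewrite mem_iota /= add0n prime_gt1.
Qed.

(* The norm of a [p]-th root is a [p]-th root of a power prime to [p]. *)
Lemma pth_power_descent x z : x \in S -> z \in Sz -> x = z ^+ p ->
  exists2 u, u \in S & x = u ^+ p.
Proof.
move=> xS zS xz; pose d := #|'Gal(Sz / S)%g|.
have [x0|x0] := eqVneq x 0.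
  by exists 0; rewrite ?mem0v // expr0n gtn_eqF ?prime_gt0.
have dE : d = adjoin_degree S zeta.
  by rewrite /d -(galois_dim galois_zeta) adjoin_degreeE.
have d0 : (0 < d)%N := cardG_gt0 _.
have cop : coprime d p.
  rewrite coprime_sym prime_coprime //; apply/negP => /(dvdn_leq d0).
  by rewrite leqNgt dE adjoin_degree_zeta.
pose N := galNorm S Sz z; have NS : N \in S := mem_galNorm galois_zeta zS.
have NE : N ^+ p = x ^+ d.
  rewrite -galNormX -xz /galNorm (eq_bigr (fun=> x)) ?prodr_const // => s sG.
  exact: (fixed_gal subv_zeta sG).
have /coprimeP -/(_ d0)[[u v] /= uv] := cop.
have {}uv : (u * d = v * p + 1)%N by have := prime_gt0 p_pr; lia.
exists (N ^+ u / x ^+ v); first by rewrite rpred_div ?rpredX.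
rewrite expr_div_n -!exprM mulnC exprM NE -exprM mulnC uv exprD expr1 mulrC mulKf //.
by rewrite expf_neq0.
Qed.

Variables (r : nat) (x y : 'I_r -> M).
Hypotheses (xS : forall i, x i \in S) (x_neq0 : forall i, x i != 0).
Hypothesis yx : forall i, y i ^+ p = x i.
Hypothesis x_indep : forall (n : 'I_r -> nat) z, z \in S ->
  \prod_i x i ^+ n i = z ^+ p -> forall i, (p %| n i)%N.

(** [Gal(M / S(zeta, y_1, ..., y_r))]. The root [zeta] is adjoined because, for [S] the image of
    [E], the index of this group is what proves in [zeta_of_property_C] that [zeta] lies in [S]. *)
Definition kummer_group : {set gal_of {:M}} :=
  [set s in 'Gal({:M} / Sz)%g | [forall i, s (y i) == y i]].

Let y_neq0 i : y i != 0.
Proof. by have := x_neq0 i; rewrite -yx expf_eq0 prime_gt0. Qed.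

Let kummer_exponent s : s \in 'Gal({:M} / Sz)%g ->
  exists e : 'I_r -> 'I_p, forall i, s (y i) = zeta ^+ e i * y i.
Proof.
move=> /mem_galfP sG; apply: (fin_all_exists (P := fun i (e : 'I_p) => s (y i) = zeta ^+ e * y i)) => i.
have [|e eE] := prim_rootP zeta_prim (x := s (y i) / y i).
  rewrite expr_div_n -gal_expr yx sG ?divff //.
  exact: subvP subv_zeta _ (xS i).
by exists e; rewrite -eE mulfVK ?y_neq0.
Qed.

Let eq_pow_Fp m n : zeta ^+ m = zeta ^+ n -> m%:R = n%:R :> 'F_p.
Proof.
move=> /eqP; rewrite (eq_prim_root_expr zeta_prim) => /eqP mn.
by apply: val_inj; rewrite /= !val_Fp_nat.
Qed.

(** ['I_p.-1.+1] rather than ['I_p] provides the default [ord0], taken when [s (y i)] is not of this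
    form. *)
Let e s i : nat := odflt ord0 [pick j : 'I_p.-1.+1 | s (y i) == zeta ^+ j * y i].

Let e_spec s i : s \in 'Gal({:M} / Sz)%g -> s (y i) = zeta ^+ e s i * y i.
Proof.
move=> /kummer_exponent[f fE]; rewrite /e; case: pickP => [j /eqP //|] /=.
have fp : (f i < p.-1.+1)%N by rewrite prednK ?prime_gt0.
by move=> /(_ (Ordinal fp)); rewrite /= fE eqxx.
Qed.

Let theta s : 'rV['F_p]_r := \row_i (e s i)%:R.

Let theta_morph : {in 'Gal({:M} / Sz)%g &, {morph theta : s t / (s * t)%g >-> (s * t)%g}}.
Proof.
move=> s t sG tG; apply/rowP => i; rewrite !mxE -natrD; apply: eq_pow_Fp.
apply: (mulIf (y_neq0 i)); rewrite -e_spec ?groupM // galfM e_spec //.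
rewrite gal_mulr gal_expr (e_spec _ tG) (mem_galfP _ _ tG) ?memv_adjoin //.
by rewrite exprD mulrA.
Qed.

Let theta_mor := Morphism theta_morph.

Let theta_ker : ('ker theta_mor = kummer_group)%g.
Proof.
apply/setP => s; rewrite !inE /=; case: (boolP (s \in _)) => //= sG.
apply/eqP/forallP => [s0 i|sy]; last first.
  apply/rowP => i; rewrite !mxE -[RHS](mulr0n 1); apply: eq_pow_Fp.
  by apply: (mulIf (y_neq0 i)); rewrite -e_spec // mul1r (eqP (sy i)).
have /rowP/(_ i) := s0; rewrite !mxE => /(congr1 val); rewrite /= val_Fp_nat // => ei.
rewrite e_spec // -(prim_expr_mod zeta_prim) ei mul1r.
by [].
Qed.

(* If [theta] were not onto, a linear relation among the exponents would give
   a product of the [y i] fixed by the Galois group over [Sz]. *)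
Let theta_im : (theta_mor @* 'Gal({:M} / Sz))%g = [set: 'rV['F_p]_r].
Proof.
set H := (_ @* _)%g; have zH0 : 0 \in H by exact: group1 H.
have HD u v : u \in H -> v \in H -> u + v \in H by exact: groupM.
have HZ (c : 'F_p) u : u \in H -> c *: u \in H.
  move=> uH; rewrite -[c]natr_Zp scaler_nat; elim: (val c) => [|n IHn]; first by rewrite mulr0n.
  by rewrite mulrS HD.
apply/setP => v; rewrite inE.
pose A : 'M['F_p]_(#|H|, r) := \matrix_i enum_val i.
have [/row_fullP[B BA]|] := boolP (row_full A).
  rewrite -[v]mulmx1 -BA mulmxA mulmx_sum_row; elim/big_ind: _ => // i _.
  by rewrite HZ // rowK enum_valP.
rewrite -cokermx_eq0 => cok0.
(* A nonzero column [j] of the cokernel matrix is a linear form vanishing on [H]; its entries are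
   the exponents of a product [z] of the [y i], which the group therefore fixes. *)
have /matrix0Pn[i0 [j nz]] := cok0.
pose n i := val (cokermx A i j); pose z := \prod_i y i ^+ n i.
have zSz : z \in Sz.
  apply: mem_of_gal_fixed => s sG; rewrite gal_prodr.
  under eq_bigr do rewrite gal_expr e_spec // exprMn -exprM.
  rewrite big_split /= -(big_morph (fun n => zeta ^+ n) (exprD zeta) (expr0 zeta)).
  have thH : theta s \in H by apply/morphimP; exists s.
  have : (A *m cokermx A) (enum_rank_in thH (theta s)) j = 0 by rewrite mulmx_coker mxE.
  have AE i : A (enum_rank_in thH (theta s)) i = (e s i)%:R.
    by rewrite mxE enum_rankK_in // mxE.
  have -> : (A *m cokermx A) (enum_rank_in thH (theta s)) j = (\sum_(i < r) e s i * n i)%:R.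
    rewrite mxE natr_sum; apply: eq_bigr => i _.
    by rewrite [A _ _]AE natrM; congr (_ * _); rewrite /n natr_Zp.
  move=> /(congr1 val); rewrite /= val_Fp_nat // => en.
  by rewrite -(prim_expr_mod zeta_prim) en mul1r.
have zp : \prod_i x i ^+ n i = z ^+ p.
  rewrite /z -prodrXl; apply: eq_bigr => i _.
  by rewrite -yx -!exprM mulnC.
have [|u uS xu] := pth_power_descent _ zSz zp.
  by rewrite rpred_prod // => i _; rewrite rpredX.
have /(_ i0) := x_indep uS xu; rewrite /n => pn.
case/eqP: nz; apply: val_inj => /=; apply/eqP; move: pn; rewrite /dvdn modn_small //.
by rewrite -[X in (_ < X)%N](Fp_cast p_pr) ltn_ord.
Qed.

Lemma kummer_index : #|'Gal({:M} / Sz) : kummer_group|%g = (p ^ r)%N.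
Proof.
have := card_morphim theta_mor 'Gal({:M} / Sz)%G.
by rewrite theta_im cardsT card_mx card_Fp // mul1n setIid theta_ker => ->.
Qed.

End Kummer.

Section KummerGenerator.

Variables (p : nat) (K : fieldType) (M : splittingFieldType K).
Hypotheses (p_pr : prime p) (M_gal : galois 1 {:M}).
Variables (S : {subfield M}) (zeta : M).
Hypotheses (zeta_prim : p.-primitive_root zeta) (zetaS : zeta \in S).

Let B := 'Gal({:M} / S)%G.

(* Hilbert 90 for the fixed field of a subgroup of index [p]. *)
Lemma exists_pth_root (D : {group gal_of {:M}}) : (D <| B)%g -> D \proper B ->
  (p.-group (B / D))%g ->
  exists y : M, [/\ y ^+ p \in S, y \notin S & {in D, forall s : gal_of {:M}, s y = y}].
Proof.
move=> nDB prDB pBD; have sDB := proper_sub prDB.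
have [DB|[C maxC DC]] := maximal_exists sDB; first by move: prDB; rewrite -DB properxx.
have sCB := proper_sub (maxgroupp maxC).
have nDC : (D <| C)%g := normalS DC sCB nDB.
have maxCD : maximal (C / D)%g (B / D)%g by rewrite quotient_maximal.
have nCB : (C <| B)%g.
  have := p_maximal_normal pBD maxCD.
  by rewrite -cosetpre_normal !quotientGK.
have iC : #|B : C|%g = p.
  rewrite -(p_maximal_index pBD maxCD) index_quotient_eq ?normal_norm //.
  exact: subset_trans (subsetIr _ _) DC.
have galS : galois S {:M} by apply: galoisS M_gal; rewrite sub1v subvf.
pose T := [aspace of fixedField C].
have galST : galois S T := normal_fixedField_galois galS nCB.
have cardG : #|'Gal(T / S)%g| = p.
  have sSTM : (S <= T <= {:M})%VS by case/and3P: galST => -> _ _; rewrite subvf.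
  have nST : normalField S T by case/and3P: galST.
  rewrite -(card_isog (normalField_isog galS sSTM nST)) /= gal_fixedField.
  by rewrite card_quotient ?normal_norm.
have /cyclicP[x xE] : cyclic 'Gal(T / S)%g by rewrite prime_cyclic // cardG.
have gx : generator 'Gal(T / S)%g x by rewrite /generator xE.
have sST : (S <= T)%VS by case/and3P: galST.
have zetaT := subvP sST _ zetaS.
have N1 : galNorm S T zeta == 1.
  rewrite /galNorm (eq_bigr (fun=> zeta)) => [|s sG]; last exact: fixed_gal sG zetaS.
  by rewrite prodr_const cardG (prim_expr_order zeta_prim).
have /(Hilbert's_theorem_90 gx zetaT)[b [bT b0] zE] := N1.
(* Since [x b = zeta^-1 b], the generator [x] fixes [b ^ p] but not [b]. *)
have xb : b = zeta * x b by rewrite zE mulfVK // fmorph_eq0.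
exists b; split.
- have /galois_fixedField <- := galST; apply/fixedFieldP; first by rewrite rpredX.
  have xbp : x (b ^+ p) = b ^+ p.
    by rewrite [in RHS]xb exprMn (prim_expr_order zeta_prim) mul1r rmorphXn.
  rewrite xE => s /cycleP[i ->]; elim: i => [|i IHi]; first by rewrite expg0 gal_id.
  by rewrite expgSr galM ?rpredX // IHi.
- apply/negP => bS; have xbb : x b = b.
    by apply: fixed_gal sST _ bS; rewrite xE cycle_id.
  move: xb; rewrite xbb -[X in X = _]mul1r => /(mulIf b0) z1.
  have := eq_prim_root_expr zeta_prim 1 0; rewrite -z1 !expr1n eqxx.
  by rewrite mod0n modn_small ?prime_gt1.
- move=> s sD; have /mem_fixedFieldP[_ fx] := bT.
  by apply: fx; exact: (subsetP DC).
Qed.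

End KummerGenerator.

(** * Subfields of [Omega] as subfields of a Galois extension *)

Section VspaceOfSet.

Variables (F : fieldType) (V : vectType F) (P : V -> Prop).
Hypotheses (P0 : P 0) (P_lin : forall a u v, P u -> P v -> P (a *: u + v)).

(** A subspace of largest dimension inside [P] absorbs each vector of [P]. This turns classical
    predicates, such as membership in a generated field of [Omega], into subspaces. *)
Lemma exists_vspace_of_set : exists U : {vspace V}, forall v, v \in U <-> P v.
Proof.
pose Q d := `[< exists U : {vspace V}, (forall v, v \in U -> P v) /\ \dim U = d >].
have Qex : exists d, Q d.
  by exists 0%N; apply/asboolP; exists 0%VS; rewrite dimv0; split=> // v; rewrite memv0 => /eqP->.
have Qle d : Q d -> (d <= \dim {:V})%N.
  by move=> /asboolP[U [_ <-]]; exact: dimvS (subvf U).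
case: (ex_maxnP Qex Qle) => d /asboolP[U [UP dU]] max; exists U => v; split=> [/UP //|Pv].
have : (\dim (U + <[v]>) <= d)%N.
  apply: max; apply/asboolP; exists (U + <[v]>)%VS; split=> // _ /memv_addP[u uU [_ /vlineP[a ->] ->]].
  by rewrite addrC; apply: P_lin => //; exact: UP.
rewrite -dU => le; have /eqP -> : U == (U + <[v]>)%VS by rewrite eqEdim addvSl.
by rewrite (subvP (addvSr _ _)) // memv_line.
Qed.

End VspaceOfSet.

Lemma exists_subfield_of_set (F : fieldType) (L : fieldExtType F) (P : L -> Prop) :
  P 1 -> (forall a u v, P u -> P v -> P (a *: u + v)) ->
  (forall u v, P u -> P v -> P (u * v)) ->
  exists U : {subfield L}, forall v, v \in U <-> P v.
Proof.
move=> P1 P_lin PM; have P0 : P 0 by have := P_lin (-1) _ _ P1 P1; rewrite scaleN1r addNr.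
have [U UP] := exists_vspace_of_set P0 P_lin.
have U_aspace : is_aspace U.
  rewrite /is_aspace has_algid1; last exact/UP.
  by apply/prodvP => u v /UP Pu /UP Pv; apply/UP; exact: PM.
by exists (ASpace U_aspace).
Qed.

Section Embeddings.

Variables (K : fieldType) (Omega : closedFieldType) (iota : {rmorphism K -> Omega}).

Lemma embZ (L : fieldExtType K) (l : embedding iota L) a x : l (a *: x) = iota a * l x.
Proof. by rewrite -mulr_algl rmorphM /= embK. Qed.

Lemma emb_inj (L : fieldExtType K) (l : embedding iota L) : injective l.
Proof. exact: fmorph_inj. Qed.

(** Preimages under the injective [m] are unique, so choosing them pointwise gives a morphism. *)
Lemma exists_model_gen (R : fieldType) (L M : fieldExtType K) (l : {rmorphism L -> R})
    (m : {rmorphism M -> R}) : (forall a : K, l a%:A = m a%:A) ->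
  (forall x, exists y, m y = l x) -> exists g : {lrmorphism L -> M}, forall x, m (g x) = l x.
Proof.
move=> lmA lm; have [g gE] := choice lm.
have gB : zmod_morphism g by move=> x y; apply: (fmorph_inj m); rewrite rmorphB !gE rmorphB.
have gM : monoid_morphism g.
  by split=> [|x y]; apply: (fmorph_inj m); rewrite ?rmorph1 ?rmorphM !gE ?rmorph1 ?rmorphM.
have gZ : scalable g.
  move=> a x; apply: (fmorph_inj m); rewrite gE -mulr_algl rmorphM lmA.
  by rewrite -[in RHS]mulr_algl rmorphM gE.
pose gl : {lrmorphism L -> M} := HB.pack g (GRing.isZmodMorphism.Build _ _ g gB)
  (GRing.isMonoidMorphism.Build _ _ g gM) (GRing.isScalable.Build _ _ _ _ g gZ).
by exists gl.
Qed.

Lemma exists_model (L M : fieldExtType K) (l : embedding iota L) (m : embedding iota M) :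
  (forall x, exists y, m y = l x) -> exists g : {lrmorphism L -> M}, forall x, m (g x) = l x.
Proof. by apply: exists_model_gen => a; rewrite !embK. Qed.

Definition comp_embedding (L M : fieldExtType K) (m : embedding iota M)
  (g : {lrmorphism L -> M}) : embedding iota L.
Proof.
apply: (@Embedding _ _ _ _ (m \o g : {rmorphism L -> Omega})) => a /=.
by rewrite linearZ /= rmorph1 embK.
Defined.

End Embeddings.

Section ImageField.

Variables (K : fieldType) (L M : fieldExtType K) (g : {lrmorphism L -> M}).

Lemma lrmorphA (a : K) : g a%:A = a%:A.
Proof. by rewrite linearZ /= rmorph1. Qed.

Definition img : {subfield M} := (linfun_ahom g @: {:L})%AS.

Lemma mem_imgP x : reflect (exists y, x = g y) (x \in img).
Proof.
apply: (iffP memv_imgP) => [[y _ ->]|[y ->]]; exists y; rewrite ?lfunE ?memvf //.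
Qed.

Lemma mem_img y : g y \in img.
Proof. by apply/mem_imgP; exists y. Qed.

Lemma dim_img : \dim img = \dim {:L}.
Proof. by rewrite limg_dim_eq // (eqP (AHom_lker0 _)) capv0. Qed.

Lemma no_intermediate_img : no_intermediate L <->
  forall N : {subfield M}, (N <= img)%VS -> (N : {vspace M}) = 1%VS \/ (N : {vspace M}) = img.
Proof.
split=> [noL N NI|noM S].
  have [S SE] : exists S : {subfield L}, forall x, x \in S <-> g x \in N.
    apply: exists_subfield_of_set => [|a u v uN vN|u v uN vN].
    - by rewrite rmorph1 mem1v.
    - by rewrite linearP memvD ?memvZ.
    - by rewrite rmorphM memvM.
  have [S1|SL] := noL S; [left|right]; apply/eqP; rewrite eqEsubv.
    rewrite sub1v andbT; apply/subvP => x xN.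
    have /mem_imgP[y xy] := subvP NI x xN.
    have : y \in S by apply/SE; rewrite -xy.
    rewrite S1 => /vlineP[a yE]; apply/vlineP; exists a.
    by rewrite xy yE linearZ rmorph1.
  rewrite NI; apply/subvP => x /mem_imgP[y ->]; apply/SE; rewrite SL; exact: memvf.
have [|S1|SL] := noM (linfun_ahom g @: S)%AS; first exact: limgS (subvf S).
- left; apply/val_inj/eqP; rewrite eqEsubv [X in _ && X]sub1v andbT /=.
  apply/subvP => x xS; have : g x \in (linfun_ahom g @: S)%VS.
    by apply/memv_imgP; exists x; rewrite ?lfunE.
  rewrite /= in S1; rewrite S1 => /vlineP[a gx]; apply/vlineP; exists a.
  by apply: (fmorph_inj g); rewrite [LHS]gx; exact/esym/lrmorphA.
- right; apply/val_inj/eqP; rewrite eqEsubv subvf /=; apply/subvP => x _.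
  have := mem_img x; rewrite -SL => /memv_imgP[y yS]; rewrite lfunE => /fmorph_inj ->.
  exact: yS.
Qed.

End ImageField.

Section GaloisModel.

Variables (K : fieldType) (M : splittingFieldType K).
Hypothesis M_gal : galois 1 {:M}.
Local Notation G := ('Gal({:M} / 1))%G.

Lemma gal_inj (S T : {subfield M}) :
  ('Gal({:M} / S) = 'Gal({:M} / T))%g -> (S : {vspace M}) = T.
Proof.
move=> E; have /galois_fixedField <- := galois_over M_gal S.
by have /galois_fixedField <- := galois_over M_gal T; rewrite E.
Qed.

Lemma gal_index (S : {subfield M}) : #|G : 'Gal({:M} / S)|%g = \dim S.
Proof.
have sSG : ('Gal({:M} / S) \subset G)%g := galS _ (sub1v _).
have dS0 : (0 < #|'Gal({:M} / S)%g|)%N := cardG_gt0 _.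
apply/eqP; rewrite -(eqn_pmul2l dS0) Lagrange //.
rewrite -(galois_dim M_gal) dimv1 divn1 -(galois_dim (galois_over M_gal S)).
by rewrite -dim_sup_field ?subvf.
Qed.

(** The bound [1 < \dim S] matches the properness of a maximal subgroup. *)
Lemma maximal_gal (S : {subfield M}) : (1 < \dim S)%N ->
  (forall N : {subfield M}, (N <= S)%VS -> (N : {vspace M}) = 1%VS \/ (N : {vspace M}) = S) <->
  maximal 'Gal({:M} / S)%g G.
Proof.
move=> dS; split=> [noS|maxS N NS].
  apply/maxgroupP; split=> [|H prH SH].
    rewrite properEneq galS ?sub1v // andbT; apply: contraTneq dS => E.
    by rewrite -gal_index E indexgg.
  have sHG := proper_sub prH.
  have [|N1|NS] := noS [aspace of fixedField H].
  - have /galois_fixedField SE := galois_over M_gal S.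
    by rewrite -[X in (_ <= X)%VS]SE; exact: fixedFieldS.
  - by move: prH; rewrite -(gal_fixedField H) /= [fixedField _]N1 properxx.
  - by rewrite -(gal_fixedField H) /= [fixedField _]NS.
have := maximal_group_eq maxS (galS _ NS) (galS _ (sub1v _)).
by case=> /gal_inj; [right|left].
Qed.

(** [f2 \o f1^-1] is a homomorphism on the image of [f1] and extends to [M], which is normal over
    [K]. *)
Lemma conj_ahom (L : fieldExtType K) (f1 f2 : 'AHom(L, M)) :
  exists s : gal_of {:M}, forall x, f2 x = s (f1 x).
Proof.
pose h : 'End(M) := (f2 \o f1^-1)%VF.
have hE x : h (f1 x) = f2 x by rewrite lfunE /= lker0_lfunK ?AHom_lker0.
have khom : kHom 1 (f1 @: {:L})%AS h.
  apply/kHomP_tmp; split=> [_ /vlineP[a ->]|_ _ /memv_imgP[x _ ->] /memv_imgP[y _ ->]].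
    have f1a : f1 a%:A = a%:A by rewrite linearZ /= rmorph1.
    by rewrite -[X in h X]f1a hE linearZ /= rmorph1.
  by rewrite -rmorphM !hE rmorphM.
have sub1 : (1 <= (f1 @: {:L})%AS <= {:M})%VS by rewrite sub1v subvf.
have [s _ sE] := kHom_to_gal sub1 (normalFieldf 1) khom.
by exists s => x; rewrite -hE sE // memv_img ?memvf.
Qed.

End GaloisModel.

Lemma splitting_subvs (K : fieldType) (L : fieldExtType K) (q : {poly K}) (us : seq L) :
  map_poly (in_alg L) q %= \prod_(u <- us) ('X - u%:P) ->
  splitting_field_axiom (subvs_of <<1 & us>>%AS).
Proof.
move=> qE; set T := <<1 & us>>%AS; pose v : {lrmorphism subvs_of T -> L} := @vsval _ _ T.
have usK : map v (map (vsproj T) us) = us.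
  by rewrite -map_comp; apply: map_id_in => u uus; rewrite /= vsprojK // seqv_sub_adjoin.
have qT : map_poly v (map_poly (in_alg (subvs_of T)) q) = map_poly (in_alg L) q.
  by rewrite -map_poly_comp (eq_map_poly (lrmorphA v)).
exists (map_poly (in_alg _) q); first by apply/polyOver1P; exists q.
exists (map (vsproj T) us).
  rewrite -(eqp_map v) qT (eqp_trans qE) // rmorph_prod -[X in \prod_(_ <- X) _]usK !big_map.
  rewrite [X in _ %= X](eq_bigr (fun j => 'X - (v (vsproj T j))%:P)) ?eqpxx // => i _.
  by rewrite /= map_polyXsubC.
pose w := linfun_ahom v; pose U := <<1 & map (vsproj T) us>>%VS.
have dU : \dim (w @: U)%VS = \dim U by rewrite limg_dim_eq // (eqP (AHom_lker0 _)) capv0.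
apply/eqP; rewrite eqEdim subvf /= -[X in (_ <= X)%N]dU aimg_adjoin_seq aimg1.
have -> : map w (map (vsproj T) us) = us.
  by rewrite -[RHS]usK; apply: eq_map => x; rewrite lfunE.
by rewrite dimvf.
Qed.

Lemma exists_splitting_subfield (K : fieldType) (M : splittingFieldType K)
    (T : {subfield M}) : galois 1 T ->
  exists (N : splittingFieldType K) (v : {lrmorphism N -> M}), img v = T :> {vspace M}.
Proof.
move=> /splitting_galoisField[_ [/polyOver1P[q ->] _ [us qE <-]]].
pose N : splittingFieldType K := HB.pack (subvs_of <<1 & us>>%AS)
  (FieldExt_isSplittingField.Build _ (subvs_of <<1 & us>>%AS) (splitting_subvs qE)).
exists N, (@vsval _ _ <<1 & us>>%AS : {lrmorphism N -> M}).
apply/vspaceP => x; apply/mem_imgP/idP => [[y ->]|xT]; first exact: subvsP.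
by exists (Subvs xT).
Qed.

(** * Finite Galois extensions inside Omega *)

Section BigExtension.

Variables (K : fieldType) (Omega : closedFieldType) (iota : {rmorphism K -> Omega}).
Hypothesis Omega_alg : forall x : Omega, algebraicOver iota x.

Definition base_emb_morph : {rmorphism K^o -> Omega} := iota.

Definition base_emb : embedding iota K^o.
Proof.
apply: (@Embedding _ _ _ _ base_emb_morph) => a.
by rewrite /= -[RHS](mulr1 (iota a)) -(rmorph1 iota) -rmorphM.
Defined.

(** An annihilating polynomial of [z] of least size over [L] is irreducible; [L(z)] is built from it
    as an abstract extension, then embedded. *)
Lemma exists_adjoin (L : fieldExtType K) (l : embedding iota L) (z : Omega) :
  exists (L' : fieldExtType K) (l' : embedding iota L'),
    (forall x, exists y, l' y = l x) /\ exists y, l' y = z.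
Proof.
pose P n := `[< exists q : {poly L}, [/\ q != 0, root (map_poly l q) z & size q = n] >].
have Pex : exists n, P n.
  have [q q0 qz] := Omega_alg z.
  exists (size (map_poly (in_alg L) q)); apply/asboolP; exists (map_poly (in_alg L) q).
  rewrite map_poly_eq0 q0; split=> //.
  by rewrite -map_poly_comp (eq_map_poly (embK l)).
case: (ex_minnP Pex) => n /asboolP[q [q0 qz sq]] minq.
have irr : irreducible_poly q.
  apply/(subfx_irreducibleP qz q0) => q' qz' q0'; rewrite sq; apply: minq.
  by apply/asboolP; exists q'.
pose L1 : fieldExtType L := SubFieldExtType qz irr.
pose L' : fieldExtType K := baseFieldType L1.
pose l' : {rmorphism L' -> Omega} := (subfx_inj : subFExtend l z q -> Omega).
have l'E (a : K) : l' a%:A = iota a.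
  by rewrite baseField_scaleE /= [LHS](subfx_inj_base qz q0) embK.
exists L', (Embedding l'E); split=> [x|].
  by exists (x%:A : L1); exact: (subfx_inj_base qz q0).
by exists (subfx_root l z q); exact: (subfx_inj_root qz q0).
Qed.

Lemma exists_extension (zs : seq Omega) :
  exists (L : fieldExtType K) (l : embedding iota L),
    forall z, z \in zs -> exists y, l y = z.
Proof.
elim: zs => [|z zs [L [l lE]]]; first by exists K^o, base_emb.
have [L' [l' [ll' [y yz]]]] := exists_adjoin l z.
exists L', l' => t; rewrite inE => /orP[/eqP->|/lE[u <-]]; first by exists y.
by have [v <-] := ll' u; exists v.
Qed.

Hypothesis K_char0 : [pchar K] =i pred0.

Lemma galois_of_char0 (M : splittingFieldType K) : galois 1 {:M}.
Proof.
apply/and3P; split; [exact: sub1v| |exact: normalFieldf].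
apply/separableP => x _; apply/negPn/negP => /separablePn_pchar[q].
by rewrite pchar_lalg K_char0.
Qed.

Lemma exists_splitting_extension (zs : seq Omega) :
  exists (M : splittingFieldType K) (m : embedding iota M),
    galois 1 {:M} /\ forall z, z \in zs -> exists y, m y = z.
Proof.
have [q [q0 qz]] : exists q : {poly K}, q != 0 /\ forall z, z \in zs -> root (map_poly iota q) z.
  elim: zs => [|z zs [q [q0 qz]]]; first by exists 1; rewrite oner_neq0.
  have [r r0 rz] := Omega_alg z; exists (r * q); rewrite mulf_neq0 //; split=> // t.
  by rewrite rmorphM rootM inE => /orP[/eqP->|/qz ->]; rewrite ?rz ?orbT.
have [rs qE] := closed_field_poly_normal (map_poly iota q).
set c := lead_coef _ in qE; have c0 : c != 0 by rewrite lead_coef_eq0 map_poly_eq0.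
have [L [l lE]] := exists_extension rs.
have [ys ysE] : exists ys, map l ys = rs.
  elim: rs lE {qE c c0} => [|r rs IH] lE; first by exists [::].
  have [y yr] := lE r (mem_head _ _); have [|ys <-] := IH.
    by move=> z zrs; apply: lE; rewrite inE zrs orbT.
  by exists (y :: ys); rewrite /= yr.
have qL : map_poly (in_alg L) q %= \prod_(y <- ys) ('X - y%:P).
  rewrite -(eqp_map l) -map_poly_comp (eq_map_poly (embK l)) qE.
  rewrite (eqp_trans (eqp_scale _ c0)) // rmorph_prod -ysE big_map.
  rewrite [X in _ %= X](eq_bigr (fun j => 'X - (l j)%:P)) ?eqpxx // => i _.
  by rewrite /= map_polyXsubC.
pose T := <<1 & ys>>%AS; pose v : {lrmorphism subvs_of T -> L} := @vsval _ _ T.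
pose M : splittingFieldType K :=
  HB.pack (subvs_of T) (FieldExt_isSplittingField.Build _ (subvs_of T) (splitting_subvs qL)).
pose m : embedding iota M := comp_embedding l v.
exists M, m; split=> [|z zzs]; first exact: galois_of_char0.
have : z \in rs by rewrite -root_prod_XsubC -(rootZ _ _ c0) -qE qz.
rewrite -ysE => /mapP[y yys ->]; exists (vsproj T y) => /=.
by rewrite vsprojK // seqv_sub_adjoin.
Qed.

End BigExtension.

Section Generated.

Variable Omega : closedFieldType.
Implicit Types A B : set Omega.

Lemma generated_sub A x : A x -> generated_subfield A x.
Proof. by move=> Ax S [_ AS]; exact: AS. Qed.

Lemma generated_min A B :
  GRing.divring_closed [in B] -> (A `<=` B)%classic -> (generated_subfield A `<=` B)%classic.
Proof. by move=> cB AB x gx; apply: gx. Qed.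

Lemma generated_closed A : GRing.divring_closed [in generated_subfield A].
Proof.
split=> [|x y|x y]; rewrite ?classical_sets.inE.
- by move=> S [[S1 _ _] _]; move: S1; rewrite classical_sets.inE.
- move=> gx gy S SA; have [[_ SB _] _] := SA.
  by have := SB x y; rewrite !classical_sets.inE; apply; [exact: gx|exact: gy].
- move=> gx gy S SA; have [[_ _ SV] _] := SA.
  by have := SV x y; rewrite !classical_sets.inE; apply; [exact: gx|exact: gy].
Qed.

End Generated.

Section Model.

Variables (K : fieldType) (Omega : closedFieldType) (iota : {rmorphism K -> Omega}).

Lemma range_closed (M : fieldExtType K) (m : embedding iota M) (T : {subfield M}) :
  GRing.divring_closed [in (m @` [set` T])%classic].
Proof.
split=> [|x y|x y]; rewrite ?classical_sets.inE.
- by exists 1; rewrite ?rmorph1 //= mem1v.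
- by move=> [u uT <-] [v vT <-]; exists (u - v); rewrite ?rmorphB //= memvB.
- by move=> [u uT <-] [v vT <-]; exists (u / v); rewrite ?fmorph_div //= rpred_div.
Qed.

Lemma range_vbasis (L M : fieldExtType K) (l : embedding iota L) (m : embedding iota M) :
  (forall z, z \in [seq l v | v <- vbasis {:L}] -> exists y, m y = z) ->
  forall x, exists y, m y = l x.
Proof.
move=> H x; have xE := coord_vbasis (memvf x).
have Hb (i : 'I_(\dim {:L})) : exists y, m y = l (vbasis {:L})`_i.
  by apply: H; apply: map_f; rewrite mem_nth // size_tuple.
have [b bE] := choice Hb.
exists (\sum_i coord (vbasis {:L}) i x *: b i); rewrite [in RHS]xE !rmorph_sum.
by apply: eq_bigr => i _; rewrite !embZ bE.
Qed.

Variables (M : splittingFieldType K) (m : embedding iota M).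
Hypothesis M_gal : galois 1 {:M}.

(** The fixed field of [s] is closed under the field operations, so [s] fixes the generated field as
    soon as it fixes the generators: Galois groups are read off [A]. *)
Lemma generated_model (A : set Omega) :
  (forall x, A x -> exists y, m y = x) -> (forall a, generated_subfield A (iota a)) ->
  exists T : {subfield M}, (m @` [set` T])%classic = generated_subfield A /\
    forall s : gal_of {:M}, s \in 'Gal({:M} / T)%g <-> forall x, A (m x) -> s x = x.
Proof.
move=> mA KA; have [g1 gB gV] := generated_closed A; rewrite !classical_sets.inE in g1.
have gM u v : generated_subfield A u -> generated_subfield A v -> generated_subfield A (u * v).
  move=> gu gv; have v1 : generated_subfield A v^-1.
    by have := gV 1 v; rewrite !classical_sets.inE mul1r; apply.
  by have := gV u v^-1; rewrite !classical_sets.inE invrK; apply.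
have gD u v : generated_subfield A u -> generated_subfield A v -> generated_subfield A (u + v).
  move=> gu gv; have v1 : generated_subfield A (- v).
    have := gB (v - v) v; rewrite !classical_sets.inE subrr sub0r; apply=> //.
    by have := gB v v; rewrite !classical_sets.inE subrr; apply.
  by have := gB u (- v); rewrite !classical_sets.inE opprK; apply.
have [T TE] : exists T : {subfield M}, forall x, x \in T <-> generated_subfield A (m x).
  apply: exists_subfield_of_set => [|a u v gu gv|u v gu gv].
  - by rewrite rmorph1.
  - by rewrite rmorphD embZ; apply: gD => //; apply: gM.
  - by rewrite rmorphM; apply: gM.
exists T; split.
  apply/seteqP; split=> [_ [x /= /TE gx <-] //|x gx].
  have [y _ yx] : (m @` [set` {:M}%AS])%classic x.
    apply: generated_min gx; first exact: range_closed.
    by move=> z /mA[y <-]; exists y => //=; exact: memvf.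
  by exists y => //=; apply/TE; rewrite yx.
move=> s; split=> [/mem_galfP sT x Ax|sA]; first by apply: sT; apply/TE; exact: generated_sub.
apply/mem_galfP => x /TE gx.
have [y ys /emb_inj <-] : (m @` [set` fixedField [set s]%SET])%classic (m x).
  apply: generated_min gx; first exact: range_closed.
  move=> z Az; have [y yz] := mA z Az; exists y => //=.
  by apply/fixedFieldP; rewrite ?memvf // => t /set1P->; apply: sA; rewrite yz.
by move: ys => /= /mem_fixedFieldP[_]; apply; exact: set11.
Qed.

End Model.

(** * Galois groups of embedded fields *)

Section ModelGroups.

Variables (K : fieldType) (Omega : closedFieldType) (iota : {rmorphism K -> Omega}).
Variables (M : splittingFieldType K) (m : embedding iota M).
Hypothesis M_gal : galois 1 {:M}.
Local Notation G := ('Gal({:M} / 1))%G.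

Lemma mem_gal_img (L : fieldExtType K) (g : {lrmorphism L -> M}) (s : gal_of {:M}) :
  s \in 'Gal({:M} / img g)%g <-> forall x, s (g x) = g x.
Proof.
split=> [/mem_galfP sI x|sI]; first exact: sI (mem_img g x).
by apply/mem_galfP => _ /mem_imgP[x ->].
Qed.

Lemma sub_gal (T : {subfield M}) : ('Gal({:M} / T) \subset G)%g.
Proof. exact: galS (sub1v _). Qed.

Lemma eq_image_gal (T1 T2 : {subfield M}) :
  (m @` [set` T1])%classic = (m @` [set` T2])%classic <->
  ('Gal({:M} / T1) = 'Gal({:M} / T2))%g.
Proof.
split=> [E|/(gal_inj M_gal) ->] //; congr ('Gal(_ / _))%g.
have sub (T T' : {subfield M}) : (m @` [set` T])%classic = (m @` [set` T'])%classic ->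
    (T <= T')%VS.
  move=> TT; apply/subvP => x xT; have : (m @` [set` T'])%classic (m x) by rewrite -TT; exists x.
  by move=> [y /= yT /emb_inj <-].
by apply/eqP; rewrite eqEsubv !sub.
Qed.

Lemma ext_maximal (L : fieldExtType K) (g : {lrmorphism L -> M}) q : (1 < q)%N ->
  (\dim {:L} = q /\ no_intermediate L) <->
  (maximal 'Gal({:M} / img g) G /\ #|G : 'Gal({:M} / img g)| = q)%g.
Proof.
move=> q1; rewrite gal_index // dim_img.
split=> [[dL noL]|[maxL dL]]; split=> //.
  by apply/(maximal_gal M_gal); [rewrite dim_img dL|apply/no_intermediate_img].
by apply/(no_intermediate_img g)/(maximal_gal M_gal); rewrite ?dim_img ?dL.
Qed.

Lemma exists_ext (A : {group gal_of {:M}}) q : (1 < q)%N ->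
  maximal A G -> #|G : A|%g = q ->
  exists (L : fieldExtType K) (l : embedding iota L) (g : {lrmorphism L -> M}),
    [/\ forall x, m (g x) = l x, 'Gal({:M} / img g)%g = A
      & \dim {:L} = q /\ no_intermediate L].
Proof.
move=> q1 maxA iA; pose T := [aspace of fixedField A].
pose g : {lrmorphism subvs_of T -> M} := @vsval _ _ T.
have gT : 'Gal({:M} / img g)%g = A.
  rewrite -[RHS](gal_fixedField A) /=; congr ('Gal(_ / _))%g.
  apply/vspaceP => x; apply/mem_imgP/idP => [[y ->]|xT]; first exact: subvsP.
  by exists (Subvs xT).
exists (subvs_of T), (comp_embedding m g), g; split=> //.
by apply/(ext_maximal g q1); rewrite gT.
Qed.

Lemma compositum_model (L E : fieldExtType K) (l : embedding iota L) (e : embedding iota E)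
    (g : {lrmorphism L -> M}) (h : {lrmorphism E -> M}) :
  (forall x, m (g x) = l x) -> (forall x, m (h x) = e x) ->
  exists T : {subfield M}, (m @` [set` T])%classic = compositum l e /\
    ('Gal({:M} / T) = 'Gal({:M} / img g) :&: 'Gal({:M} / img h))%g.
Proof.
move=> mg mh; have [|a|T [TE TG]] := generated_model (m := m) (A := (range l `|` range e)%classic).
- by move=> x [[y _ <-]|[y _ <-]]; [exists (g y)|exists (h y)].
- by apply: generated_sub; left; exists a%:A; rewrite ?embK.
exists T; split=> //; apply/setP => s; rewrite inE.
apply/idP/andP => [/TG sA|[/mem_gal_img sL /mem_gal_img sE]].
  split; apply/mem_gal_img => x; apply: sA; [left|right]; exists x; rewrite ?mg ?mh //.
apply/TG => x [[y _]|[y _]]; rewrite -?mg -?mh => /emb_inj <-; [exact: sL|exact: sE].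
Qed.

Lemma compositum_eq (L1 L2 E : fieldExtType K) (l1 : embedding iota L1) (l2 : embedding iota L2)
    (e : embedding iota E) (g1 : {lrmorphism L1 -> M}) (g2 : {lrmorphism L2 -> M})
    (h : {lrmorphism E -> M}) :
  (forall x, m (g1 x) = l1 x) -> (forall x, m (g2 x) = l2 x) -> (forall x, m (h x) = e x) ->
  compositum l1 e = compositum l2 e <->
  ('Gal({:M} / img g1) :&: 'Gal({:M} / img h) = 'Gal({:M} / img g2) :&: 'Gal({:M} / img h))%g.
Proof.
move=> mg1 mg2 mh; have [T1 [<- <-]] := compositum_model mg1 mh.
by have [T2 [<- <-]] := compositum_model mg2 mh; exact: eq_image_gal.
Qed.

Lemma lr_conj (L : fieldExtType K) (g1 g2 : {lrmorphism L -> M}) :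
  exists s : gal_of {:M}, forall x, g2 x = s (g1 x).
Proof.
have [s sE] := conj_ahom (linfun_ahom g1) (linfun_ahom g2).
by exists s => x; have := sE x; rewrite !lfunE.
Qed.

Definition gal_lr (s : gal_of {:M}) : {lrmorphism M -> M} := s.

Definition comp_lr (L1 L2 L3 : fieldExtType K) (g : {lrmorphism L2 -> L3})
  (f : {lrmorphism L1 -> L2}) : {lrmorphism L1 -> L3} := g \o f.

Lemma iso_conj (L1 L2 : fieldExtType K) (g1 : {lrmorphism L1 -> M}) (g2 : {lrmorphism L2 -> M}) :
  Kisomorphic L1 L2 <->
  exists s, ('Gal({:M} / img g2) = 'Gal({:M} / img g1) :^ s)%g.
Proof.
split=> [[f [f' fK f'K]]|[s sE]].
  have [s sE] := lr_conj g1 (comp_lr g2 f); exists s; rewrite gal_conjg; congr ('Gal(_ / _))%g.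
  apply/vspaceP => x; apply/mem_imgP/memv_imgP => [[y ->]|[_ /mem_imgP[y ->] ->]].
    by exists (g1 (f' y)); rewrite ?mem_img // -sE /= f'K.
  by exists (f y); rewrite -sE.
have {}sE : (img g2 : {vspace M}) = (s @: img g1)%VS.
  by apply: (gal_inj M_gal (T := (s @: img g1)%AS)); rewrite sE gal_conjg.
have [|x|f fE] := @exists_model_gen _ _ _ _ (comp_lr (gal_lr s) g1) g2.
- by move=> a; exact: etrans (lrmorphA _ a) (esym (lrmorphA g2 a)).
- have : s (g1 x) \in img g2 by rewrite sE memv_img ?mem_img.
  by move=> /mem_imgP[y yE]; exists y; exact: esym.
have surj y : exists x, f x = y.
  have := mem_img g2 y; rewrite sE => /memv_imgP[_ /mem_imgP[x ->] yx]; exists x.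
  by apply: (fmorph_inj g2); rewrite [LHS]fE.
have [f' f'K] := choice surj.
by exists f; exists f' => // x; apply: (fmorph_inj f); exact: f'K.
Qed.

(** Normality of [E]: [s (h x)] is a root of the minimal polynomial of [x], which splits in [E], so
    [s] preserves the image of [h]. *)
Lemma gal_restrict (E : splittingFieldType K) (h : {lrmorphism E -> M}) (s : gal_of {:M}) :
  exists t : gal_of {:E}, forall x, h (t x) = s (h x).
Proof.
have [a|x|f fE] := @exists_model_gen _ _ _ _ (comp_lr (gal_lr s) h) h.
- exact: etrans (lrmorphA _ a) (esym (lrmorphA h a)).
- have [r /eqP rE] := splitting_field_normal 1 x.
  have /polyOver1P[q qE] := minPolyOver 1 x.
  have rt : root (map_poly h (minPoly 1 x)) (s (h x)).
    rewrite qE -map_poly_comp (eq_map_poly (lrmorphA h)).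
    rewrite -(eq_map_poly (lrmorphA (gal_lr s))) map_poly_comp /= -[s (h x)]/(gal_lr s (h x)).
    rewrite fmorph_root -(eq_map_poly (lrmorphA h)) map_poly_comp fmorph_root -qE.
    exact: root_minPoly.
  move: rt; rewrite rE rmorph_prod /=.
  rewrite (eq_bigr (fun j => 'X - (h j)%:P)) => [|i _]; last by rewrite map_polyXsubC.
  rewrite -(big_map h xpredT (fun j => 'X - j%:P)) root_prod_XsubC => /mapP[y _ ->].
  by exists y.
have [t tE] := conj_ahom (\1%AF : 'AHom(E, E)) (linfun_ahom f).
by exists t => x; have := tE x; rewrite id_lfunE lfunE => <-; exact: fE.
Qed.

Lemma gal_extend (E : splittingFieldType K) (h : {lrmorphism E -> M}) (t : gal_of {:E}) :
  exists s : gal_of {:M}, forall x, h (t x) = s (h x).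
Proof. exact: (lr_conj h (comp_lr h (t : {lrmorphism E -> E}))). Qed.

Lemma gal_img_normal (E : splittingFieldType K) (h : {lrmorphism E -> M}) :
  ('Gal({:M} / img h) <| G)%g.
Proof.
rewrite /normal sub_gal; apply/subsetP => s _; rewrite inE.
apply/subsetP => _ /imsetP[b /mem_gal_img bB ->].
apply/mem_gal_img => x; have [t tE] := gal_restrict h s^-1%g.
by rewrite conjgE !galfM -tE bB tE -galfM mulVg gal_id.
Qed.

End ModelGroups.

(** * The split extension Gal(LE/K) *)

Section SplitCompositum.

Variables (K : fieldType) (Omega : closedFieldType) (iota : {rmorphism K -> Omega}).
Hypothesis K_char0 : [pchar K] =i pred0.
Variables (M : splittingFieldType K) (m : embedding iota M).
Let M_gal : galois 1 {:M} := galois_of_char0 K_char0 M.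
Local Notation G := ('Gal({:M} / 1))%G.

(** [LE] is Galois because [A :&: B] is normal, and [Gal(LE/L)] is a complement of [Gal(LE/E)]: they
    meet trivially and their orders multiply to [[LE : K]]. As [split_compositum] wants [LE] as a
    full range, it gets its own splitting field [N]. *)
Lemma split_compositum_model (L : fieldExtType K) (E : splittingFieldType K)
    (l : embedding iota L) (e : embedding iota E)
    (g : {lrmorphism L -> M}) (h : {lrmorphism E -> M}) :
  (forall x, m (g x) = l x) -> (forall x, m (h x) = e x) ->
  let A := 'Gal({:M} / img g)%G in let B := 'Gal({:M} / img h)%G in
  maximal A G -> (A :&: B <| G)%g -> ~~ (B \subset A) -> split_compositum e l.
Proof.
move=> mg mh A B maxA nAB BA; have [T [TE TG]] := compositum_model mg mh.
have galT : galois 1 T.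
  have -> : (T : {vspace M}) = fixedField (A :&: B)%g.
    by rewrite -TG; have /galois_fixedField -> := galois_over M_gal T.
  exact: normal_fixedField_galois.
have [N [v vT]] := exists_splitting_subfield galT.
have sub (L1 : fieldExtType K) (g1 : {lrmorphism L1 -> M}) : (img g1 <= T)%VS ->
    exists f : {lrmorphism L1 -> N}, forall x, v (f x) = g1 x.
  move=> gT; apply: exists_model_gen => [a|x].
    exact: etrans (lrmorphA _ a) (esym (lrmorphA v a)).
  have : g1 x \in img v by rewrite vT (subvP gT) ?mem_img.
  by move=> /mem_imgP[y yE]; exists y.
have subT (S : {subfield M}) : ('Gal({:M} / T) \subset 'Gal({:M} / S))%g -> (S <= T)%VS.
  have /galois_fixedField {2}<- := galois_over M_gal T.
  have /galois_fixedField {2}<- := galois_over M_gal S.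
  exact: fixedFieldS.
have [gN gNE] : exists f : {lrmorphism L -> N}, forall x, v (f x) = g x.
  by apply: sub; apply: subT; rewrite TG subsetIl.
have [hN hNE] : exists f : {lrmorphism E -> N}, forall x, v (f x) = h x.
  by apply: sub; apply: subT; rewrite TG subsetIr.
have galN : galois 1 {:N} := galois_of_char0 K_char0 N.
exists N, (comp_embedding m v), (img hN); split=> //.
- rewrite -TE; apply/seteqP; split=> [_ [x _ <-]|_ [x xT <-]].
    by exists (v x) => //=; rewrite -vT mem_img.
  have /mem_imgP[y yE] : x \in img v by rewrite vT.
  by exists y => //=; rewrite -yE.
- apply/seteqP; split=> [_ [x /mem_imgP[y ->] <-]|_ [x _ <-]].
    by exists y => //=; rewrite hNE mh.
  by exists (hN x) => /=; rewrite ?mem_img // hNE mh.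
apply/splitsP; exists 'Gal({:N} / img gN)%G; apply/complP.
have tiN : ('Gal({:N} / img hN) :&: 'Gal({:N} / img gN) = 1)%g.
  apply/trivgP/subsetP => s; rewrite inE => /andP[/mem_gal_img sh /mem_gal_img sg].
  have [t tE] := gal_extend v s.
  have : t \in 'Gal({:M} / T)%g.
    rewrite TG inE; apply/andP; split; apply/mem_gal_img => x.
      by rewrite -gNE -tE sg.
    by rewrite -hNE -tE sh.
  move=> /mem_galfP tT; apply/set1P/eqP/gal_eqP => x _; rewrite gal_id.
  by apply: (fmorph_inj v); apply: etrans (tE x) _; apply: tT; rewrite -vT mem_img.
split=> //; apply/eqP; rewrite eqEcard mul_subG ?(galS _ (sub1v _)) //=.
rewrite TI_cardMg // -(galois_dim galN) dimv1 divn1.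
(* [[LE : E] = #|B : A :&: B| = #|G : A| = [L : K]]. *)
have dT : (\dim T = \dim {:L} * \dim {:E})%N.
  rewrite -gal_index // TG -(dim_img g) -(dim_img h) -!gal_index //.
  rewrite -(Lagrange_index (normal_sub (gal_img_normal h)) (subsetIr _ _)) mulnC.
  by rewrite (maximal_index_mul maxA (gal_img_normal h) BA) mulnC.
have dN : \dim {:N} = \dim T by rewrite -(dim_img v) vT.
have cN (L1 : fieldExtType K) (f : {lrmorphism L1 -> N}) :
    (#|'Gal({:N} / img f)%g| * \dim {:L1})%N = \dim {:N}.
  by rewrite -(dim_img f) -gal_index // Lagrange ?sub_gal // -(galois_dim galN) dimv1 divn1.
have cL : #|'Gal({:N} / img gN)%g| = \dim {:E}.
  by apply/eqP; rewrite -(eqn_pmul2r (adim_gt0 {:L})) cN dN dT mulnC.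
have cE : #|'Gal({:N} / img hN)%g| = \dim {:L}.
  by apply/eqP; rewrite -(eqn_pmul2r (adim_gt0 {:E})) cN dN dT.
suff : (\dim {:N} <= #|'Gal({:N} / img hN)%g| * #|'Gal({:N} / img gN)%g|)%N by [].
by rewrite cL cE dN dT.
Qed.

End SplitCompositum.

(** * Power classes and radical extensions *)

Definition fcons (T : Type) r (v : T) (b : 'I_r -> T) (i : 'I_r.+1) : T :=
  if unlift ord0 i is Some j then b j else v.

Section Independence.

Variables (F : fieldType) (V : lmodType F).

Definition indep r (b : 'I_r -> V) :=
  forall c : 'I_r -> F, \sum_i c i *: b i = 0 -> forall i, c i = 0.

Lemma indep_cons r v (b : 'I_r -> V) : indep b ->
  (forall c : 'I_r -> F, v != \sum_i c i *: b i) -> indep (fcons v b).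
Proof.
move=> ib vb c; rewrite big_ord_recl {1}/fcons unlift_none => E.
have bE i : c (lift ord0 i) *: fcons v b (lift ord0 i) = c (lift ord0 i) *: b i.
  by rewrite /fcons liftK.
rewrite (eq_bigr _ (fun i _ => bE i)) in E.
have c0 : c ord0 = 0.
  apply/eqP; apply: contraT => c0; have /eqP := vb (fun i => - ((c ord0)^-1 * c (lift ord0 i))).
  case; move/eqP: E; rewrite addr_eq0 => /eqP /(congr1 ( *:%R (c ord0)^-1)).
  rewrite scalerA mulVf // scale1r => ->; rewrite scalerN scaler_sumr -sumrN.
  by apply: eq_bigr => i _; rewrite scaleNr scalerA.
move: E; rewrite c0 scale0r add0r => /ib cl i.
by case: (unliftP ord0 i) => [j ->|-> //].
Qed.

Lemma submod_sum (X : set V) : GRing.submod_closed [in X] ->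
  forall r (c : 'I_r -> F) (b : 'I_r -> V), (forall i, X (b i)) -> X (\sum_i c i *: b i).
Proof.
move=> [X0 XD] r c b Xb; rewrite classical_sets.inE in X0.
elim/big_rec: _ => // i v _ Xv; have := XD (c i) (b i) v.
by rewrite !classical_sets.inE; apply.
Qed.

Lemma exists_dim (X : set V) n : GRing.submod_closed [in X] ->
  (forall r (b : 'I_r -> V), (forall i, X (b i)) -> indep b -> (r <= n)%N) ->
  exists r, has_dim r X.
Proof.
move=> Xsub bnd.
pose P r := `[< exists b : 'I_r -> V, (forall i, X (b i)) /\ indep b >].
have Pex : exists r, P r.
  exists 0%N; apply/asboolP; exists (fun=> 0); split=> [[]|c _ []] //.
have Pn r : P r -> (r <= n)%N by move=> /asboolP[b [Xb ib]]; exact: bnd Xb ib.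
case: (ex_maxnP Pex Pn) => r /asboolP[b [Xb ib]] max; exists r, b; split=> // v.
split=> [Xv|[c ->]]; last exact: submod_sum.
apply: contrapT => nc; suff : (r.+1 <= r)%N by rewrite ltnn.
apply: max; apply/asboolP; exists (fcons v b); split=> [i|].
  by rewrite /fcons; case: (unlift ord0 i).
by apply: indep_cons => // c; apply/eqP => vE; apply: nc; exists c.
Qed.

End Independence.

Section PClasses.

Variables (p : nat) (p_pr : prime p) (E : fieldType).
Local Notation pc := (@pcl p p_pr E).

Lemma pcl_choice (I : Type) (b : I -> pclasses E p_pr) :
  exists x : I -> E, (forall i, x i != 0) /\ b = fun i => pc (x i).
Proof.
have [|x xE] := @choice _ _ (fun i u => u != 0 /\ b i = pc u).
  by move=> i; have [u u0 uE] := pcl_surj (b i); exists u.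
by exists x; split=> [i|]; [case: (xE i)|apply: funext => i; case: (xE i)].
Qed.

Lemma pcl_prod r (x : 'I_r -> E) (n : 'I_r -> nat) : (forall i, x i != 0) ->
  pc (\prod_i x i ^+ n i) = \sum_i pc (x i) *+ n i.
Proof.
move=> x0.
suff [] : \prod_i x i ^+ n i != 0 /\ pc (\prod_i x i ^+ n i) = \sum_i pc (x i) *+ n i by [].
elim/big_rec2: _ => [|i v y _ [y0 yE]]; first by rewrite oner_neq0 pcl1.
by rewrite mulf_neq0 ?expf_neq0 // pclM ?expf_neq0 // pclX // yE.
Qed.

Lemma pclXp x : x != 0 -> pc (x ^+ p) = 0.
Proof.
move=> x0; rewrite -(pcl1 p_pr E).
by apply/pcl_eq; rewrite ?expf_neq0 ?oner_neq0 //; exists x; rewrite ?mul1r.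
Qed.

Lemma pcl_eq0 x : x != 0 -> pc x = 0 -> exists2 z, z != 0 & x = z ^+ p.
Proof.
move=> x0; rewrite -(pcl1 p_pr E) => /pcl_eq; rewrite oner_neq0 => /(_ x0 isT)[z z0 ->].
by exists z; rewrite ?mul1r.
Qed.

(** Independence over ['F_p] in the multiplicative form that [kummer_index] requires. *)
Lemma indep_pcl r (x : 'I_r -> E) : (forall i, x i != 0) -> indep (fun i => pc (x i)) ->
  forall (n : 'I_r -> nat), pc (\prod_i x i ^+ n i) = 0 -> forall i, (p %| n i)%N.
Proof.
move=> x0 ix n; rewrite pcl_prod // => E0 i.
have c0 : \sum_i ((n i)%:R : 'F_p) *: pc (x i) = 0.
  by rewrite -[RHS]E0; apply: eq_bigr => j _; rewrite scaler_nat.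
by have /(congr1 val) := ix _ c0 i; rewrite /= val_Fp_nat // => /eqP.
Qed.

End PClasses.

(** * Radical extensions as subgroups of Gal(M/E) *)

Section KummerClasses.

Variables (p : nat) (p_pr : prime p) (K : fieldType) (E M : splittingFieldType K).
Hypothesis M_gal : galois 1 {:M}.
Variables (h : {lrmorphism E -> M}) (zeta : M).
Hypothesis zeta_prim : p.-primitive_root zeta.

Local Notation pc := (@pcl p p_pr E).
Local Notation G := ('Gal({:M} / 1))%G.
Local Notation B := ('Gal({:M} / img h))%G.
Local Notation Bz := ('Gal({:M} / <<img h; zeta>>))%G.
Implicit Types (Xi : set (pclasses E p_pr)) (s : gal_of {:M}).

Definition has_roots Xi :=
  forall x, x != 0 -> Xi (pc x) -> exists y, y ^+ p = h x.

(* [Gal(M / E(Xi^(1/p)))], by [radical_model]. *)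
Definition rad_set Xi : {set gal_of {:M}} :=
  [set s in B | `[< forall x y, x != 0 -> Xi (pc x) -> y ^+ p = h x -> s y = y >]]%SET.

Lemma rad_setP Xi s : reflect (s \in B /\
  forall x y, x != 0 -> Xi (pc x) -> y ^+ p = h x -> s y = y) (s \in rad_set Xi).
Proof. by rewrite inE; apply: (iffP andP) => -[sB /asboolP]. Qed.

Fact rad_group_set Xi : group_set (rad_set Xi).
Proof.
apply/group_setP; split=> [|s t /rad_setP[sB sX] /rad_setP[tB tX]].
  by apply/rad_setP; rewrite group1; split=> // x y _ _ _; rewrite gal_id.
apply/rad_setP; rewrite groupM //; split=> // x y x0 Xx yx.
by rewrite galfM (sX x) // (tX x).
Qed.
Canonical rad_group Xi := Group (rad_group_set Xi).

Lemma rad_sub Xi : rad_set Xi \subset B.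
Proof. by apply/subsetP => s /rad_setP[]. Qed.

Let p_gt0 : (0 < p)%N. Proof. exact: prime_gt0. Qed.

Lemma lrM x y : h (x * y) = h x * h y. Proof. exact: rmorphM. Qed.

Lemma lrX x n : h (x ^+ n) = h x ^+ n. Proof. exact: rmorphXn. Qed.

Lemma lr_eq0 x : (h x == 0) = (x == 0). Proof. exact: fmorph_eq0. Qed.

Lemma lr_prod (I : Type) (r : seq I) (P : pred I) (x : I -> E) :
  h (\prod_(i <- r | P i) x i) = \prod_(i <- r | P i) h (x i).
Proof. exact: rmorph_prod. Qed.

Lemma root_neq0 x y : x != 0 -> y ^+ p = h x -> y != 0.
Proof.
move=> x0 yx; apply: contraNneq x0 => y0; rewrite -lr_eq0 -yx y0.
by rewrite expr0n gtn_eqF ?p_gt0.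
Qed.

Lemma root_unity_mul (y y' : M) : y' != 0 -> y ^+ p = y' ^+ p -> exists i, y = zeta ^+ i * y'.
Proof.
move=> y0 yy; have [|i iE] := prim_rootP zeta_prim (x := y / y').
  by rewrite expr_div_n yy divff // expf_neq0.
by exists i; rewrite -iE mulfVK.
Qed.

Lemma root_class x x' y y' : x != 0 -> x' != 0 -> pc x = pc x' ->
  y ^+ p = h x -> y' ^+ p = h x' -> exists i z, y = zeta ^+ i * (y' * h z).
Proof.
move=> x0 x'0 /pcl_eq; rewrite x0 x'0 => /(_ isT isT)[z z0 xE] yx yx'.
have [||i iE] := @root_unity_mul y (y' * h z); last by exists i, z.
  by rewrite mulf_neq0 ?lr_eq0 // (root_neq0 x'0 yx').
by rewrite yx exprMn yx' xE lrM lrX.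
Qed.

Lemma mem_gal_zeta s : reflect (s \in B /\ s zeta = zeta) (s \in Bz).
Proof.
apply: (iffP idP) => [sBz|[sB sz]].
  split; first by apply: subsetP sBz; exact: galS (subv_adjoin _ _).
  by have /mem_galfP -> := sBz; rewrite ?memv_adjoin.
apply/mem_galfP => x xz.
have : x \in fixedField [set s]%SET.
  apply: subvP xz; apply/FadjoinP; split; last first.
    by apply/fixedFieldP; rewrite ?memvf // => t /set1P->.
  apply/subvP => t tS; apply/fixedFieldP; rewrite ?memvf // => u /set1P->.
  by have /mem_galfP -> := sB.
by move=> /mem_fixedFieldP[_]; apply; exact: set11.
Qed.

(** Roots of two elements of one class differ by a power of [zeta] and an element of [E], both fixed
    by [s]; so representatives can be chosen at will. *)
Lemma fix_class s x x' y y' : s \in Bz -> x != 0 -> x' != 0 -> pc x = pc x' ->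
  y ^+ p = h x -> y' ^+ p = h x' -> s y' = y' -> s y = y.
Proof.
move=> /mem_gal_zeta[/mem_galfP sB sz] x0 x'0 xx yx yx' sy.
have [i [z ->]] := root_class x0 x'0 xx yx yx'.
by rewrite !gal_mulr gal_expr sz sy (sB (h z)) ?mem_img.
Qed.

(** [zeta] is a [p]-th root of 1, whose class is 0: a radical extension contains the [p]-th roots of
    unity. *)
Lemma rad_sub_zeta Xi : Xi 0 -> rad_set Xi \subset Bz.
Proof.
move=> X0; apply/subsetP => s /rad_setP[sB sX]; apply/mem_gal_zeta; split=> //.
apply: (sX 1); rewrite ?oner_neq0 ?pcl1 // (prim_expr_order zeta_prim); exact/esym/rmorph1.
Qed.

Lemma kummer_index_indep r (x : 'I_r -> E) (y : 'I_r -> M) : (forall i, x i != 0) ->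
  (forall i, y i ^+ p = h (x i)) -> indep (fun i => pc (x i)) ->
  #|Bz : kummer_group (img h) zeta y|%g = (p ^ r)%N.
Proof.
move=> x0 yx ix; apply: (kummer_index p_pr M_gal zeta_prim (x := fun i => h (x i))) => //.
- by move=> i; exact: mem_img.
- by move=> i; rewrite lr_eq0.
move=> n _ /mem_imgP[z ->] E0; apply: (indep_pcl x0 ix).
have -> : \prod_i x i ^+ n i = z ^+ p.
  apply: (fmorph_inj h); rewrite [LHS]lr_prod [RHS]lrX -E0; apply: eq_bigr => i _.
  exact: lrX.
have [z0|z0] := eqVneq z 0; last exact: pclXp.
have : h (\prod_i x i ^+ n i) != 0.
  by rewrite lr_eq0; apply/prodf_neq0 => i _; rewrite expf_neq0.
rewrite lr_prod (eq_bigr (fun i => h (x i) ^+ n i)) => [|i _]; last exact: lrX.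
by rewrite E0 z0 -lrX lr_eq0 expr0n gtn_eqF ?p_gt0 // eqxx.
Qed.

Lemma dim_roots r Xi : has_dim r Xi -> has_roots Xi ->
  exists (x : 'I_r -> E) (y : 'I_r -> M), [/\ forall i, x i != 0, forall i, y i ^+ p = h (x i),
    forall v, Xi v <-> exists c : 'I_r -> 'F_p, v = \sum_i c i *: pc (x i)
    & indep (fun i => pc (x i))].
Proof.
move=> [b [Xb ib]] Xr; have [x [x0 bE]] := pcl_choice b.
move: bE Xb ib => -> Xb ib.
have Xx i : Xi (pc (x i)).
  apply/Xb; exists (fun j => (j == i)%:R).
  rewrite (bigD1 i) //= eqxx scale1r big1 ?addr0 // => j /negPf->; exact: scale0r.
have [y yE] := choice (fun i => Xr (x i) (x0 i) (Xx i)).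
by exists x, y; split.
Qed.

Lemma rad_kummer Xi r (x : 'I_r -> E) (y : 'I_r -> M) : has_roots Xi ->
  (forall i, x i != 0) -> (forall i, y i ^+ p = h (x i)) ->
  (forall v, Xi v <-> exists c : 'I_r -> 'F_p, v = \sum_i c i *: pc (x i)) ->
  rad_set Xi = kummer_group (img h) zeta y.
Proof.
move=> Xr x0 yx XE; have X0 : Xi 0.
  by apply/XE; exists (fun=> 0); rewrite big1 // => i _; rewrite scale0r.
have Xx i : Xi (pc (x i)).
  apply/XE; exists (fun j => (j == i)%:R).
  rewrite (bigD1 i) //= eqxx scale1r big1 ?addr0 // => j /negPf->; exact: scale0r.
apply/setP => s; rewrite [in RHS]inE; apply/idP/andP => [sR|[sBz /forallP sy]].
  split; first by apply: subsetP sR; exact: rad_sub_zeta.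
  by apply/forallP => i; move: sR => /rad_setP[_ /(_ (x i) (y i)) ->].
have [sB sz] := mem_gal_zeta _ sBz.
apply/rad_setP; split=> // u w u0 /XE[c uE] wu.
pose x' := \prod_i x i ^+ c i; pose y' := \prod_i y i ^+ c i.
have x'0 : x' != 0 by apply/prodf_neq0 => i _; rewrite expf_neq0.
have yx' : y' ^+ p = h x'.
  rewrite lr_prod -prodrXl; apply: eq_bigr => i _.
  by rewrite lrX -yx -!exprM mulnC.
apply: (fix_class sBz u0 x'0 _ wu yx'); first by rewrite uE pcl_prod.
by rewrite gal_prodr; apply: eq_bigr => i _; rewrite gal_expr (eqP (sy i)).
Qed.

Lemma rad_index Xi r : has_dim r Xi -> has_roots Xi -> #|Bz : rad_set Xi|%g = (p ^ r)%N.
Proof.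
move=> dX Xr; have [x [y [x0 yx XE ix]]] := dim_roots dX Xr.
by rewrite (rad_kummer Xr x0 yx XE); exact: kummer_index_indep.
Qed.

(** If the class of [x] were outside [Xi], adding it to a basis of [Xi] would multiply the index by
    [p] without changing the subgroup. *)
Lemma rad_complete Xi r x y : has_dim r Xi -> has_roots Xi -> x != 0 -> y ^+ p = h x ->
  {in rad_set Xi, forall s, s y = y} -> Xi (pc x).
Proof.
move=> dX Xr x0 yx Ry; have [xs [ys [xs0 yxs XE ix]]] := dim_roots dX Xr.
apply: contrapT => nX.
have i1 : #|Bz : kummer_group (img h) zeta ys|%g = (p ^ r)%N by exact: kummer_index_indep.
have i2 : #|Bz : kummer_group (img h) zeta (fcons y ys)|%g = (p ^ r.+1)%N.
  apply: (kummer_index_indep (x := fcons x xs)).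
  - by move=> i; rewrite /fcons; case: (unlift ord0 i).
  - by move=> i; rewrite /fcons; case: (unlift ord0 i).
  rewrite (_ : (fun i => _) = fcons (pc x) (fun i => pc (xs i))); last first.
    by apply: funext => i; rewrite /fcons; case: (unlift ord0 i).
  by apply: indep_cons => // c; apply/eqP => xE; apply: nX; apply/XE; exists c.
have E0 : kummer_group (img h) zeta (fcons y ys) = kummer_group (img h) zeta ys.
  rewrite -(rad_kummer Xr xs0 yxs XE).
  apply/setP => s; apply/idP/idP.
    rewrite (rad_kummer Xr xs0 yxs XE) !inE => /andP[-> /forallP sy] /=; apply/forallP => i.
    by have := sy (lift ord0 i); rewrite /fcons liftK.
  move=> sR; have := sR; rewrite {1}(rad_kummer Xr xs0 yxs XE) !inE => /andP[-> /forallP sy] /=.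
  by apply/forallP => i; rewrite /fcons; case: (unlift ord0 i) => [j|] //; rewrite Ry.
move: i2; rewrite E0 i1 => /eqP; rewrite eqn_exp2l ?prime_gt1 // => /eqP; lia.
Qed.

Lemma conj_fix (N : {group gal_of {:M}}) (t s : gal_of {:M}) y : (N <| G)%g -> s \in N ->
  {in N, forall s, s y = y} -> s (t y) = t y.
Proof.
move=> /andP[_ nN] sN fy; have /fy : (s ^ t^-1)%g \in N.
  by rewrite memJ_norm // groupV (subsetP nN) // mem_galf.
rewrite conjgE invgK !galfM => /(congr1 t).
by rewrite -[LHS]galfM mulVg gal_id.
Qed.

Lemma rad_normal Xi : is_submodule Xi -> (rad_set Xi <| G)%g.
Proof.
move=> [_ Xst]; rewrite /normal (subset_trans (rad_sub _)) ?sub_gal //=.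
apply/subsetP => t _; rewrite inE; apply/subsetP => _ /imsetP[s /rad_setP[sB sX] ->].
apply/rad_setP; split=> [|x y x0 Xx yx].
  by rewrite memJ_norm // (subsetP (normal_norm (gal_img_normal h))) ?mem_galf.
have [u uE] := gal_restrict h t^-1%g.
have ux0 : u x != 0 by rewrite fmorph_eq0.
rewrite conjgE !galfM (sX (u x)) //.
- by rewrite -galfM mulVg gal_id.
- by apply: Xst => //; exact: mem_galf.
- by rewrite uE -yx gal_expr.
Qed.

Hypothesis zetaE : zeta \in img h.

Lemma gal_zetaE : Bz :=: B.
Proof. by have /Fadjoin_idP /= -> := zetaE. Qed.

(** For a normal [N] in between, the classes of [Xi] whose roots are fixed by [N] form a submodule
    [Y]. [Y = Xi] gives [N = rad_set Xi]. [Y = 0] means that a basis of [Xi] stays independent over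
    the fixed field of [N], so that [rad_set Xi] has index [p ^ k] in [N] as in [B]. *)
Lemma rad_chief k Xi : (0 < k)%N -> irreducible_submodule Xi -> has_dim k Xi -> has_roots Xi ->
  chief_factor G (rad_group Xi) B.
Proof.
move=> k0 [[Xsub Xst] _ Xirr] dX Xr.
have iX : #|B : rad_set Xi|%g = (p ^ k)%N by rewrite -(rad_index dX Xr) gal_zetaE.
have X0 : Xi 0 by case: Xsub; rewrite classical_sets.inE.
apply/chief_factorP; split; [by apply: rad_normal| exact: gal_img_normal | |].
  rewrite properEneq rad_sub andbT; apply: contraTneq k0 => E0.
  move: iX; rewrite E0 indexgg; case: (k) => // k' /esym/eqP.
  by rewrite -[X in _ == X](expn0 p) eqn_exp2l ?prime_gt1.
move=> N nN sDN sNB.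
pose Y : set (pclasses E p_pr) := fun v => Xi v /\
  forall x y, x != 0 -> v = pc x -> y ^+ p = h x -> {in N, forall s, s y = y}.
have NBz s : s \in N -> s \in Bz by rewrite gal_zetaE => /(subsetP sNB).
have Ysub : is_submodule Y.
  split; first split=> [|a u v]; rewrite ?classical_sets.inE.
  - split=> // x y x0 xE yx s sN; apply: (fix_class (NBz s sN) x0 (oner_neq0 _) _ yx (y' := 1)).
    + by rewrite pcl1.
    + by rewrite expr1n; exact/esym/rmorph1.
    + exact: rmorph1.
  - move=> [Xu Yu] [Xv Yv]; split.
      by have := Xsub.2 a u v; rewrite !classical_sets.inE; apply.
    move=> x y x0 xE yx s sN.
    have [x1 x10 uE] := pcl_surj u; have [x2 x20 vE] := pcl_surj v.
    have [y1 yx1] : exists y, y ^+ p = h x1 by apply: Xr => //; rewrite -uE.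
    have [y2 yx2] : exists y, y ^+ p = h x2 by apply: Xr => //; rewrite -vE.
    apply: (fix_class (NBz s sN) x0 (x' := x1 ^+ a * x2) (y' := y1 ^+ a * y2)) => //.
    + by rewrite mulf_neq0 ?expf_neq0.
    + by rewrite pclM ?expf_neq0 // pclX // -uE -vE -xE.
    + by rewrite lrM lrX exprMn -yx1 -yx2 -!exprM mulnC.
    + by rewrite gal_mulr gal_expr (Yu x1 y1) // (Yv x2 y2).
  - move=> t x tG x0 [Xx Yx]; split; first exact: Xst.
    move=> x' y' x'0 xx' yx' s sN; have [y yx] := Xr x x0 Xx.
    have [sg sgE] := gal_extend h t.
    apply: (fix_class (NBz s sN) x'0 (x' := t x) (y' := sg y)) => //.
    + by rewrite fmorph_eq0.
    + by rewrite sgE -yx gal_expr.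
    + by apply: conj_fix nN sN _; exact: Yx yx.
have [Y0|YX] := Xirr Y Ysub (fun v Yv => Yv.1).
  right; have [x [y [x0 yx XE ix]]] := dim_roots dX Xr.
  pose S := [aspace of fixedField N].
  have GS : 'Gal({:M} / S)%g = N by exact: gal_fixedField.
  have hS : (img h <= S)%VS.
    have /galois_fixedField {1}<- := galois_over M_gal (img h).
    exact: fixedFieldS.
  have zS : <<S; zeta>>%VS = S by apply/Fadjoin_idP; exact: subvP hS _ zetaE.
  have iN : #|'Gal({:M} / <<S; zeta>>) : kummer_group S zeta y|%g = (p ^ k)%N.
    apply: (kummer_index p_pr M_gal zeta_prim (x := fun i => h (x i))) => //.
    - by move=> i; rewrite (subvP hS) ?mem_img.
    - by move=> i; rewrite lr_eq0.
    move=> n z zS1 zE; apply: (indep_pcl x0 ix).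
    have zx : z ^+ p = h (\prod_i x i ^+ n i).
      by rewrite -zE lr_prod; apply: eq_bigr => i _; rewrite lrX.
    have x'0 : \prod_i x i ^+ n i != 0 by apply/prodf_neq0 => i _; rewrite expf_neq0.
    suff : Y (pc (\prod_i x i ^+ n i)) by rewrite Y0.
    split=> [|u w u0 uE wu s sN].
      apply/XE; exists (fun i => (n i)%:R); rewrite pcl_prod //; apply: eq_bigr => i _.
      by rewrite scaler_nat.
    apply: (fix_class (NBz s sN) u0 x'0 (esym uE) wu zx).
    by move: zS1 => /mem_fixedFieldP[_]; apply.
  have GSz : 'Gal({:M} / <<S; zeta>>)%g = N by rewrite zS GS.
  have kN : kummer_group S zeta y = rad_set Xi.
    apply/setP => s; apply/idP/idP => [|sR].
      rewrite (rad_kummer Xr x0 yx XE) !inE GSz => /andP[sN ->].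
      by rewrite andbT; exact: NBz.
    rewrite inE GSz (subsetP sDN) //=.
    by move: sR; rewrite (rad_kummer Xr x0 yx XE) inE => /andP[].
  rewrite GSz kN in iN.
  apply/eqP; rewrite eqEcard sNB /=.
  by rewrite -(Lagrange sDN) -(Lagrange (subset_trans sDN sNB)) /= iN iX.
left; apply/eqP; rewrite eqEsubset sDN andbT; apply/subsetP => s sN.
apply/rad_setP; split; first exact: subsetP sNB _ sN.
by move=> x y x0 Xx yx; rewrite -YX in Xx; case: Xx => _ /(_ x y x0 erefl yx); apply.
Qed.

Lemma rad_inj k1 k2 Xi1 Xi2 : has_dim k1 Xi1 -> has_dim k2 Xi2 ->
  has_roots Xi1 -> has_roots Xi2 -> rad_set Xi1 = rad_set Xi2 -> Xi1 = Xi2.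
Proof.
have sub k X1 X2 : has_dim k X2 -> has_roots X1 -> has_roots X2 ->
    rad_set X1 = rad_set X2 -> (X1 `<=` X2)%classic.
  move=> dX r1 r2 RR v; have [x x0 ->] := pcl_surj v => Xx; have [y yx] := r1 x x0 Xx.
  by apply: (rad_complete dX r2 x0 yx) => s; rewrite -RR => /rad_setP[_]; apply; eassumption.
move=> d1 d2 r1 r2 RR; apply/seteqP.
by split; [exact: (sub _ _ _ d2 r1 r2 RR)|exact: (sub _ _ _ d1 r2 r1 (esym RR))].
Qed.

(** [r] independent classes with roots in [M] give a subgroup of index [p ^ r] in the finite group
    [Bz], which bounds [r]. *)
Lemma exists_dim_roots Xi : GRing.submod_closed [in Xi] -> has_roots Xi -> exists r, has_dim r Xi.
Proof.
move=> Xsub Xr; apply: (exists_dim (n := #|Bz|) Xsub) => r b Xb ib.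
have [x [x0 bE]] := pcl_choice b.
have Xx i : Xi (pc (x i)) by rewrite -[pc _](congr1 (@^~ i) bE).
have [y yE] := choice (fun i => Xr (x i) (x0 i) (Xx i)).
have := kummer_index_indep x0 yE; rewrite -bE => /(_ ib) iE.
have : (p ^ r <= #|Bz|)%N by rewrite -iE; exact: leq_imset_card.
by apply: leq_trans; apply: ltnW; rewrite ltn_expl // prime_gt1.
Qed.

(** [Xi] consists of the classes with a root fixed by [D]. For a submodule [Y] of [Xi], [rad_set Y]
    is normal between [D] and [B], hence one of them; [rad_inj] and the index turn this into
    irreducibility. *)
Lemma rad_surj k (D : {group gal_of {:M}}) : chief_factor G D B -> #|B : D|%g = (p ^ k)%N ->
  exists Xi, [/\ irreducible_submodule Xi, has_dim k Xi, has_roots Xi & rad_set Xi = D].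
Proof.
move=> chief iD; have /chief_factorP[nD nB prDB minD] := chief; have sDB := proper_sub prDB.
have DBz s : s \in D -> s \in Bz by rewrite gal_zetaE => /(subsetP sDB).
pose Xi : set (pclasses E p_pr) := fun v => exists x y,
  [/\ x != 0, v = pc x, y ^+ p = h x & {in D, forall s, s y = y}].
have fixD x y : x != 0 -> y ^+ p = h x -> Xi (pc x) -> {in D, forall s, s y = y}.
  move=> x0 yx [x' [y' [x'0 xx' yx' Dy']]] s sD.
  by apply: (fix_class (DBz s sD) x0 x'0 xx' yx yx'); exact: Dy'.
have Xr : has_roots Xi.
  move=> x x0 [x' [y' [x'0 xx' yx' Dy']]].
  move: xx' => /pcl_eq; rewrite x0 x'0 => /(_ isT isT)[z z0 ->].
  by exists (y' * h z); rewrite exprMn yx' lrM lrX.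
have Xsub : is_submodule Xi.
  split; first split=> [|a u v]; rewrite ?classical_sets.inE.
  - exists 1, 1; rewrite oner_neq0 pcl1 expr1n; split=> //; first exact/esym/rmorph1.
    by move=> s _; exact: rmorph1.
  - move=> [x1 [y1 [x10 -> yx1 D1]]] [x2 [y2 [x20 -> yx2 D2]]].
    exists (x1 ^+ a * x2), (y1 ^+ a * y2); split.
    + by rewrite mulf_neq0 ?expf_neq0.
    + by rewrite pclM ?expf_neq0 // pclX.
    + by rewrite lrM lrX exprMn -yx1 -yx2 -!exprM mulnC.
    + by move=> s sD; rewrite gal_mulr gal_expr D1 // D2.
  - move=> t x tG x0 [x' [y' [x'0 xx' yx' Dy']]].
    have [y yx] := Xr x x0 (ex_intro _ x' (ex_intro _ y' (And4 x'0 xx' yx' Dy'))).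
    have [sg sgE] := gal_extend h t.
    exists (t x), (sg y); split; [by rewrite fmorph_eq0| by []|by rewrite sgE -yx gal_expr|].
    move=> s sD; apply: conj_fix nD sD _; apply: (fixD x) => //.
    by exists x', y'.
have radE (Y : set _) : is_submodule Y -> (Y `<=` Xi)%classic -> rad_set Y = D \/ rad_set Y = B.
  move=> Ysub YX; apply: (minD (rad_group Y)); [exact: rad_normal| |exact: rad_sub].
  apply/subsetP => s sD; apply/rad_setP; split; first exact: (subsetP sDB).
  by move=> x y x0 Yx yx; apply: (fixD x) => //; exact: YX.
have pBD : (p.-group (B / D))%g.
  rewrite /pgroup card_quotient; last exact: subset_trans (normal_sub nB) (normal_norm nD).
  by rewrite iD pnatX pnat_id.
(* Hilbert 90 supplies a root outside [E] fixed by [D], so that [rad_set Xi] is not [B]. *)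
have [y [yB ynB Dy]] := exists_pth_root p_pr M_gal zeta_prim zetaE
   (normalS sDB (normal_sub nB) nD) prDB pBD.
have [x xE] : exists x, y ^+ p = h x by apply/mem_imgP.
have y0 : y != 0 by apply: contraNneq ynB => ->; rewrite mem0v.
have x0 : x != 0 by rewrite -lr_eq0 -xE expf_neq0.
have Xx : Xi (pc x) by exists x, y.
have radX : rad_set Xi = D.
  have [//|RB] := radE Xi Xsub (fun v => id).
  case/negP: ynB; apply: (mem_of_gal_fixed M_gal) => s.
  by rewrite -RB => /rad_setP[_]; apply; eassumption.
have [r dX] := exists_dim_roots Xsub.1 Xr.
have rk : r = k.
  have := rad_index dX Xr; rewrite radX gal_zetaE iD => /eqP; rewrite eqn_exp2l ?prime_gt1 //.
  by move=> /eqP.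
subst r; exists Xi; split=> //; split=> //.
  move=> X0; have : pc x = 0 by move: Xx; rewrite X0.
  move=> /(pcl_eq0 x0)[z z0 xz]; case/negP: ynB.
  have [||i ->] := @root_unity_mul y (h z); rewrite ?lr_eq0 //.
    by rewrite xE xz lrX.
  by rewrite memvM ?mem_img // rpredX.
move=> Y Ysub YX; have Yr : has_roots Y by move=> u u0 /YX; exact: Xr.
have [r dY] := exists_dim_roots Ysub.1 Yr.
have [RD|RB] := radE Y Ysub YX; [right|left].
  by apply: rad_inj dY dX Yr Xr _; rewrite RD radX.
have r0 : r = 0%N.
  have := rad_index dY Yr; rewrite RB gal_zetaE indexgg => /esym/eqP.
  by rewrite -[X in _ == X](expn0 p) eqn_exp2l ?prime_gt1 // => /eqP.
subst r; have [b [Yb _]] := dY; apply/seteqP; split=> [v /Yb[c ->]|v ->].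
  by rewrite big_ord0.
by apply/Yb; exists (fun=> 0); rewrite big_ord0.
Qed.

End KummerClasses.

Lemma pchar0_padic (p : nat) (Q : fieldType) (a : Q -> rat) (K : fieldExtType Q) :
  prime p -> is_Qp p a -> [pchar K] =i pred0.
Proof.
move=> p_pr hQ q; have hw := ext_abs_is_absval p_pr hQ K.
rewrite !inE; apply/negP => /andP[q_pr /eqP q0].
have [qp|qp] := eqVneq q p; first by have := av_p_neq0 hw; rewrite -qp q0 eqxx.
by have := av_prime hw q_pr qp; rewrite q0 (av0 hw) => /esym/eqP; rewrite oner_eq0.
Qed.

Lemma exists_prim_root (p : nat) (F : closedFieldType) : prime p -> [pchar F] =i pred0 ->
  exists z : F, p.-primitive_root z.
Proof.
move=> p_pr char0; have p1 := prime_gt1 p_pr.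
have szf : size (\poly_(i < p) (1 : F)) = p by rewrite size_poly_eq ?oner_neq0.
have /closed_rootP[z rz] : size (\poly_(i < p) (1 : F)) != 1%N by rewrite szf gtn_eqF.
exists z; have sz : \sum_(i < p) z ^+ i = 0.
  by move/rootP: rz; rewrite horner_poly; under eq_bigr do rewrite mul1r.
have zp : z ^+ p = 1 by apply/eqP; rewrite -subr_eq0 subrX1 sz mulr0.
have [n zn np] := prim_order_exists (prime_gt0 p_pr) zp.
have /orP[/eqP n1|/eqP <- //] : (n == 1%N) || (n == p).
  by case/primeP: p_pr => _; apply.
have z1 : z = 1 by have := prim_expr_order zn; rewrite n1 expr1.
move: sz; rewrite z1; under eq_bigr do rewrite expr1n.
rewrite sumr_const card_ord => p0; have := char0 p.
by rewrite !inE p_pr p0 eqxx.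
Qed.

Lemma exists_root_power (F : closedFieldType) (x : F) n : (0 < n)%N -> exists y, y ^+ n = x.
Proof.
move=> n0; have /closed_rootP[y] : size ('X^n - x%:P) != 1%N.
  by rewrite size_XnsubC // eqSS -lt0n.
by rewrite rootE !hornerE subr_eq0 => /eqP yx; exists y.
Qed.

Section ExistsExt.

Variables (p : nat) (p_pr : prime p) (Q : fieldType) (a : Q -> rat) (hQ : is_Qp p a).
Variables (K : fieldExtType Q) (Omega : closedFieldType) (iota : {rmorphism K -> Omega}).
Hypothesis Omega_alg : forall x : Omega, algebraicOver iota x.

Lemma exists_padic_ext k : (0 < k)%N ->
  exists (L : fieldExtType K) (l : embedding iota L), \dim {:L} = (p ^ k)%N /\ no_intermediate L.
Proof.
move=> k0; have char0 := pchar0_padic K p_pr hQ.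
have [pi pi_unif] := exists_uniformizer p_pr (gal_abs_is_absval p_pr hQ K^o).
have q1 : (1 < p ^ k)%N by rewrite -[X in (X < _)%N](expn0 p) ltn_exp2l // prime_gt1.
pose f := 'X^(p ^ k) + iota pi *: 'X + (iota pi)%:P.
have sf : size f = (p ^ k).+1.
  rewrite /f -addrA size_polyDl size_polyXn // ltnS; apply: leq_trans (size_polyD _ _) _.
  rewrite geq_max; apply/andP; split.
    by apply: leq_trans (size_scale_leq _ _) _; rewrite size_polyX.
  by rewrite (leq_trans (size_polyC_leq1 _)) // ltnW.
have /closed_rootP[z rz] : size f != 1%N by rewrite sf eqSS gtn_eqF // ltnW.
have [M [m [M_gal mz]]] := exists_splitting_extension Omega_alg char0 [:: z].
have [al alz] := mz z (mem_head _ _).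
have r_al : root (eisenstein_poly p M k pi) al.
  rewrite rootE eisensteinE -(inj_eq (emb_inj (l := m))) rmorph0 !rmorphD rmorphM rmorphXn /=.
  by rewrite !embK alz; move: rz; rewrite rootE /f !hornerE.
have hw := gal_abs_is_absval p_pr hQ M.
have unif := uniformizer_alg p_pr hQ M pi_unif.
pose T := <<1; al>>%AS.
have dT : \dim T = (p ^ k)%N.
  by rewrite dim_Fadjoin (adjoin_degree_eisenstein p_pr hw k0 unif r_al) dimv1 muln1.
have maxT : maximal 'Gal({:M} / T)%G 'Gal({:M} / 1)%G.
  apply/(maximal_gal M_gal); first by rewrite dT.
  by move=> N; exact: (eisenstein_no_intermediate p_pr hw k0 unif r_al M_gal).
have iT : #|'Gal({:M} / 1)%G : 'Gal({:M} / T)|%g = (p ^ k)%N by rewrite gal_index.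
have [L [l [_ [_ _ extL]]]] := exists_ext m M_gal q1 maxT iT.
by exists L, l.
Qed.

End ExistsExt.

Section RadicalModel.

Variables (p : nat) (p_pr : prime p) (K : fieldType) (Omega : closedFieldType).
Variable iota : {rmorphism K -> Omega}.
Variables (M : splittingFieldType K) (m : embedding iota M).
Hypothesis M_gal : galois 1 {:M}.
Variables (E : splittingFieldType K) (e : embedding iota E) (h : {lrmorphism E -> M}).
Hypothesis mh : forall x, m (h x) = e x.
Variables (zeta : M) (zeta_prim : p.-primitive_root zeta).
Implicit Type Xi : set (pclasses E p_pr).

(** [radical_extension] adjoins all the roots in [Omega]; [has_roots] puts one of each in [M], and
    [zeta] provides the others. *)
Lemma radical_model Xi : has_roots h Xi ->
  exists T : {subfield M}, (m @` [set` T])%classic = radical_extension e Xi /\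
    ('Gal({:M} / T) = rad_set h Xi)%g.
Proof.
move=> Xr; pose A := (range e `|`
  [set y | exists x : E, [/\ x != 0, Xi (pcl p_pr x) & y ^+ p = e x]])%classic.
have [|c|T [TE TG]] := generated_model (m := m) (A := A).
- move=> y [[x _ <-]|[x [x0 Xx yx]]]; first by exists (h x).
  have [u ux] := Xr x x0 Xx.
  have mz : p.-primitive_root (m zeta) by rewrite fmorph_primitive_root.
  have u0 : m u != 0 by rewrite fmorph_eq0 (root_neq0 p_pr x0 ux).
  have [|i iE] := prim_rootP mz (x := y / m u).
    by rewrite expr_div_n yx -mh -ux rmorphXn divff // expf_neq0.
  by exists (zeta ^+ i * u); rewrite rmorphM rmorphXn -iE mulfVK.
- by apply: generated_sub; left; exists c%:A; rewrite ?embK.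
exists T; split=> //; apply/setP => s; apply/idP/rad_setP => [/TG sA|[/mem_gal_img sB sX]].
  split; first by apply/mem_gal_img => x; apply: sA; left; exists x.
  by move=> x y x0 Xx yx; apply: sA; right; exists x; rewrite -mh -yx rmorphXn.
apply/TG => y [[x _]|[x [x0 Xx yx]]]; first by rewrite -mh => /emb_inj <-; exact: sB.
by apply: (sX x) => //; apply: (emb_inj (l := m)); rewrite rmorphXn yx mh.
Qed.

Lemma has_roots_of_sub Xi : (radical_extension e Xi `<=` range m)%classic -> has_roots h Xi.
Proof.
move=> sub x x0 Xx; have [y yx] := exists_root_power (e x) (prime_gt0 p_pr).
have [|u _ uy] := sub y; first by apply: generated_sub; right; exists x.
by exists u; apply: (emb_inj (l := m)); rewrite rmorphXn mh uy.
Qed.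

Lemma has_roots_of_basis Xi r (x : 'I_r -> E) (y : 'I_r -> M) : (forall i, x i != 0) ->
  (forall i, y i ^+ p = h (x i)) ->
  (forall v, Xi v -> exists c : 'I_r -> 'F_p, v = \sum_i c i *: pcl p_pr (x i)) ->
  has_roots h Xi.
Proof.
move=> x0 yx XE u u0 /XE[c uE].
have [x'0 uE'] : \prod_i x i ^+ c i != 0 /\ pcl p_pr u = pcl p_pr (\prod_i x i ^+ c i).
  by rewrite pcl_prod // uE; split=> //; apply/prodf_neq0 => i _; rewrite expf_neq0.
move: uE' => /pcl_eq; rewrite u0 x'0 => /(_ isT isT)[z z0 ->].
exists (\prod_i y i ^+ c i * h z); rewrite exprMn lrM lr_prod lrX -prodrXl; congr (_ * _).
by apply: eq_bigr => i _; rewrite lrX -yx -!exprM mulnC.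
Qed.

End RadicalModel.

(** * The property (C_k) *)

Section PropertyC.

Variables (p : nat) (p_pr : prime p) (K : fieldType) (Omega : closedFieldType).
Variable iota : {rmorphism K -> Omega}.
Hypotheses (Omega_alg : forall x : Omega, algebraicOver iota x) (char0 : [pchar K] =i pred0).
Variables (E : splittingFieldType K) (e : embedding iota E) (k : nat).
Hypothesis k_gt0 : (0 < k)%N.

Let q_gt1 : (1 < p ^ k)%N.
Proof. by rewrite -[X in (X < _)%N](expn0 p) ltn_exp2l // prime_gt1. Qed.

Let M_gal (M : splittingFieldType K) : galois 1 {:M} := galois_of_char0 char0 M.

Lemma compositum_rad (M : splittingFieldType K) (m : embedding iota M) (h : {lrmorphism E -> M})
    (zeta : M) (L : fieldExtType K) (l : embedding iota L) (g : {lrmorphism L -> M})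
    (Xi : set (pclasses E p_pr)) :
  (forall x, m (h x) = e x) -> (forall x, m (g x) = l x) -> p.-primitive_root zeta ->
  has_roots h Xi ->
  compositum l e = radical_extension e Xi <->
  ('Gal({:M} / img g) :&: 'Gal({:M} / img h) = rad_set h Xi)%g.
Proof.
move=> mh mg zp Xr; have [T1 [<- <-]] := compositum_model mg mh.
by have [T2 [<- <-]] := radical_model mh zp Xr; exact: eq_image_gal.
Qed.

Lemma roots_of_compositum (M : splittingFieldType K) (m : embedding iota M)
    (h : {lrmorphism E -> M}) (L : fieldExtType K) (l : embedding iota L) (g : {lrmorphism L -> M})
    (Xi : set (pclasses E p_pr)) :
  (forall x, m (h x) = e x) -> (forall x, m (g x) = l x) ->
  compositum l e = radical_extension e Xi -> has_roots h Xi.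
Proof.
move=> mh mg LX; have [T [TE _]] := compositum_model mg mh.
by apply: (has_roots_of_sub mh); rewrite -LX -TE => _ [x _ <-]; exists x.
Qed.

Lemma model_of_radical (M : splittingFieldType K) (m : embedding iota M) (h : {lrmorphism E -> M})
    (zeta : M) (L : fieldExtType K) (l : embedding iota L) (Xi : set (pclasses E p_pr)) :
  (forall x, m (h x) = e x) -> p.-primitive_root zeta -> has_roots h Xi ->
  compositum l e = radical_extension e Xi ->
  exists g : {lrmorphism L -> M}, forall x, m (g x) = l x.
Proof.
move=> mh zp Xr LX; have [T [TE _]] := radical_model mh zp Xr.
apply: exists_model => x; have : radical_extension e Xi (l x).
  by rewrite -LX; apply: generated_sub; left; exists x.
by rewrite -TE => -[y _ yx]; exists y.
Qed.

Lemma exists_big_model (zs : seq Omega) : exists (M : splittingFieldType K) (m : embedding iota M)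
    (zeta : M), p.-primitive_root zeta /\ forall z, z \in zs -> exists y, m y = z.
Proof.
have char0W : [pchar Omega] =i pred0 by move=> q; rewrite (fmorph_pchar iota) char0.
have [z zp] := exists_prim_root p_pr char0W.
have [M [m [_ mz]]] := exists_splitting_extension Omega_alg char0 (z :: zs).
have [zeta zE] := mz z (mem_head _ _); exists M, m, zeta; split.
  by rewrite -(fmorph_primitive_root m) zE.
by move=> t tz; apply: mz; rewrite inE tz orbT.
Qed.

Definition basis_images (L : fieldExtType K) (l : embedding iota L) : seq Omega :=
  [seq l v | v <- vbasis {:L}].

Section Elim.

Hypothesis E_C : property_C p_pr e k.

(** Kummer theory over [E(zeta)] gives [A :&: B] the index [p ^ k] in [Bz], while its index in [B]
    is at most [#|G : A| = p ^ k]; so [Bz = B]. *)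
Lemma zeta_of_property_C : (exists (L : fieldExtType K) (l : embedding iota L),
    \dim {:L} = (p ^ k)%N /\ no_intermediate L) ->
  exists z : E, p.-primitive_root z.
Proof.
move=> [L [l extL]]; have [C1 _ _] := E_C.
have [M [m [zeta [zp mz]]]] := exists_big_model (basis_images l ++ basis_images e).
have [g mg] : exists g : {lrmorphism L -> M}, forall x, m (g x) = l x.
  by apply: exists_model; apply: range_vbasis => z zL; apply: mz; rewrite mem_cat zL.
have [h mh] : exists h : {lrmorphism E -> M}, forall x, m (h x) = e x.
  by apply: exists_model; apply: range_vbasis => z zL; apply: mz; rewrite mem_cat zL orbT.
have [Xi [[[irrX dX] LX] _]] := C1 L l extL.
have Xr := roots_of_compositum mh mg LX.
have [maxA iA] := (ext_maximal (M_gal M) g q_gt1).1 extL.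
have DE := (compositum_rad mh mg zp Xr).1 LX.
set G := 'Gal({:M} / 1)%G in maxA iA; set A := 'Gal({:M} / img g)%G in maxA iA DE.
set B := 'Gal({:M} / img h)%G in DE.
pose Bz := 'Gal({:M} / <<img h; zeta>>)%G.
have sBz : Bz \subset B by exact: galS (subv_adjoin _ _).
have X0 : Xi 0 by case: irrX => -[[]]; rewrite classical_sets.inE.
have sDBz : (A :&: B)%g \subset Bz by rewrite DE; exact: rad_sub_zeta.
have iz : #|Bz : (A :&: B)%g|%g = (p ^ k)%N by rewrite DE; exact: (rad_index (M_gal M) zp dX Xr).
have iB : (#|B : (A :&: B)%g|%g <= p ^ k)%N.
  rewrite -iA setIC indexgI; apply: subset_leq_card; apply: imsetS; exact: sub_gal.
have BE : Bz :=: B.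
  apply/eqP; rewrite eqEcard sBz /=.
  rewrite -(Lagrange (subsetIr A B)) -(Lagrange sDBz) leq_mul2l iz; apply/orP; right; exact: iB.
have : zeta \in img h.
  apply: (mem_of_gal_fixed (M_gal M)) => s sB.
  have /mem_galfP -> // : s \in Bz by rewrite BE.
  exact: memv_adjoin.
by move=> /mem_imgP[z zE]; exists z; move: zp; rewrite zE fmorph_primitive_root.
Qed.

(** For the fibres: [A1 :&: B = A2 :&: B] gives [L1] and [L2] the same [Xi], and [(C_k)] makes both
    isomorphic to one [L]. *)
Lemma chief_corr_of_property_C (M : splittingFieldType K) (m : embedding iota M)
    (h : {lrmorphism E -> M}) (z : E) :
  (forall x, m (h x) = e x) -> p.-primitive_root z ->
  chief_corr 'Gal({:M} / 1)%G 'Gal({:M} / img h)%G (p ^ k).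
Proof.
move=> mh zp; have [C1 C2 _] := E_C.
have hz : p.-primitive_root (h z) by rewrite fmorph_primitive_root.
have zE : h z \in img h by exact: mem_img.
split.
- move=> A maxA iA; have [L [l [g [mg gA extL]]]] := exists_ext m (M_gal M) q_gt1 maxA iA.
  have [Xi [[[irrX dX] LX] _]] := C1 L l extL.
  have Xr := roots_of_compositum mh mg LX.
  have := (compositum_rad mh mg hz Xr).1 LX; rewrite gA => DE.
  have /chief_factorP[nD _ prD _] := rad_chief (M_gal M) hz zE k_gt0 irrX dX Xr.
  rewrite DE; split=> //; apply: contraL prD => BA.
  by rewrite -[rad_group h Xi : {set _}]/(rad_set h Xi) -DE (setIidPr BA) properxx.
- move=> D chD iD.
  have [Xi [irrX dX Xr XD]] := rad_surj p_pr (M_gal M) hz zE chD iD.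
  have [L [l [extL LX _]]] := C2 Xi (conj irrX dX).
  have [g mg] := model_of_radical mh hz Xr LX.
  have [maxA iA] := (ext_maximal (M_gal M) g q_gt1).1 extL.
  exists 'Gal({:M} / img g)%G; split=> //.
  by rewrite -XD; exact: (compositum_rad mh mg hz Xr).1 LX.
move=> A1 A2 max1 max2 i1 i2 AE.
have [L1 [l1 [g1 [mg1 gA1 ext1]]]] := exists_ext m (M_gal M) q_gt1 max1 i1.
have [L2 [l2 [g2 [mg2 gA2 ext2]]]] := exists_ext m (M_gal M) q_gt1 max2 i2.
have [Xi [[[irrX dX] LX1] _]] := C1 L1 l1 ext1.
have Xr := roots_of_compositum mh mg1 LX1.
have LX2 : compositum l2 e = radical_extension e Xi.
  by rewrite -LX1; apply/(compositum_eq (M_gal _) mg2 mg1 mh); rewrite gA1 gA2 AE.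
have [L [l [extL LX iso]]] := C2 Xi (conj irrX dX).
have [g mg] := model_of_radical mh hz Xr LX.
have [s1 sE1] := (iso_conj (M_gal M) g g1).1 ((iso L1 l1 ext1).1 LX1).
have [s2 sE2] := (iso_conj (M_gal M) g g2).1 ((iso L2 l2 ext2).1 LX2).
exists (s1^-1 * s2)%g; rewrite -gA1 -gA2 sE1 sE2 -conjsgM mulgA mulgV mul1g //.
Qed.

End Elim.

Section Intro.

Variable z : E.
Hypothesis z_prim : p.-primitive_root z.
Hypothesis big : forall zs : seq Omega, exists (M : splittingFieldType K) (m : embedding iota M)
  (h : {lrmorphism E -> M}), [/\ forall z, z \in zs -> exists y, m y = z,
    forall x, m (h x) = e x & chief_corr 'Gal({:M} / 1)%G 'Gal({:M} / img h)%G (p ^ k)].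

Lemma property_C_of_chief_corr : property_C p_pr e k.
Proof.
split.
- move=> L l extL; have [M [m [h [mz mh [nor ex inj]]]]] := big (basis_images l).
  have [g mg] : exists g : {lrmorphism L -> M}, forall x, m (g x) = l x.
    by apply: exists_model; exact: range_vbasis.
  have hz : p.-primitive_root (h z) by rewrite fmorph_primitive_root.
  have zE : h z \in img h by exact: mem_img.
  have [maxA iA] := (ext_maximal (M_gal M) g q_gt1).1 extL.
  have [nAB BA] := nor _ maxA iA.
  have chD := maximal_chief_factor maxA (gal_img_normal h) nAB BA.
  have [|Xi [irrX dX Xr XD]] := rad_surj p_pr (M_gal M) hz zE chD (k := k).
    by rewrite (maximal_index_mul maxA (gal_img_normal h) BA).
  have LX : compositum l e = radical_extension e Xi by apply/(compositum_rad mh mg hz Xr).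
  exists Xi; split=> // Xi' [[irrX' dX'] LX'].
  have Xr' := roots_of_compositum mh mg LX'.
  apply: (rad_inj (M_gal M) hz dX dX' Xr Xr'); rewrite XD.
  exact: (compositum_rad mh mg hz Xr').1 LX'.
- move=> Xi [irrX dX]; have [b [Xb _]] := dX.
  have [x [x0 bE]] := pcl_choice b.
  have [ys ysE] := choice (fun i => exists_root_power (e (x i)) (prime_gt0 p_pr)).
  have rootsX (M : splittingFieldType K) (m : embedding iota M) (h : {lrmorphism E -> M}) :
      (forall x, m (h x) = e x) ->
      (forall z, z \in [seq ys i | i <- enum 'I_k] -> exists y, m y = z) -> has_roots h Xi.
    move=> mh mz.
    have [y yE] := choice (fun i => mz (ys i) (map_f ys (mem_enum 'I_k i))).
    apply: (has_roots_of_basis (x := x) (y := y)) => [//|i|v /Xb[c ->]].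
      by apply: (emb_inj (l := m)); rewrite rmorphXn yE ysE mh.
    by exists c; rewrite bE.
  have [M [m [h [mz mh [nor ex inj]]]]] := big [seq ys i | i <- enum 'I_k].
  have Xr := rootsX M m h mh mz.
  have hz : p.-primitive_root (h z) by rewrite fmorph_primitive_root.
  have zE : h z \in img h by exact: mem_img.
  have chD := rad_chief (M_gal M) hz zE k_gt0 irrX dX Xr.
  have [|A [maxA iA AE]] := ex _ chD.
    by rewrite -(rad_index (M_gal M) hz dX Xr) gal_zetaE.
  have [L [l [g [mg gA extL]]]] := exists_ext m (M_gal M) q_gt1 maxA iA.
  have LX : compositum l e = radical_extension e Xi.
    by apply/(compositum_rad mh mg hz Xr); rewrite gA AE.
  exists L, l; split=> // L' l' extL'.
  (* [M] need not contain [L']; the comparison of [L] with [L'] takes place in a second model. *)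
  have [M' [m' [h' [mz' mh' [nor' ex' inj']]]]] :=
    big ([seq ys i | i <- enum 'I_k] ++ basis_images l ++ basis_images l').
  have Xr' : has_roots h' Xi.
    by apply: (rootsX M' m' h' mh') => t tz; apply: mz'; rewrite mem_cat tz.
  have [g1 mg1] : exists g : {lrmorphism L -> M'}, forall x, m' (g x) = l x.
    by apply: exists_model; apply: range_vbasis => t tz; apply: mz'; rewrite !mem_cat tz orbT.
  have [g2 mg2] : exists g : {lrmorphism L' -> M'}, forall x, m' (g x) = l' x.
    by apply: exists_model; apply: range_vbasis => t tz; apply: mz'; rewrite !mem_cat tz !orbT.
  have [max1 i1] := (ext_maximal (M_gal M') g1 q_gt1).1 extL.
  have [max2 i2] := (ext_maximal (M_gal M') g2 q_gt1).1 extL'.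
  split=> [LX'|/(iso_conj (M_gal M') g1 g2)[s sE]].
    apply/(iso_conj (M_gal M') g1 g2); apply: inj' => //.
    by apply/(compositum_eq (M_gal _) mg1 mg2 mh'); rewrite LX LX'.
  rewrite -LX; apply/(compositum_eq (M_gal _) mg2 mg1 mh'); rewrite sE.
  (* Both [B] and [A :&: B] are normal, so conjugating [A] does not change its intersection with
     [B]. *)
  have nB := gal_img_normal h'; have [nAB _] := nor' _ max1 i1.
  have sG := mem_galf s.
  by rewrite -[in LHS](normsP (normal_norm nB) s sG) -conjIg (normsP (normal_norm nAB) s sG).
move=> L l extL; have [M [m [h [mz mh [nor ex inj]]]]] := big (basis_images l).
have [g mg] : exists g : {lrmorphism L -> M}, forall x, m (g x) = l x.
  by apply: exists_model; exact: range_vbasis.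
have [maxA iA] := (ext_maximal (M_gal M) g q_gt1).1 extL.
have [nAB BA] := nor _ maxA iA.
exact: (split_compositum_model char0 mg mh maxA nAB BA).
Qed.

End Intro.

End PropertyC.

(** * The field fixed by the p-core *)

Section RestrictionMorphism.

Variables (p : nat) (K : fieldType) (M F : splittingFieldType K) (F1 : fieldExtType K).
Hypothesis F_gal : galois 1 {:F}.
Variables (h : {lrmorphism F -> M}) (j : {lrmorphism F1 -> F}).
Hypothesis img_j : (img j : {vspace F}) = fixedField 'O_p('Gal({:F} / 1))%g.
Local Notation G := ('Gal({:M} / 1))%G.
Local Notation B := ('Gal({:M} / img h))%G.
Local Notation B1 := ('Gal({:M} / img (comp_lr h j)))%G.

(** Restriction to [F] maps [G] onto [Gal(F/K)] with kernel [B], and [B1] is the preimage of the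
    [p]-core. *)
Lemma pcore_preimage_gal :
  [/\ B \subset B1, (B1 <| G)%g, (p.-group (B1 / B))%g & ('O_p(G / B1) = 1)%g].
Proof.
have [r rE] := choice (gal_restrict h).
have galF : ('Gal({:F} / img j) = 'O_p('Gal({:F} / 1)))%g.
  by rewrite img_j; exact: gal_fixedField.
apply: (preimage_pcore (H := 'Gal({:F} / 1)%G) (f := r)).
- move=> s t _ _; apply/eqP/gal_eqP => x _; apply: (fmorph_inj h).
  by rewrite galfM [LHS]rE [RHS]rE rE galfM.
- apply/setP => t; rewrite [RHS]mem_galf; apply/imsetP.
  have [s sE] := gal_extend h t; exists s; first exact: mem_galf.
  by apply/eqP/gal_eqP => x _; apply: (fmorph_inj h); rewrite [RHS]rE; exact: sE.
- move=> s; rewrite mem_galf /=; apply/idP/eqP => [/mem_gal_img sB|r1].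
    by apply/eqP/gal_eqP => x _; apply: (fmorph_inj h); rewrite gal_id [LHS]rE sB.
  by apply/mem_gal_img => x; rewrite -rE r1 gal_id.
- move=> s; rewrite mem_galf /= -galF; apply/idP/idP => /mem_gal_img sB; apply/mem_gal_img => x.
    by apply: (fmorph_inj h); rewrite [LHS]rE; exact: sB.
  by have := congr1 h (sB x); rewrite rE.
Qed.

End RestrictionMorphism.

(** The degree of [z] over this field is less than [p], and it is a power of [p] as the index of a
    subgroup of a [p]-group; so it is 1. *)
Lemma prim_root_in_pcore_field (p : nat) (K : fieldType) (F : splittingFieldType K) (z : F) :
  prime p -> galois 1 {:F} -> p.-primitive_root z ->
  z \in fixedField 'O_p('Gal({:F} / 1))%g.
Proof.
move=> p_pr F_gal zp; pose O := 'O_p('Gal({:F} / 1))%G; pose T := [aspace of fixedField O].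
pose d := adjoin_degree T z.
have GT : ('Gal({:F} / T) = O)%g by exact: gal_fixedField.
have d0 : (0 < d)%N by rewrite /d -[adjoin_degree _ _]prednK.
have sO : ('Gal({:F} / <<T; z>>) \subset O)%g by rewrite -GT; exact: galS (subv_adjoin _ _).
have iO : (#|O : 'Gal({:F} / <<T; z>>)|)%g = d.
  have t0 : (0 < \dim T)%N by rewrite adim_gt0.
  apply/eqP; rewrite -(eqn_pmul2l t0); apply/eqP.
  rewrite -{1}(gal_index F_gal T) GT Lagrange_index ?pcore_sub //.
  by rewrite (gal_index F_gal <<T; z>>%AS) dim_Fadjoin mulnC.
have pd : p.-nat d by rewrite -iO; apply: pnat_dvd (pcore_pgroup p _); exact: dvdn_indexg.
have cop : coprime p d.
  by rewrite prime_coprime // gtnNdvd // /d (adjoin_degree_zeta p_pr T zp).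
have d1 : d = 1%N by apply: (pnat_dvd_coprime_eq1 pd (dvdnn d) cop).
have -> : fixedField O = <<T; z>>%VS; last exact: memv_adjoin.
by apply/eqP; rewrite eqEdim subv_adjoin dim_Fadjoin -/d d1 mul1n /=.
Qed.

Theorem corollary3p4 (p : nat) (p_pr : prime p)
    (Qp : fieldType) (absp : Qp -> rat) (Qp_completion : is_Qp p absp)
    (K : fieldExtType Qp)
    (Omega : closedFieldType) (iota : {rmorphism K -> Omega})
    (Omega_alg : forall x : Omega, algebraicOver iota x)
    (k : nat) (k_gt0 : (0 < k)%N)
    (F : splittingFieldType K) (f : embedding iota F) (F_galois : galois 1 {:F})
    (F_C : property_C p_pr f k)
    (F' : splittingFieldType K) (f' : embedding iota F') (F'_galois : galois 1 {:F'}) :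
  ((exists S : {subfield F'},
      (f' @` [set` S])%classic = range f /\ coprime (\dim_S {:F'}) p) ->
    property_C p_pr f' k) /\
  (range f' = (f @` [set` fixedField 'O_p('Gal({:F} / 1))%g])%classic ->
    property_C p_pr f' k).
Proof.
have char0 := pchar0_padic K p_pr Qp_completion.
have [z zp] := zeta_of_property_C Omega_alg char0 k_gt0 F_C
  (exists_padic_ext p_pr Qp_completion Omega_alg k_gt0).
have corr (M : splittingFieldType K) (m : embedding iota M) (h : {lrmorphism F -> M}) :
    (forall x, m (h x) = f x) -> chief_corr 'Gal({:M} / 1)%G 'Gal({:M} / img h)%G (p ^ k).
  by move=> mh; exact: (chief_corr_of_property_C char0 k_gt0 F_C mh zp).
have big (E : splittingFieldType K) (e : embedding iota E) (zs : seq Omega) :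
    exists (M : splittingFieldType K) (m : embedding iota M) (h : {lrmorphism E -> M}),
      (forall z, z \in zs -> exists y, m y = z) /\ forall x, m (h x) = e x.
  have [M [m [_ [_ mz]]]] := exists_big_model p_pr Omega_alg char0 (zs ++ basis_images e).
  have [h mh] : exists h : {lrmorphism E -> M}, forall x, m (h x) = e x.
    by apply: exists_model; apply: range_vbasis => t tE; apply: mz; rewrite mem_cat tE orbT.
  by exists M, m, h; split=> // t tz; apply: mz; rewrite mem_cat tz.
split=> [[S [SE cop]]|F'E].
  have [j jE] : exists j : {lrmorphism F -> F'}, forall x, f' (j x) = f x.
    apply: exists_model => x; have : range f (f x) by exists x.
    by rewrite -SE => -[y _ yx]; exists y.
  have jS : (img j : {vspace F'}) = S.
    apply/vspaceP => y; apply/mem_imgP/idP => [[x ->]|yS].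
      have : range f (f x) by exists x.
      by rewrite -SE => -[y' y'S]; rewrite -jE => /emb_inj <-.
    have : (f' @` [set` S])%classic (f' y) by exists y.
    by rewrite SE => -[x _]; rewrite -jE => /emb_inj <-; exists x.
  apply: (property_C_of_chief_corr p_pr char0 k_gt0 (z := j z)).
    by rewrite fmorph_primitive_root.
  move=> zs; have [M [m [h [mz mh]]]] := big F' f' zs; exists M, m, h; split=> //.
  have M_gal := galois_of_char0 char0 M.
  have mhj x : m (comp_lr h j x) = f x by rewrite -jE -mh.
  have sB : 'Gal({:M} / img h)%G \subset 'Gal({:M} / img (comp_lr h j))%G.
    by apply/subsetP => s /mem_gal_img sh; apply/mem_gal_img => x; exact: sh.
  apply: (chief_corr_coprime p_pr (corr M m _ mhj)) => //; try exact: gal_img_normal.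
  (* By the Galois correspondence this index is [[F' : S]]. *)
  rewrite coprime_sym.
  suff -> : #|'Gal({:M} / img (comp_lr h j)) : 'Gal({:M} / img h)|%g = \dim_S {:F'} by [].
  have dS : (0 < \dim S)%N by rewrite adim_gt0.
  apply/eqP; rewrite -(eqn_pmul2l dS) -{1}jS dim_img -(dim_img (comp_lr h j)).
  rewrite -(gal_index M_gal) Lagrange_index ?sub_gal // gal_index // dim_img.
  by rewrite mulnC -dim_sup_field ?subvf.
have [j jE] : exists j : {lrmorphism F' -> F}, forall x, f (j x) = f' x.
  apply: exists_model => x; have : range f' (f' x) by exists x.
  by rewrite F'E => -[y _ yx]; exists y.
have jS : (img j : {vspace F}) = fixedField 'O_p('Gal({:F} / 1))%g.
  apply/vspaceP => y; apply/mem_imgP/idP => [[x ->]|yS].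
    have : range f' (f' x) by exists x.
    by rewrite F'E => -[y' y'S]; rewrite -jE => /emb_inj <-.
  have : (f @` [set` fixedField 'O_p('Gal({:F} / 1))%g])%classic (f y) by exists y.
  by rewrite -F'E => -[x _]; rewrite -jE => /emb_inj <-; exists x.
(* Kummer theory over [F'] needs the primitive root in [F'], here a subfield of [F]. *)
have [z' zz'] : exists z', z = j z'.
  by apply/mem_imgP; rewrite jS; exact: prim_root_in_pcore_field.
apply: (property_C_of_chief_corr p_pr char0 k_gt0 (z := z')).
  by move: zp; rewrite zz' fmorph_primitive_root.
move=> zs; have [M [m [h [mz mh]]]] := big F f zs.
have M_gal := galois_of_char0 char0 M.
have [sB nB1 pB1 Op1] := pcore_preimage_gal h jS.
have [P [I [nP nI pP p'I abGI]]] := ramification_filtration p_pr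
  (gal_abs_is_absval p_pr Qp_completion M) (@gal_abs_gal Qp absp K M).
exists M, m, (comp_lr h j); split=> [//|x|]; first by rewrite /= mh jE.
exact: (chief_corr_pcore p_pr (corr M m h mh) (gal_img_normal h) nB1 sB pB1 Op1 nP nI pP p'I abGI).
Qed.
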